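(* Let $\varphi\in H^\infty+C$ with $\|\varphi\|_\infty\le1$, $\mathbb J\varphi=\bar\varphi$, and suppose $\varphi$ is not unimodular (i.e. $|\varphi|<1$ on a set of positive Lebesgue measure). Then $\|\mathbb H(\varphi)\|<1$.
   Context: $H^2$ ($H^2_-$): Hardy space of the upper (lower) half-plane, identified with boundary values on $\mathbb R$; $\mathbb P_-$ the orthogonal projection of $L^2(\mathbb R)$ onto $H^2_-$; $(\mathbb Jf)(x)=f(-x)$. For $\varphi\in L^\infty(\mathbb R)$, the Hankel operator is $\mathbb H(\varphi)f=\mathbb J\mathbb P_-(\varphi f)$, $f\in H^2$. $H^\infty$: bounded analytic functions in the upper half-plane (boundary values). $C$: continuous functions on $\mathbb R$ with finite limits at $\pm\infty$ that coincide. $H^\infty+C=\{h+g: h\in H^\infty,\ g\in C\}$. *)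

(* Defs.v *)
(* complex numbers are R[i] from mathcomp-real-closed. *)
From HB Require Import structures.
From mathcomp Require Import all_boot all_order all_algebra.
From mathcomp Require Import all_classical all_reals all_analysis.
From mathcomp.real_closed Require Import complex.
Import Order.TTheory GRing.Theory Num.Theory numFieldNormedType.Exports.
Unset Printing Implicit Defensive.
Local Open Scope ring_scope. Local Open Scope classical_set_scope.
Local Open Scope complex_scope.

(* R[i] viewed as a normed space over itself: topology / complex derivative *)
Definition CN (R : realType) := (R[i])^o.

(* squared modulus |z|^2 as a real number *)
Definition sqmod {R : realType} (z : R[i]) : R := complex.Re z ^+ 2 + complex.Im z ^+ 2.

(* Lebesgue measure on the real line *)
Definition leb (R : realType) := @lebesgue_measure R.

(* measurable complex-valued functions on R *)
Definition cmeasurable {R : realType} (f : R -> R[i]) : Prop :=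
  measurable_fun setT (fun x : R => complex.Re (f x)) /\ measurable_fun setT (fun x : R => complex.Im (f x)).

(* L^2(R) *)
Definition L2 {R : realType} (f : R -> R[i]) : Prop :=
  cmeasurable f /\ (\int[leb R]_x (sqmod (f x))%:E < +oo)%E.

(* L^2 norm *)
Definition L2norm {R : realType} (f : R -> R[i]) : R :=
  Num.sqrt (fine (\int[leb R]_x (sqmod (f x))%:E)%E).

(* L^2 inner product <u, w> = \int u conj(w) equal to 0 (real and imaginary parts) *)
Definition L2orth {R : realType} (u w : R -> R[i]) : Prop :=
  (\int[leb R]_x (complex.Re (u x * (w x)^*))%:E = 0)%E /\
  (\int[leb R]_x (complex.Im (u x * (w x)^*))%:E = 0)%E.

(* F is holomorphic (complex differentiable) at every point of D *)
Definition holomorphic_on {R : realType} (D : set R[i]) (F : R[i] -> R[i]) : Prop :=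
  forall z, D z -> derivable (F : CN R -> CN R) (z : CN R) (1 : CN R).

Definition upper_half (R : realType) : set R[i] := [set z | 0 < complex.Im z].
Definition lower_half (R : realType) : set R[i] := [set z | complex.Im z < 0].

(* H^2 of the upper half-plane, identified with boundary values on R:
   f in L^2(R) is the a.e. vertical boundary limit of some F holomorphic in the
   upper half-plane with sup_{y>0} \int |F(x+iy)|^2 dx < oo. *)
Definition H2plus {R : realType} (f : R -> R[i]) : Prop :=
  L2 f /\ exists F : R[i] -> R[i],
    [/\ holomorphic_on (@upper_half R) F,
        exists M : R, forall y : R, 0 < y ->
          (\int[leb R]_x (sqmod (F (Complex x y)))%:E <= M%:E)%E
      & {ae leb R, forall x : R,
          (fun y : R => (F (Complex x y) : CN R)) @ 0^'+ --> (f x : CN R)}].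

(* H^2_- : Hardy space of the lower half-plane (boundary values on R). *)
Definition H2minus {R : realType} (f : R -> R[i]) : Prop :=
  L2 f /\ exists F : R[i] -> R[i],
    [/\ holomorphic_on (@lower_half R) F,
        exists M : R, forall y : R, y < 0 ->
          (\int[leb R]_x (sqmod (F (Complex x y)))%:E <= M%:E)%E
      & {ae leb R, forall x : R,
          (fun y : R => (F (Complex x y) : CN R)) @ 0^'- --> (f x : CN R)}].

(* H^infty: boundary values of bounded analytic functions in the upper half-plane *)
Definition Hinf {R : realType} (h : R -> R[i]) : Prop :=
  exists F : R[i] -> R[i],
    [/\ holomorphic_on (@upper_half R) F,
        exists M : R, forall z : R[i], upper_half R z -> sqmod (F z) <= M
      & {ae leb R, forall x : R,
          (fun y : R => (F (Complex x y) : CN R)) @ 0^'+ --> (h x : CN R)}].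

(* C: continuous functions on R with finite coinciding limits at +oo and -oo *)
Definition Cinf {R : realType} (g : R -> R[i]) : Prop :=
  continuous (g : R -> CN R) /\
  exists l : CN R, (g x : CN R) @[x --> +oo] --> l /\ (g x : CN R) @[x --> -oo] --> l.

(* H^infty + C (as L^infty functions, i.e. equality a.e.) *)
Definition HinfC {R : realType} (phi : R -> R[i]) : Prop :=
  exists h g : R -> R[i], [/\ Hinf h, Cinf g & {ae leb R, forall x, phi x = h x + g x}].

(* (J f)(x) = f(-x) *)
Definition Jop {R : realType} (f : R -> R[i]) : R -> R[i] := fun x => f (- x).

(* v = P_- u : the orthogonal projection of u onto H^2_- *)
Definition is_Pminus {R : realType} (u v : R -> R[i]) : Prop :=
  H2minus v /\ forall w, H2minus w -> L2orth (fun x => u x - v x) w.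

(* Main.v *)
Require Import Defs.
From HB Require Import structures.
From mathcomp Require Import all_boot all_order all_algebra.
From mathcomp Require Import all_classical all_reals all_analysis.
From mathcomp.real_closed Require Import complex.
From mathcomp Require Import measurable_realfun ring lra.
Import Order.TTheory GRing.Theory Num.Theory numFieldNormedType.Exports.
Import Normc.
Local Open Scope ring_scope. Local Open Scope classical_set_scope.
Local Open Scope complex_scope.

(* Let E be a compact set of positive measure on which |phi|^2 <= 1 - k, let f be in H^2
   and v = P_-(phi f). Then |v|^2 = Re <phi f, v>, and two bounds are played against each other.
   On the one hand |v|^2 <= |phi f|^2 <= |f|^2 - k |1_E f|^2. On the other hand <beta f, v> = 0
   for beta in H^infty, so |v|^2 <= int |phi - beta| |f| |v|, and beta can be chosen such that
   |phi - beta| <= 1/2 off E (in the limit at the boundary) and |phi - beta| <= C on E; hence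
   |v|^2 <= |f|^2 / 2 + 2 C^2 |1_E f|^2. A convex combination of the two bounds gives |H(phi)| < 1.

   To find beta write phi = h + g and approximate g uniformly by finite sums of Poisson kernels,
   that is by combinations of 1/(x - a) and 1/(x - conj a) with a in the upper half-plane. The
   second kind is in H^infty; 1/(x - a) is replaced by (1 - e^m)/(z - a), where
   e = b/b(a), b = (2 pi i + T)/(2 pi i - T) and T is the Cauchy integral of 1_E. As Im T is
   pi times the harmonic measure of E, b is bounded, |b(a)| > 1, and |b| tends to 1 at the
   boundary points off E. *)

(** The qualitative route would take an extremal vector of the compact operator H(phi) and a
    uniqueness theorem for H^2; the argument here is quantitative and yields an explicit constant.
    The obstacle is that 1/(x - a), with a in the upper half-plane, has positive distance from
    H^infty, so phi has no uniform approximation by H^infty on all of the line. The error can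
    however be pushed onto any set of positive measure: e equals 1 at a, so 1 - e^m cancels the
    pole, while its boundary modulus off E is 1/|b(a)| < 1, so e^m dies out there. The large error
    on E is affordable because the first bound gains k |1_E f|^2. Any number below 1 could stand for
    1/2. A second difficulty is <beta f, v> = 0: functions in H^2 are given through a.e. vertical
    limits, without L^2 convergence, and holomorphy is bare differentiability at each point. Hence
    the route through Goursat, through line integrals of H^1 functions that do not depend on the
    height, and through a weak passage to the boundary. *)

Section NormC.
Context {R : realType}.
Implicit Types (z w : R[i]) (x y : R).

Lemma normc_ge0 z : 0 <= normc z.
Proof. by case: z => a b; apply: sqrtr_ge0. Qed.

Lemma sqmodE z : sqmod z = normc z ^+ 2.
Proof.
by case: z => a b; rewrite /sqmod /= sqr_sqrtr // addr_ge0 // sqr_ge0.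
Qed.

Lemma normc_le_sqr z (c : R) : 0 <= c -> sqmod z <= c ^+ 2 -> normc z <= c.
Proof. by move=> c0; rewrite sqmodE ler_sqr // nnegrE normc_ge0. Qed.

Lemma normc_triangle z w : normc (z + w) <= normc z + normc w.
Proof. exact: le_normcD. Qed.

Lemma normc_opp z : normc (- z) = normc z.
Proof. exact: normcN. Qed.

Lemma normc_distC z w : normc (z - w) = normc (w - z).
Proof. by rewrite -normc_opp opprB. Qed.

Lemma normc_triangleB z w : normc z - normc w <= normc (z - w).
Proof. by rewrite lerBlDr (le_trans _ (normc_triangle _ _)) // subrK. Qed.

Lemma normc_gt0 z : (0 < normc z) = (z != 0).
Proof.
rewrite lt_neqAle normc_ge0 andbT eq_sym; congr (~~ _).
by apply/eqP/eqP => [/eq0_normc //|->]; rewrite normc0.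
Qed.

Lemma normc_conj z : normc z^* = normc z.
Proof. by case: z => a b /=; rewrite sqrrN. Qed.

Lemma normcX z n : normc (z ^+ n) = normc z ^+ n.
Proof. by elim: n => [|n IH]; rewrite ?expr0 ?normc1 // !exprS normcM IH. Qed.

Lemma Re_le_normc z : `|complex.Re z| <= normc z.
Proof.
case: z => a b /=; rewrite -sqrtr_sqr; apply: ler_wsqrtr.
by rewrite lerDl sqr_ge0.
Qed.

Lemma Im_le_normc z : `|complex.Im z| <= normc z.
Proof.
case: z => a b /=; rewrite -sqrtr_sqr; apply: ler_wsqrtr.
by rewrite lerDr sqr_ge0.
Qed.

Lemma normc_le_ReIm z : normc z <= `|complex.Re z| + `|complex.Im z|.
Proof.
apply: normc_le_sqr; first by rewrite addr_ge0.
rewrite /sqmod -(real_normK (num_real (complex.Re z))) -(real_normK (num_real (complex.Im z))).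
by rewrite sqrrD lerD2r lerDl mulrn_wge0 // mulr_ge0.
Qed.

Lemma normc_real x : normc x%:C = `|x|.
Proof. by rewrite /= expr0n addr0 sqrtr_sqr. Qed.

Lemma normc_imag x : normc (Complex 0 x) = `|x|.
Proof. by rewrite /= expr0n add0r sqrtr_sqr. Qed.

Lemma normr_normc z : `|z| = (normc z)%:C.
Proof. by case: z. Qed.

Lemma ReD z w : complex.Re (z + w) = complex.Re z + complex.Re w.
Proof. by case: z w => a b [c d]. Qed.
Lemma ImD z w : complex.Im (z + w) = complex.Im z + complex.Im w.
Proof. by case: z w => a b [c d]. Qed.
Lemma ReN z : complex.Re (- z) = - complex.Re z.
Proof. by case: z. Qed.
Lemma ImN z : complex.Im (- z) = - complex.Im z.
Proof. by case: z. Qed.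
Lemma ReM z w : complex.Re (z * w) =
  complex.Re z * complex.Re w - complex.Im z * complex.Im w.
Proof. by case: z w => a b [c d]. Qed.
Lemma ImM z w : complex.Im (z * w) =
  complex.Re z * complex.Im w + complex.Im z * complex.Re w.
Proof. by case: z w => a b [c d]. Qed.
Definition ReImE := (ReD, ImD, ReN, ImN, ReM, ImM).

End NormC.

(** * Complex differentiability in epsilon-delta form *)

Section EpsilonDelta.
Context {R : realType}.

(* Complex differentiability, with real epsilons in place of the complex-valued norm of [R[i]]. *)
Definition cdiff (F : R[i] -> R[i]) (z l : R[i]) := forall e : R, 0 < e ->
  exists2 d : R, 0 < d & forall h, normc h < d ->
    normc (F (z + h) - F z - l * h) <= e * normc h.

Definition ccont (F : R[i] -> R[i]) (z : R[i]) := forall e : R, 0 < e ->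
  exists2 d : R, 0 < d & forall h, normc h < d -> normc (F (z + h) - F z) <= e.

Lemma cdiff_derivable (F : R[i] -> R[i]) z :
  derivable (F : CN R -> CN R) (z : CN R) (1 : CN R) -> exists l, cdiff F z l.
Proof.
move=> /cvg_ex [l Fl]; exists l => e e0.
have e0' : (0 : R[i]) < e%:C by rewrite ltcR.
have := @cvgr_dist_le _ _ _ _ _ _ _ Fl e%:C e0'; rewrite near_withinE => /(_ _) /nbhs_ballP [d d0 dP].
have dE : d = (complex.Re d)%:C.
  by case: d d0 {dP} => a b /=; rewrite ltcE /= => /andP [/eqP -> _].
have d0r : 0 < complex.Re d.
  by move: d0; rewrite /= ltcE => /andP [].
exists (complex.Re d) => // h hd.
have [->|h0] := eqVneq h 0; first by rewrite addr0 mulr0 subrr subr0 normc0 mulr0.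
have := dP h; rewrite /ball /= sub0r normrN normr_normc dE ltcR hd => /(_ isT h0).
rewrite normr_normc lecR => H.
have -> : F (z + h) - F z - l * h = - (l - h^-1 *: (F (h *: 1 + z) - F z)) * h.
  rewrite /GRing.scale /= mulr1 (addrC h).
  by field.
by rewrite normcM normc_opp ler_wpM2r // normc_ge0.
Qed.

Lemma derivable_cdiff (F : R[i] -> R[i]) z l : cdiff F z l ->
  derivable (F : CN R -> CN R) (z : CN R) (1 : CN R).
Proof.
move=> Fl; apply/cvg_ex; exists (l : CN R); apply/cvgrPdist_le => e e0.
have eE : e = (complex.Re e)%:C.
  by case: e e0 => a b /=; rewrite ltcE /= => /andP [/eqP -> _].
have e0r : 0 < complex.Re e by move: e0; rewrite /= ltcE => /andP [].
have [d d0 dP] := Fl _ e0r.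
rewrite near_withinE; apply/nbhs_ballP; exists d%:C; first by rewrite /= ltcR.
move=> h; rewrite /ball /= sub0r normrN normr_normc ltcR => hd h0.
rewrite normr_normc eE lecR.
have -> : l - h^-1 *: (F (h *: 1 + z) - F z) = - (F (z + h) - F z - l * h) * h^-1.
  rewrite /GRing.scale /= mulr1 (addrC h).
  by field.
rewrite normcM normc_opp normcV ler_pdivrMr ?normc_gt0 //; exact: dP.
Qed.

Lemma cdiff_cont (F : R[i] -> R[i]) z l : cdiff F z l -> ccont F z.
Proof.
move=> Fl e e0; have [d d0 dP] := Fl 1 ltr01.
have c0 : 0 < 1 + normc l by rewrite ltr_pwDl // normc_ge0.
exists (Num.min d (e / (1 + normc l))).
  by rewrite lt_min d0 divr_gt0.
move=> h; rewrite lt_min => /andP [hd he].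
rewrite -[F (z + h) - F z](subrK (l * h)); apply: le_trans (normc_triangle _ _) _.
rewrite normcM; apply: le_trans (lerD (dP _ hd) (lexx _)) _.
by rewrite -mulrDl mulrC -ler_pdivlMr // ltW.
Qed.

Lemma is_derive_eps (f : R -> R) (x l : R) : (forall e : R, 0 < e ->
    exists2 d : R, 0 < d &
      forall h, `|h| < d -> `|f (x + h) - f x - l * h| <= e * `|h|) ->
  is_derive x 1 f l.
Proof.
move=> fl.
have fl' : h^-1 *: ((f \o shift x) (h *: 1) - f x) @[h --> 0^'] --> l.
  apply/cvgrPdist_le => e e0; have [d d0 dP] := fl e e0.
  rewrite near_withinE; apply/nbhs_ballP; exists d => //= h.
  rewrite /ball /= sub0r normrN => hd h0.
  have -> : l - h^-1 *: (f (h *: 1 + x) - f x) = - (f (x + h) - f x - l * h) * h^-1.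
    rewrite /GRing.scale /= mulr1 (addrC h).
    by field.
  by rewrite normrM normrN normfV ler_pdivrMr ?normr_gt0 //; exact: dP.
by split; [apply/cvg_ex; exists l|apply: cvg_lim].
Qed.

Lemma cdiff_horizontal F (x y : R) l : cdiff F (Complex x y) l ->
  is_derive x 1 (fun t => complex.Re (F (Complex t y))) (complex.Re l) /\
  is_derive x 1 (fun t => complex.Im (F (Complex t y))) (complex.Im l).
Proof.
move=> Fl; split; apply: is_derive_eps => e e0; have [d d0 dP] := Fl e e0;
    exists d => // h hd; have := dP h%:C; rewrite normc_real => /(_ hd);
    apply: le_trans.
- apply: le_trans (Re_le_normc _); rewrite !ReImE /= mulr0 subr0.
  by rewrite -[Complex x y + _]/(Complex (x + h) (y + 0)) addr0.
- apply: le_trans (Im_le_normc _); rewrite !ReImE /= mulr0 add0r.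
  by rewrite -[Complex x y + _]/(Complex (x + h) (y + 0)) addr0.
Qed.

Lemma cdiff_vertical F (x y : R) l : cdiff F (Complex x y) l ->
  is_derive y 1 (fun t => complex.Re (F (Complex x t))) (- complex.Im l) /\
  is_derive y 1 (fun t => complex.Im (F (Complex x t))) (complex.Re l).
Proof.
move=> Fl; split; apply: is_derive_eps => e e0; have [d d0 dP] := Fl e e0;
    exists d => // h hd; have := dP (Complex 0 h); rewrite normc_imag => /(_ hd);
    apply: le_trans.
- apply: le_trans (Re_le_normc _); rewrite !ReImE /= mulr0 sub0r mulNr.
  by rewrite -[Complex x y + _]/(Complex (x + 0) (y + h)) addr0.
- apply: le_trans (Im_le_normc _); rewrite !ReImE /= mulr0 addr0.
  by rewrite -[Complex x y + _]/(Complex (x + 0) (y + h)) addr0.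
Qed.

End EpsilonDelta.

(** * Closure properties of holomorphic functions *)

Section Holomorphic.
Context {R : realType}.
Implicit Types (F G : R[i] -> R[i]) (z : R[i]).

Definition cdable F z := derivable (F : CN R -> CN R) (z : CN R) (1 : CN R).
Definition hol F := forall z, 0 < complex.Im z -> cdable F z.

Lemma cdableP F z : cdable F z <-> exists l, cdiff F z l.
Proof. by split => [/cdiff_derivable //|[l /derivable_cdiff]]. Qed.

Lemma cdable_cont F z : cdable F z -> ccont F z.
Proof. by move=> /cdableP [l /cdiff_cont]. Qed.

Lemma cdable_near F G z (d : R) : 0 < d ->
  (forall h, normc h < d -> F (z + h) = G (z + h)) -> cdable F z -> cdable G z.
Proof.
move=> d0 FG /cdableP [l Fl]; apply/cdableP; exists l => e /Fl [d' d'0 d'P].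
exists (Num.min d d'); first by rewrite lt_min d0.
move=> h; rewrite lt_min => /andP [hd hd'].
by rewrite -FG // -[z in G z]addr0 -FG ?normc0 // addr0; exact: d'P.
Qed.

Lemma eq_cdable F G z : F =1 G -> cdable F z -> cdable G z.
Proof. by move=> FG; apply: (cdable_near _ _ _ 1). Qed.

Lemma cdable_cst c z : cdable (fun=> c) z.
Proof. exact: (@derivable_cst _ (CN R) (CN R)). Qed.

Lemma cdable_id z : cdable id z.
Proof. exact: (@derivable_id _ (CN R)). Qed.

Lemma cdableD F G z : cdable F z -> cdable G z -> cdable (fun z => F z + G z) z.
Proof. exact: (@derivableD _ (CN R) (CN R)). Qed.

Lemma cdableB F G z : cdable F z -> cdable G z -> cdable (fun z => F z - G z) z.
Proof. exact: (@derivableB _ (CN R) (CN R)). Qed.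

Lemma cdableM F G z : cdable F z -> cdable G z -> cdable (fun z => F z * G z) z.
Proof. exact: (@derivableM R[i] (CN R)). Qed.

Lemma cdableV F z : F z != 0 -> cdable F z -> cdable (fun z => (F z)^-1) z.
Proof. exact: (@derivableV R[i] (CN R)). Qed.

Lemma cdableX F n z : cdable F z -> cdable (fun z => F z ^+ n) z.
Proof.
move=> dF; elim: n => [|n IH]; first exact: cdable_cst.
by apply: eq_cdable (cdableM _ _ _ dF IH) => w; rewrite exprS.
Qed.

Lemma cdable_shift F z w : cdable F (z + w) -> cdable (fun z => F (z + w)) z.
Proof.
move=> /cdableP [l Fl]; apply/cdableP; exists l => e /Fl [d d0 dP].
by exists d => // h /dP; rewrite [z + h + w]addrAC.
Qed.

(** Schwarz reflection. It moves functions on the lower half-plane to the upper one, so that H^2_-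
    needs no theory of its own. *)
Lemma cdable_conj F z : cdable F z^* -> cdable (fun z => (F z^*)^*) z.
Proof.
move=> /cdableP [l Fl]; apply/cdableP; exists l^* => e /Fl [d d0 dP].
exists d => // h; rewrite -(normc_conj h) => /dP; rewrite -[X in X <= _]normc_conj.
by rewrite !rmorphB rmorphM /= conjcK -rmorphD.
Qed.

Lemma cdable_continuous F y : (forall x, cdable F (Complex x y)) ->
  continuous (fun x : R => complex.Re (F (Complex x y))) /\
  continuous (fun x : R => complex.Im (F (Complex x y))).
Proof.
move=> dF; split => x; have /cdableP [l /cdiff_horizontal [[dr _] [di _]]] := dF x.
- by apply: differentiable_continuous; apply/derivable1_diffP.
- by apply: differentiable_continuous; apply/derivable1_diffP.
Qed.

End Holomorphic.

(** * Primitives of continuous functions on the line and the half-line *)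

Section Primitives.
Context {R : realType}.
Local Notation mu := (@lebesgue_measure R).

Lemma continuous_integrable_itv (u : R -> R) (a b : R) : continuous u ->
  mu.-integrable `[a, b] (EFin \o u).
Proof.
move=> cu; apply: continuous_compact_integrable; first exact: segment_compact.
exact: continuous_subspaceT.
Qed.

(** An integral over [[c, x]] is a primitive only to the right of [c], so no fixed base point serves
    the whole line; the base point moves with [x]. *)
Lemma continuous_primitive (u : R -> R) : continuous u ->
  exists U : R -> R, forall x : R, is_derive x 1 U (u x).
Proof.
move=> cu.
(* Subtracting the integral up to 0 makes the value independent of the left endpoint [- n], which is
   [VS]. *)
pose V (n x : R) := (\int[mu]_(t in `[- n, x]) u t - \int[mu]_(t in `[- n, 0%R]) u t)%R.
have VS (n m x : R) : n <= m -> 0 < n -> - n < x -> V n x = V m x.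
  move=> nm n0 nx; rewrite /V.
  have E (z : R) : - n < z ->
      (\int[mu]_(t in `[- m, z]) u t = \int[mu]_(t in `[- m, - n]) u t +
       \int[mu]_(t in `[- n, z]) u t)%R.
    move=> nz.
    have H := @Rintegral_itvB _ u (BLeft (- m)) (BRight z) (- n)
      (continuous_integrable_itv _ _ _ cu).
    rewrite -(@Rintegral_itv_obnd_cbnd _ (- n)) -?H ?bnd_simp ?lerN2 ?(ltW nz) //.
      by rewrite addrC subrK.
    by apply: (integrableS _ _ _ (continuous_integrable_itv _ (- n) z cu)) => //; move=> t /=; rewrite !in_itv /= => /andP [/ltW -> ->].
  rewrite (E x) // (E 0) ?oppr_lt0 //; ring.
pose U x := V (`|x| + 1) x.
exists U => x.
(* Near [x] a single base point suffices: |y| + 1 stays below |x| + 2. *)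
have UE : \forall y \near x, V (`|x| + 2) y = U y.
  near=> y; rewrite /U; apply/esym/VS.
  - have : `|y - x| < 1 by near: y; apply: cvgr_distC_lt.
    have := ler_normD (y - x) x; rewrite subrK; lra.
  - by rewrite ltr_wpDl.
  - by rewrite ltrNl (le_lt_trans (ler_norm _)) // normrN ltrDl.
apply: (@near_eq_is_derive _ _ _ _ _ _ _ _ UE).

have [] := @continuous_FTC1_closed _ u (- (`|x| + 2)) x (x + 1) _ _ _ _.
- by rewrite ltrDl.
- exact: continuous_integrable_itv.
- have := ler_norm (- x); rewrite normrN; lra.
- exact: cu.
move=> dF FE.
pose W y : R := (\int[mu]_(t in `[- (`|x| + 2), y]) u t)%R.
have dW : is_derive x 1 W (u x) by apply: DeriveDef dF _; rewrite -derive1E.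
have := is_deriveB dW (is_derive_cst (W 0) x 1); rewrite subr0; exact.
Unshelve. all: by end_near. Qed.

(** The substitution y = exp s reduces the half-line to the whole line. *)
Lemma continuous_primitive_pos (u : R -> R) :
  (forall y : R, 0 < y -> {for y, continuous u}) ->
  exists U : R -> R, forall y : R, 0 < y -> is_derive y 1 U (u y).
Proof.
move=> cu.
have [S dS] : exists S : R -> R, forall s : R, is_derive s 1 S (u (expR s) * expR s).
  apply: continuous_primitive => s; apply: cvgM; last exact: continuous_expR.
  by apply: continuous_comp; [exact: continuous_expR|apply: cu; exact: expR_gt0].
exists (S \o @ln R) => y y0.
apply: is_derive_eq; first exact: (is_derive1_comp (dS _) (is_derive1_ln y0)).
by rewrite lnK ?posrE // -mulrA divff ?mulr1 // gt_eqF.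
Qed.

End Primitives.

(** * Goursat: holomorphic functions have primitives *)

Section RealDerivatives.
Context {R : realType}.
Implicit Types (g k : R -> R[i]).

Definition rder g (t : R) (l : R[i]) :=
  is_derive t 1 (fun s => complex.Re (g s)) (complex.Re l) /\
  is_derive t 1 (fun s => complex.Im (g s)) (complex.Im l).

Lemma rderB g k t l m : rder g t l -> rder k t m ->
  rder (fun s => g s - k s) t (l - m).
Proof.
move=> [g1 g2] [k1 k2]; split; rewrite !ReImE.
- under eq_fun do rewrite ReD ReN; exact: is_deriveB.
- under eq_fun do rewrite ImD ImN; exact: is_deriveB.
Qed.

Lemma real_MVT_bound (f df : R -> R) (a b C : R) : a <= b ->
  (forall t : R, a <= t <= b -> is_derive t 1 f (df t)) ->
  (forall t, a <= t <= b -> `|df t| <= C) -> `|f b - f a| <= C * (b - a).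
Proof.
move=> ab fd dC.
have fd' (x : R) : (x \in `]a, b[)%R -> is_derive x 1 f (df x).
  by rewrite in_itv /= => /andP [ax xb]; apply: fd; rewrite !ltW.
have cf : {within `[a, b], continuous f}.
  apply: derivable_within_continuous => x; rewrite in_itv /= => H.
  by case: (fd x H).
have [c] := MVT_segment ab fd' cf.
rewrite in_itv /= => cab ->; rewrite normrM [`|b - a|]ger0_norm ?subr_ge0 //.
by rewrite ler_wpM2r ?subr_ge0 // dC.
Qed.

(** The mean value theorem is available for real functions only; applying it to real and imaginary
    parts separately costs the factor 2, which does no harm below. *)
Lemma rder_MVT g dg (a b C : R) : a <= b ->
  (forall t, a <= t <= b -> rder g t (dg t)) ->
  (forall t, a <= t <= b -> normc (dg t) <= C) ->
  normc (g b - g a) <= 2 * C * (b - a).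
Proof.
move=> ab gd dC; apply: le_trans (normc_le_ReIm _) _; rewrite !ReImE.
have H1 := @real_MVT_bound (fun s => complex.Re (g s)) (fun s => complex.Re (dg s))
  a b C ab (fun t H => proj1 (gd t H)) (fun t H => le_trans (Re_le_normc _) (dC t H)).
have H2 := @real_MVT_bound (fun s => complex.Im (g s)) (fun s => complex.Im (dg s))
  a b C ab (fun t H => proj2 (gd t H)) (fun t H => le_trans (Im_le_normc _) (dC t H)).
by move: H1 H2 => /=; lra.
Qed.

Lemma rder_MVT_sym g dg (a b C : R) :
  (forall t, Num.min a b <= t <= Num.max a b -> rder g t (dg t)) ->
  (forall t, Num.min a b <= t <= Num.max a b -> normc (dg t) <= C) ->
  normc (g b - g a) <= 2 * C * `|b - a|.
Proof.
move=> gd dC; have [ab|/ltW ba] := leP a b.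
  rewrite ger0_norm ?subr_ge0 //; rewrite min_l // max_r // in gd dC.
  exact: rder_MVT gd dC.
rewrite normc_distC distrC ger0_norm ?subr_ge0 //.
rewrite min_r // max_l // in gd dC; exact: rder_MVT gd dC.
Qed.

Lemma cdiff_rder_h (F : R[i] -> R[i]) x y l : cdiff F (Complex x y) l ->
  rder (fun t => F (Complex t y)) x l.
Proof. exact: cdiff_horizontal. Qed.

Lemma cdiff_rder_v (F : R[i] -> R[i]) x y l : cdiff F (Complex x y) l ->
  rder (fun t => F (Complex x t)) y (Complex 0 1 * l).
Proof.
move=> /cdiff_vertical; rewrite /rder !ReImE /= !mul0r !mul1r sub0r add0r.
by [].
Qed.

End RealDerivatives.

Section Goursat.
Context {R : realType}.
Variables (K : R[i] -> R[i]) (holK : hol K).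
Variables (A B : R -> R -> R[i]).
Hypothesis dA : forall y : R, 0 < y -> forall x, rder (A y) x (K (Complex x y)).
Hypothesis dB : forall x y : R, 0 < y -> rder (B x) y (Complex 0 1 * K (Complex x y)).

(* [A y] and [B x] are primitives of K along horizontal and vertical lines, so that [rect]
   is the contour integral of K around [a, b] x [c, d]; its additivity is ring algebra. *)
Definition rect (a b c d : R) : R[i] :=
  (A c b - A c a) + (B b d - B b c) - (A d b - A d a) - (B a d - B a c).

(** Near the point, [K] is affine up to a small multiple of the diameter. The affine part has a
    primitive and contributes nothing to the contour integral; the rest is bounded by its size times
    the perimeter. *)
Lemma rect_local (x0 y0 : R) : 0 < y0 -> forall e : R, 0 < e ->
  exists2 r : R, 0 < r & forall a b c d, a <= x0 <= b -> c <= y0 <= d -> 0 < c ->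
    (b - a) + (d - c) < r ->
    normc (rect a b c d) <= e * ((b - a) ^+ 2 + (d - c) ^+ 2).
Proof.
move=> y00 e e0.
(* With side lengths u and v, the four sides contribute 4 (e/8) (u + v)^2 in all, which is e (u +
   v)^2 / 2 <= e (u^2 + v^2). *)
have e80 : 0 < e / 8 by rewrite divr_gt0.
have /cdableP [l Kl] := holK (Complex x0 y0) y00.
have [r r0 rP] := Kl (e / 8) e80; exists r => // a b c d /andP [ax xb] /andP [cy yd] c0 rabcd.
pose z0 := Complex x0 y0.
(* A primitive of the affine approximation of [K] at [z0]. *)
pose F z := K z0 * (z - z0) + l / 2 * (z - z0) ^+ 2.
have dF z : cdiff F z (K z0 + l * (z - z0)).
  move=> e' e'0; exists (e' / (normc (l / 2) + 1)).
    by rewrite divr_gt0 // ltr_wpDl // normc_ge0.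
  move=> h; rewrite ltr_pdivlMr ?ltr_wpDl ?normc_ge0 // => hd.
  have -> : F (z + h) - F z - (K z0 + l * (z - z0)) * h = l / 2 * h * h.
    by rewrite /F; field.
  rewrite normcM ler_wpM2r ?normc_ge0 // normcM mulrC (le_trans _ (ltW hd)) //.
  by rewrite ler_wpM2l ?normc_ge0 // lerDl.
have near z : normc (z - z0) <= (b - a) + (d - c) ->
    normc (K z - (K z0 + l * (z - z0))) <= e / 8 * ((b - a) + (d - c)).
  move=> zz0; have := rP (z - z0) (le_lt_trans zz0 rabcd).
  rewrite -/z0 [z0 + _]addrC subrK opprD addrA => H; apply: le_trans H _.
  by rewrite ler_wpM2l // ltW.
have near' x y : a <= x <= b -> c <= y <= d ->
    normc (Complex x y - z0) <= (b - a) + (d - c).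
  move=> /andP [ax' xb'] /andP [cy' yd']; apply: le_trans (normc_le_ReIm _) _ => /=.
  by apply: lerD; rewrite ler_norml; apply/andP; split; lra.
have ab : a <= b by lra.
have cd : c <= d by lra.
have hA y : c <= y <= d ->
    normc (A y b - F (Complex b y) - (A y a - F (Complex a y))) <=
    2 * (e / 8 * ((b - a) + (d - c))) * (b - a).
  move=> ycd; apply: (rder_MVT (fun t => A y t - F (Complex t y)) _ a b _ ab) => t tab.
    apply: rderB; last exact: cdiff_rder_h (dF _).
    by apply: dA; case/andP: ycd => [cy' _]; exact: lt_le_trans cy'.
  by apply: near; exact: near'.
have hB x : a <= x <= b ->
    normc (B x d - F (Complex x d) - (B x c - F (Complex x c))) <=
    2 * (e / 8 * ((b - a) + (d - c))) * (d - c).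
  move=> xab; apply: (rder_MVT (fun t => B x t - F (Complex x t)) _ c d _ cd) => t tcd.
    apply: rderB; last exact: cdiff_rder_v (dF _).
    by apply: dB; case/andP: tcd => [cy' _]; exact: lt_le_trans cy'.
  rewrite -[X in normc X]mulrBr normcM normc_imag normr1 mul1r.
  by apply: near; exact: near'.
(* The values of [F] at the corners cancel around the contour. *)
have -> : rect a b c d =
    (A c b - F (Complex b c) - (A c a - F (Complex a c)))
    + (B b d - F (Complex b d) - (B b c - F (Complex b c)))
    - (A d b - F (Complex b d) - (A d a - F (Complex a d)))
    - (B a d - F (Complex a d) - (B a c - F (Complex a c))).
  by rewrite /rect; ring.
have [cc dd aa bb] : [/\ c <= c <= d, c <= d <= d, a <= a <= b & a <= b <= b].
  by rewrite !lexx ab cd.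
apply: le_trans (normc_triangle _ _) _; rewrite normc_opp.
apply: le_trans (lerD (normc_triangle _ _) (hB _ aa)) _; rewrite normc_opp.
apply: le_trans (lerD (lerD (normc_triangle _ _) (hA _ dd)) (lexx _)) _.
apply: le_trans (lerD (lerD (lerD (hA _ cc) (hB _ bb)) (lexx _)) (lexx _)) _.
set u := b - a; set v := d - c.
have -> : 2 * (e / 8 * (u + v)) * u + 2 * (e / 8 * (u + v)) * v +
  2 * (e / 8 * (u + v)) * u + 2 * (e / 8 * (u + v)) * v = e * ((u + v) ^+ 2 / 2).
  by field.
rewrite ler_wpM2l ?(ltW e0) // ler_pdivrMr //.
have := sqr_ge0 (u - v); lra.
Qed.

Lemma rect_split (a b c d m n : R) : rect a b c d =
  rect a m c n + rect m b c n + rect a m n d + rect m b n d.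
Proof. by rewrite /rect; ring. Qed.

Let bad (e : R) (q : R * R * R * R) := let: (a, b, c, d) := q in
  e * ((b - a) ^+ 2 + (d - c) ^+ 2) < normc (rect a b c d).

Let quarter (q q' : R * R * R * R) :=
  let: (a, b, c, d) := q in let: (a', b', c', d') := q' in
  [/\ a <= a' <= b', b' <= b, c <= c' <= d', d' <= d &
      (b' - a' = (b - a) / 2 /\ d' - c' = (d - c) / 2)].

(** The bound is quadratic in the side lengths, so each quarter is allowed a quarter of it: if all
    four quarters obeyed their bounds, the whole rectangle would obey its own. *)
Let bad_quarter e q : 0 < e -> (let: (a, b, c, d) := q in a <= b /\ c <= d) ->
  bad e q -> exists q', quarter q q' /\ bad e q'.
Proof.
case: q => [[[a b] c] d] e0 [ab cd] badq.
pose m := (a + b) / 2; pose n := (c + d) / 2.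
have [mE nE] : m - a = (b - a) / 2 /\ n - c = (d - c) / 2.
  by split; rewrite /m /n; field.
have [mE' nE'] : b - m = (b - a) / 2 /\ d - n = (d - c) / 2.
  by split; rewrite /m /n; field.
apply: contrapT => H.
have good q' : quarter (a, b, c, d) q' -> ~ bad e q'.
  by move=> ? ?; apply: H; exists q'.
have qu1 : quarter (a, b, c, d) (a, m, c, n) by split; [lra|lra|lra|lra|split; lra].
have qu2 : quarter (a, b, c, d) (m, b, c, n) by split; [lra|lra|lra|lra|split; lra].
have qu3 : quarter (a, b, c, d) (a, m, n, d) by split; [lra|lra|lra|lra|split; lra].
have qu4 : quarter (a, b, c, d) (m, b, n, d) by split; [lra|lra|lra|lra|split; lra].
have := good _ qu4; have := good _ qu3; have := good _ qu2; have := good _ qu1.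
rewrite /bad mE nE mE' nE'.
move=> /negP; rewrite -leNgt => h1 /negP; rewrite -leNgt => h2.
move=> /negP; rewrite -leNgt => h3 /negP; rewrite -leNgt => h4.
move: badq; rewrite /bad (rect_split _ _ _ _ m n); apply/negP; rewrite -leNgt.
apply: le_trans (normc_triangle _ _) _.
apply: le_trans (lerD (normc_triangle _ _) h4) _.
apply: le_trans (lerD (lerD (normc_triangle _ _) h3) (lexx _)) _.
apply: le_trans (lerD (lerD (lerD h1 h2) (lexx _)) (lexx _)) _.
by rewrite le_eqVlt; apply/orP; left; apply/eqP; field.
Qed.

Lemma nested_intervals (a b : nat -> R) :
  (forall n, a n <= a n.+1) -> (forall n, b n.+1 <= b n) -> (forall n, a n <= b n) ->
  exists x, forall n, a n <= x <= b n.
Proof.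
move=> a_incr b_decr ab.
have amono n k : a n <= a (n + k)%N.
  by elim: k => [|k IH]; rewrite ?addn0 // addnS (le_trans IH).
have bmono n k : b (n + k)%N <= b n.
  by elim: k => [|k IH]; rewrite ?addn0 // addnS (le_trans _ IH).
have amb m n : a m <= b n.
  by apply: le_trans (amono m n) _; apply: le_trans (ab _) _; rewrite addnC.
exists (sup (range a)) => n; apply/andP; split.
  apply: ub_le_sup; last by exists n.
  by exists (b 0%N) => _ [m _ <-].
by apply: ge_sup; [exists (a 0%N), 0%N|move=> _ [m _ <-]].
Qed.

Lemma half_pow_small (s r : R) : 0 < r -> exists n, s / 2 ^+ n < r.
Proof.
move=> r0; have [n nP] : exists n : nat, s / r < n%:R.
  by exists (Num.bound `|s / r|); apply: le_lt_trans (ler_norm _) (archi_boundP _).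
exists n; rewrite ltr_pdivrMr ?exprn_gt0 // -ltr_pdivrMl // mulrC.
apply: lt_trans nP _; rewrite -natrX ltr_nat; exact: ltn_expl.
Qed.

Lemma rect0_le (a b c d : R) : a <= b -> c <= d -> 0 < c -> rect a b c d = 0.
Proof.
move=> ab cd c0; apply/eqP/negP => /negP rn0.
pose S := (b - a) ^+ 2 + (d - c) ^+ 2.
have S0 : 0 <= S by rewrite addr_ge0 ?sqr_ge0.
have [e e0 eP] : exists2 e : R, 0 < e & e * S < normc (rect a b c d).
  exists (normc (rect a b c d) / (S + 1)); first by rewrite divr_gt0 ?normc_gt0 // ltr_wpDl.
  rewrite mulrAC ltr_pdivrMr ?ltr_wpDl // ltr_pM2l ?normc_gt0 //; lra.
pose ok q := (let: (a, b, c, d) := q : R * R * R * R in a <= b /\ c <= d).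
(* [choice] asks for a successor of every quadruple; one that is not a bad rectangle gets itself,
   and nothing is claimed about it. *)
have stepP q : exists q', ok q -> bad e q -> quarter q q' /\ bad e q'.
  have [[okq badq]|nq] := pselect (ok q /\ bad e q).
    by have [q' H] := bad_quarter e q e0 okq badq; exists q'.
  by exists q => okq badq; case: nq.
have [step sP] := choice stepP.
pose Q := fix Q n := if n is n'.+1 then step (Q n') else (a, b, c, d).
have QP n : ok (Q n) /\ bad e (Q n).
  elim: n => [|n [IH1 IH2]] //=; have [] := sP _ IH1 IH2.
  case: (Q n) (step (Q n)) => [[[? ?] ?] ?] [[[? ?] ?] ?] /=.
  by case=> /andP [_ ->] _ /andP [_ ->].
have Qquarter n : quarter (Q n) (Q n.+1) by have [/sP h /h []] := QP n.
pose an n := (Q n).1.1.1; pose bn n := (Q n).1.1.2; pose cn n := (Q n).1.2; pose dn n := (Q n).2.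
have QE n : Q n = (an n, bn n, cn n, dn n).
  by rewrite /an /bn /cn /dn; case: (Q n) => [[[? ?] ?] ?].
have aS n : [/\ an n <= an n.+1, bn n.+1 <= bn n, cn n <= cn n.+1 & dn n.+1 <= dn n].
  by have := Qquarter n; rewrite !QE => -[/andP [-> _] -> /andP [-> _] -> _].
have okn n : an n <= bn n /\ cn n <= dn n by have [+ _] := QP n; rewrite QE.
have [x0 x0P] : exists x, forall n, an n <= x <= bn n.
  by apply: nested_intervals => n; [case: (aS n)|case: (aS n)|case: (okn n)].
have [y0 y0P] : exists y, forall n, cn n <= y <= dn n.
  by apply: nested_intervals => n; [case: (aS n)|case: (aS n)|case: (okn n)].
have len n : bn n - an n = (b - a) / 2 ^+ n /\ dn n - cn n = (d - c) / 2 ^+ n.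
  elim: n => [|n [IH1 IH2]]; first by rewrite !divr1.
  have := Qquarter n; rewrite !QE => -[_ _ _ _ [-> ->]].
  by rewrite IH1 IH2 exprSr invfM !mulrA.
have cnc n : c <= cn n.
  by elim: n => [|n /le_trans]; [|apply; case: (aS n)].
have y00 : 0 < y0.
  by apply: lt_le_trans c0 _; apply: le_trans (cnc 0%N) _; case/andP: (y0P 0%N).
(* The bad rectangles shrink to (x0, y0), where the local estimate forbids small bad ones. *)
have [r r0 rP] := rect_local x0 y0 y00 e e0.
have [n nP] := half_pow_small ((b - a) + (d - c)) r r0.
have := rP (an n) (bn n) (cn n) (dn n) (x0P n) (y0P n) (lt_le_trans c0 (cnc n)).
have [-> ->] := len n; rewrite -mulrDl nP => /(_ isT).
have [_] := QP n; rewrite QE /bad; have [-> ->] := len n.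
by move=> /lt_le_trans h /h; rewrite ltxx.
Qed.

Lemma rect0 (a b c d : R) : 0 < c -> 0 < d -> rect a b c d = 0.
Proof.
have sym1 a' b' c' d' : rect b' a' c' d' = - rect a' b' c' d' by rewrite /rect; ring.
have sym2 a' b' c' d' : rect a' b' d' c' = - rect a' b' c' d' by rewrite /rect; ring.
wlog ab : a b / a <= b.
  move=> H c0 d0; have [/H->//|/ltW ba] := leP a b.
  by rewrite sym1 H // oppr0.
wlog cd : c d / c <= d.
  move=> H c0 d0; have [cd|/ltW dc] := leP c d; first by rewrite H.
  by rewrite sym2 H // oppr0.
by move=> c0 _; exact: rect0_le.
Qed.

(** The integral of [K] from [i] to [z], first along the line at height 1 and then vertically. *)
Definition primitive (z : R[i]) : R[i] :=
  A 1 (complex.Re z) - A 1 0 + (B (complex.Re z) (complex.Im z) - B (complex.Re z) 1).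

Lemma primitive_cdiff z : 0 < complex.Im z -> cdiff primitive z (K z).
Proof.
case: z => x y /= y0 e e0.
have e40 : 0 < e / 4 by rewrite divr_gt0.
have [d d0 dP] := cdable_cont _ _ (holK (Complex x y) y0) _ e40.
(* The half allows for the bound of a modulus by the sum of two coordinates; the [y] keeps the
   perturbed point in the half-plane. *)
exists (Num.min (d / 2) y); first by rewrite lt_min divr_gt0.
move=> [h k]; rewrite lt_min => /andP [hd hy].
have [hh kk] : `|h| <= normc (Complex h k) /\ `|k| <= normc (Complex h k).
  by split; [exact: (Re_le_normc (Complex h k))|exact: (Im_le_normc (Complex h k))].
have yk0 : 0 < y + k.
  by have := le_lt_trans kk hy; rewrite ltr_norml => /andP [+ _]; lra.
(* The vanishing of [rect] reroutes the path: from [x + iy] vertically to height [y + k], then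
   horizontally to [x + h]. On both legs [K] is within e/4 of its value at [x + iy], which is
   subtracted here. *)
have -> : primitive (Complex x y + Complex h k) - primitive (Complex x y)
          - K (Complex x y) * Complex h k =
    (A (y + k) (x + h) - K (Complex x y) * (x + h)%:C
      - (A (y + k) x - K (Complex x y) * x%:C))
    + (B x (y + k) - Complex 0 1 * K (Complex x y) * (y + k)%:C
      - (B x y - Complex 0 1 * K (Complex x y) * y%:C)).
  have := rect0 x (x + h) 1 (y + k) ltr01 yk0; rewrite /rect => H.
  rewrite /primitive /=.
  have -> : Complex h k = h%:C + Complex 0 1 * k%:C.
    by apply/eqP; rewrite eq_complex !ReImE /=; apply/andP; split; apply/eqP; ring.
  rewrite !rmorphD /=.
  apply/eqP; rewrite -subr_eq0; apply/eqP; rewrite -[RHS]H; ring.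
have lin (l x' : R[i]) : cdiff (fun z => l * z) x' l.
  move=> e' e'0; exists 1 => // h' _.
  by rewrite (_ : _ - _ = 0) ?normc0 ?mulr_ge0 ?normc_ge0 ?(ltW e'0) //; ring.
have lin' (l : R[i]) (t : R) : rder (fun t : R => l * t%:C) t l.
  exact: (@cdiff_rder_h _ (fun z => l * z) t 0 l (lin l (Complex t 0))).
have bnd (s t : R) : `|s| <= `|h| -> `|t| <= `|k| ->
    normc (K (Complex (x + s) (y + t)) - K (Complex x y)) <= e / 4.
  move=> sh tk; have := dP (Complex s t); apply.
  apply: le_lt_trans (normc_le_ReIm _) _ => /=.
  have := le_trans sh hh; have := le_trans tk kk; move: hd; lra.
have between (u v t : R) : Num.min u (u + v) <= t <= Num.max u (u + v) -> `|t - u| <= `|v|.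
  case: (leP u (u + v)) => [h1|/ltW h1].
    by rewrite [`|v|]ger0_norm ?ler_norml; last lra; move=> /andP [? ?]; apply/andP; split; lra.
  by rewrite [`|v|]ler0_norm ?ler_norml; last lra; move=> /andP [? ?]; apply/andP; split; lra.
apply: le_trans (normc_triangle _ _) _.
have h1 : normc (A (y + k) (x + h) - K (Complex x y) * (x + h)%:C
      - (A (y + k) x - K (Complex x y) * x%:C)) <= 2 * (e / 4) * `|x + h - x|.
  apply: (rder_MVT_sym (fun t => A (y + k) t - K (Complex x y) * t%:C)
    (fun t => K (Complex t (y + k)) - K (Complex x y))) => t /between tx.
    by apply: rderB; [exact: dA|exact: lin'].
  by have := bnd (t - x) k tx (lexx _); rewrite [x + _]addrC subrK.
have h2 : normc (B x (y + k) - Complex 0 1 * K (Complex x y) * (y + k)%:C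
      - (B x y - Complex 0 1 * K (Complex x y) * y%:C)) <= 2 * (e / 4) * `|y + k - y|.
  apply: (rder_MVT_sym (fun t => B x t - Complex 0 1 * K (Complex x y) * t%:C)
    (fun t => Complex 0 1 * K (Complex x t) - Complex 0 1 * K (Complex x y))) => t tyk.
    apply: rderB; last exact: lin'.
    apply: dB; case/andP: tyk => [+ _]; apply: lt_le_trans.
    by rewrite lt_min y0.
  rewrite -mulrBr normcM normc_imag normr1 mul1r.
  by have := bnd 0 (t - y); rewrite normr0 addr0 [y + _]addrC subrK => /(_ (normr_ge0 _) (between _ _ _ tyk)).
apply: le_trans (lerD h1 h2) _.
rewrite ![_ + _ - _]addrAC !subrr !add0r -mulrDr.
have -> : e * normc (Complex h k) = 2 * (e / 4) * (2 * normc (Complex h k)) by field.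
by rewrite ler_wpM2l //; lra.
Qed.

End Goursat.

Lemma holomorphic_primitive {R : realType} (K : R[i] -> R[i]) : hol K ->
  exists P : R[i] -> R[i], forall z, 0 < complex.Im z -> cdiff P z (K z).
Proof.
move=> holK.
have /choice [A dA] : forall y : R, exists Ay : R -> R[i], 0 < y ->
    forall x, rder Ay x (K (Complex x y)).
  move=> y; have [y0|] := boolP (0 < y); last by exists (fun=> 0).
  have [cr ci] := cdable_continuous K y (fun x => holK (Complex x y) y0).
  have [U dU] := continuous_primitive _ cr; have [V dV] := continuous_primitive _ ci.
  by exists (fun x => Complex (U x) (V x)) => _ x; split; [exact: dU|exact: dV].
have /choice [B dB] : forall x : R, exists Bx : R -> R[i], forall y, 0 < y ->
    rder Bx y (Complex 0 1 * K (Complex x y)).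
  move=> x.
  have cont y : 0 < y ->
      {for y, continuous (fun t => - complex.Im (K (Complex x t)))} /\
      {for y, continuous (fun t => complex.Re (K (Complex x t)))}.
    move=> y0; have /cdableP [l /cdiff_vertical [[dr _] [di _]]] := holK (Complex x y) y0.
    split; [apply: continuousN|];
      by apply: differentiable_continuous; apply/derivable1_diffP.
  have [U dU] := continuous_primitive_pos _ (fun y y0 => proj1 (cont y y0)).
  have [V dV] := continuous_primitive_pos _ (fun y y0 => proj2 (cont y y0)).
  exists (fun y => Complex (U y) (V y)) => y y0.
  by rewrite /rder !ReImE /= !mul0r !mul1r sub0r add0r; split; [exact: dU|exact: dV].
by exists (primitive A B) => z; exact: primitive_cdiff.
Qed.

(** * Integrals over the line *)

Section LineIntegral.
Context {R : realType}.
Local Notation mu := (@lebesgue_measure R).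
Implicit Types u v g : R -> R.

Definition mfun u := measurable_fun [set: R] u.
Definition ibl u := mu.-integrable [set: R] (EFin \o u).
Definition RI u : R := (\int[mu]_x u x)%R.

Lemma ibl_mfun u : ibl u -> mfun u.
Proof. by move=> /integrableP [/measurable_EFinP]. Qed.

Lemma ibl_le u g : mfun u -> (forall x, `|u x| <= g x) -> ibl g -> ibl u.
Proof.
move=> mu_ ug; apply: le_integrable => //; first exact/measurable_EFinP.
by move=> x _ /=; rewrite lee_fin (le_trans (ug x)) // ler_norm.
Qed.

Lemma ge0_ibl u : mfun u -> (forall x, 0 <= u x) ->
  (\int[mu]_x (u x)%:E < +oo)%E -> ibl u.
Proof.
move=> mu_ u0 fin; apply/integrableP; split; first exact/measurable_EFinP.
apply: le_lt_trans fin; rewrite le_eqVlt; apply/orP; left; apply/eqP.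
by apply: eq_integral => x _ /=; rewrite ger0_norm.
Qed.

Lemma RI_fin u : ibl u -> ((RI u)%:E = \int[mu]_x (u x)%:E)%E.
Proof. by move=> iu; rewrite /RI fineK //; exact: integrable_fin_num. Qed.

Lemma ge0_ibl_bound u M : mfun u -> (forall x, 0 <= u x) ->
  (\int[mu]_x (u x)%:E <= M%:E)%E -> ibl u /\ RI u <= M.
Proof.
move=> mu_ u0 uM; have iu : ibl u by apply: ge0_ibl => //; apply: le_lt_trans uM (ltry _).
by split => //; rewrite -lee_fin RI_fin.
Qed.

Lemma iblD u v : ibl u -> ibl v -> ibl (fun x => u x + v x).
Proof. by move=> iu iv; apply: (integrableD _ iu iv). Qed.

Lemma iblB u v : ibl u -> ibl v -> ibl (fun x => u x - v x).
Proof. by move=> iu iv; apply: (integrableB _ iu iv). Qed.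

Lemma iblZ (c : R) u : ibl u -> ibl (fun x => c * u x).
Proof. by move=> iu; apply: (integrableZl _ c iu). Qed.

Lemma ibl_norm u : ibl u -> ibl (fun x => `|u x|).
Proof. by move=> iu; apply: integrable_norm. Qed.

Lemma RID u v : ibl u -> ibl v -> RI (fun x => u x + v x) = RI u + RI v.
Proof. by move=> iu iv; rewrite /RI RintegralD. Qed.

Lemma RIB u v : ibl u -> ibl v -> RI (fun x => u x - v x) = RI u - RI v.
Proof. by move=> iu iv; rewrite /RI RintegralB. Qed.

Lemma RIZ (c : R) u : ibl u -> RI (fun x => c * u x) = c * RI u.
Proof. by move=> iu; rewrite /RI RintegralZl. Qed.

Lemma le_RI u v : ibl u -> ibl v -> (forall x, u x <= v x) -> RI u <= RI v.
Proof. by move=> iu iv uv; apply: le_Rintegral. Qed.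

Lemma RI_ge0 u : (forall x, 0 <= u x) -> 0 <= RI u.
Proof. by move=> u0; apply: Rintegral_ge0. Qed.

Lemma le_normRI u v : ibl u -> ibl v -> (forall x, `|u x| <= v x) -> `|RI u| <= RI v.
Proof.
move=> iu iv uv; apply: le_trans (le_normr_Rintegral _ iu) _ => //.
by apply: le_RI => //; exact: ibl_norm.
Qed.

Lemma ae_imp (P Q : R -> Prop) : (forall x, P x -> Q x) ->
  {ae mu, forall x, P x} -> {ae mu, forall x, Q x}.
Proof. by move=> PQ; apply: (@filterS _ _ (ae_filter_ringOfSetsType mu)). Qed.

Lemma ae_imp2 (P Q S : R -> Prop) : (forall x, P x -> Q x -> S x) ->
  {ae mu, forall x, P x} -> {ae mu, forall x, Q x} -> {ae mu, forall x, S x}.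
Proof. by move=> PQ; apply: (@filterS2 _ _ (ae_filter_ringOfSetsType mu)). Qed.

Lemma ae_eq_RI u v : mfun u -> mfun v -> {ae mu, forall x, u x = v x} -> RI u = RI v.
Proof.
move=> mu_ mv uv; rewrite /RI /Rintegral; congr fine; apply: ae_eq_integral => //.
- exact/measurable_EFinP.
- exact/measurable_EFinP.
- by apply: ae_imp uv => x /= -> _.
Qed.

Lemma cvgn_EFin (u : nat -> R) (l : R) : u n @[n --> \oo] --> l ->
  (u n)%:E @[n --> \oo] --> l%:E.
Proof. by move=> ul; apply: cvg_EFin => //; exact: nearW. Qed.

Lemma dominated_RI (u_ : nat -> R -> R) u g : (forall n, mfun (u_ n)) -> mfun u ->
  {ae mu, forall x, u_ n x @[n --> \oo] --> u x} -> ibl g ->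
  (forall n x, `|u_ n x| <= g x) -> RI (u_ n) @[n --> \oo] --> RI u.
Proof.
move=> mu_ mu0 cu ig ug.
have ug' : {ae mu, forall x, forall n, setT x -> (`|(u_ n x)%:E| <= (EFin \o g) x)%E}.
  by apply: aeW => x n _; rewrite /= lee_fin.
have [iu _ H] := @dominated_convergence _ _ _ mu setT measurableT
  (fun n x => (u_ n x)%:E) (EFin \o u) (EFin \o g)
  (fun n => proj2 (measurable_EFinP _ _) (mu_ n)) (proj2 (measurable_EFinP _ _) mu0)
  (ae_imp _ _ (fun x h _ => cvgn_EFin _ _ h) cu) ig
  ug'.
apply: fine_cvg; move: H; rewrite -/(ibl u) in iu.
by rewrite /= -(RI_fin u iu).
Qed.

Lemma ibl_mkcond u (a b : R) : ibl u ->
  mu.-integrable `[a, b] (EFin \o u).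
Proof. by move=> iu; apply: (integrableS _ _ _ iu). Qed.

Lemma ibl_patch u (a b : R) : ibl u -> ibl (u \_ `[a, b]).
Proof.
by move=> /(ibl_mkcond _ a b); rewrite integrable_mkcond // restrict_EFin.
Qed.

(** Dominated convergence on the complements of [[-n, n]]. The estimate is uniform over all
    intervals containing [[-X, X]], as needed when the endpoints move. *)
Lemma RI_tail u : ibl u -> forall e : R, 0 < e -> exists2 X : R, 0 < X &
  forall a b, a <= - X -> X <= b -> `|(\int[mu]_(x in `[a, b]) u x)%R - RI u| <= e.
Proof.
move=> iu e e0.
pose w (n : nat) := \1_(~` `[- n%:R, n%:R]%classic) : R -> R.
have mw n : mfun (w n) by apply: measurable_indic; apply: measurableC.
have mwu n : mfun (fun x => w n x * `|u x|).
  exact: (measurable_funM (mw n) (ibl_mfun _ (ibl_norm _ iu))).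
have w01 n x : 0 <= w n x <= 1.
  by rewrite /w indicE; case: (_ \in _); rewrite lexx ler01.
have wn n x : `|w n x * `|u x| | <= `|u x|.
  have /andP [w0 w1] := w01 n x.
  by rewrite normrM normr_id ger0_norm // ler_piMl.
have lim0 : RI (fun x => w n x * `|u x|) @[n --> \oo] --> RI (fun=> 0 : R).
  apply: (dominated_RI (fun n x => w n x * `|u x|) _ _ mwu _ _ (ibl_norm _ iu) wn).
    exact: measurable_cst.
  apply: aeW => x; apply: cvg_near_cst; exists (Num.bound `|x|) => // n /= hn.
  have xn : `|x| <= n%:R.
    by apply: le_trans (ltW (archi_boundP (normr_ge0 x))) _; rewrite ler_nat.
  rewrite /w indicE memNset ?mul0r //=; apply; rewrite /= in_itv /= -ler_norml.
  exact: xn.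
rewrite {2}/RI Rintegral_cst // mul0r in lim0.
have /cvgrPdist_le /(_ e e0) [N _ NP] := lim0.
(* The successor makes the radius positive. *)
have /= := NP N.+1 (leqnSn N); rewrite sub0r normrN ger0_norm; last first.
  by apply: RI_ge0 => x; rewrite mulr_ge0 //; case/andP: (w01 N.+1 x).
move=> He; exists N.+1%:R => // a b aN Nb; apply: le_trans He.
rewrite Rintegral_mkcond -/(RI _).
have ir := ibl_patch u a b iu.
rewrite -RIB //; apply: le_normRI.
- exact: iblB.
- by apply: ibl_le (mwu _) (wn _) (ibl_norm _ iu).
move=> x; rewrite patchE /w indicE.
case: ifPn => [_|]; first by rewrite subrr normr0 mulr_ge0.
rewrite notin_setE => xab; rewrite sub0r normrN mem_set ?mul1r //= => xN.
apply: xab; move: xN; rewrite /= !in_itv /= => /andP [h1 h2].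
by rewrite (le_trans aN h1) (le_trans h2 Nb).
Qed.

Lemma RI_FTC u (U : R -> R) a b : a <= b -> continuous u ->
  (forall x : R, is_derive x 1 U (u x)) -> (\int[mu]_(x in `[a, b]) u x)%R = U b - U a.
Proof.
rewrite le_eqVlt => /predU1P [<- _ _|ab cu dU].
  by rewrite set_itv1 Rintegral_set1 subrr.
have cU : continuous U.
  by move=> x; apply: differentiable_continuous; apply/derivable1_diffP; case: (dU x).
rewrite /Rintegral (@continuous_FTC2 _ u U) //.
- exact: continuous_subspaceT.
- split=> [x _||]; first by case: (dU x).
  + exact/cvg_at_right_filter/cU.
  + exact/cvg_at_left_filter/cU.
- by move=> x _; rewrite derive1E derive_val.
Qed.

Lemma le_RI_itv u v a b : continuous u -> ibl v -> (forall x, `|u x| <= v x) ->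
  `|(\int[mu]_(x in `[a, b]) u x)%R| <= RI v.
Proof.
move=> cu iv uv; apply: le_trans (le_normr_Rintegral _ _) _ => //.
  exact: continuous_integrable_itv.
have iu : ibl u.
  by apply: ibl_le uv iv; exact: continuous_measurable_fun.
rewrite Rintegral_mkcond; apply: le_RI => //; first exact: ibl_patch (ibl_norm _ iu).
move=> x; rewrite patchE; case: ifP => // _.
exact: le_trans (normr_ge0 _) (uv x).
Qed.

End LineIntegral.

(** * Hardy classes of the upper half-plane *)

Section HardyH1.
Context {R : realType}.
Local Notation mu := (@lebesgue_measure R).

Lemma mfun_normc (f : R -> R[i]) : cmeasurable f -> mfun (fun x => normc (f x)).
Proof.
move=> [mr mi]; have -> : (fun x => normc (f x)) =
    (fun x => Num.sqrt (complex.Re (f x) ^+ 2 + complex.Im (f x) ^+ 2)).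
  by apply/funext => x; case: (f x).
apply: (measurableT_comp (f := @Num.sqrt R)).
  by apply: continuous_measurable_fun; exact: sqrt_continuous.
by apply: measurable_funD; apply: measurable_funX.
Qed.

Lemma cmeasurable_line (F : R[i] -> R[i]) y : hol F -> 0 < y ->
  cmeasurable (fun x => F (Complex x y)).
Proof.
move=> holF y0; have [cr ci] := cdable_continuous F y (fun x => holF (Complex x y) y0).
by split; exact: continuous_measurable_fun.
Qed.

Definition H1bound (K : R[i] -> R[i]) (M : R) := forall t : R, 0 < t ->
  (\int[mu]_x (normc (K (Complex x t)))%:E <= M%:E)%E.

(** Real parts suffice, since only the real part of the pairing of phi f with v is ever
    estimated. *)
Definition lineRe (K : R[i] -> R[i]) (t : R) := RI (fun x => complex.Re (K (Complex x t))).

Section Fixed.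
Variables (K : R[i] -> R[i]) (M : R) (holK : hol K) (KM : H1bound K M).

Lemma H1_ibl t : 0 < t -> ibl (fun x => normc (K (Complex x t))) /\
  RI (fun x => normc (K (Complex x t))) <= M.
Proof.
move=> t0; apply: ge0_ibl_bound => [|x|]; last exact: KM.
- exact: mfun_normc (cmeasurable_line _ _ holK t0).
- exact: normc_ge0.
Qed.

Lemma H1_iblRe t : 0 < t -> ibl (fun x => complex.Re (K (Complex x t))).
Proof.
move=> t0; have [i1 _] := H1_ibl t t0; apply: ibl_le i1.
- by case: (cmeasurable_line _ _ holK t0).
- by move=> x; exact: Re_le_normc.
Qed.

Lemma lineRe_le t : 0 < t -> `|lineRe K t| <= M.
Proof.
move=> t0; have [i1 le1] := H1_ibl t t0; apply: le_trans le1.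
apply: le_normRI => //; first exact: H1_iblRe.
by move=> x; exact: Re_le_normc.
Qed.

(* With P' = K and Q' = P, the quotient Psi X / X averages the integral of K over the
   intervals [x - 3X, x] with X <= x <= 2X, while the height derivative of Psi X is an
   integral of K again: vertical sides of rectangles are never estimated. *)
Lemma lineRe_cst (s t : R) : 0 < s -> s <= t -> lineRe K s = lineRe K t.
Proof.
move=> s0 st.
have [P dP] := holomorphic_primitive K holK.
have holP : hol P by move=> z /dP h; apply/cdableP; exists (K z).
have [Q dQ] := holomorphic_primitive P holP.
have t0 : 0 < t by exact: lt_le_trans st.
have M0 : 0 <= M by apply: le_trans (lineRe_le s s0).
pose Psi X y := complex.Re (Q (Complex (2 * X) y)) - complex.Re (Q (Complex X y))
  - (complex.Re (Q (Complex (- X) y)) - complex.Re (Q (Complex (- (2 * X)) y))).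
(* An increment of [P] along a horizontal line is an integral of [K], hence at most the H^1
   bound. *)
have ImP a b y : a <= b -> 0 < y ->
    `|complex.Im (P (Complex b y)) - complex.Im (P (Complex a y))| <= M.
  move=> ab y0; have [i1 le1] := H1_ibl y y0; apply: le_trans le1.
  have [_ ci] := cdable_continuous K y (fun x => holK (Complex x y) y0).
  have <- := @RI_FTC _ (fun x => complex.Im (K (Complex x y)))
     (fun x => complex.Im (P (Complex x y))) a b ab ci
     (fun x => proj2 (cdiff_horizontal _ _ _ _ (dP (Complex x y) y0))).
  by apply: le_RI_itv => // x; exact: Im_le_normc.
(* By Cauchy-Riemann the height derivative of Re Q is - Im P, so that of [Psi X] is made of two
   increments of Im P; the bound does not depend on [X]. *)
have PsiM X : 0 < X -> `|Psi X t - Psi X s| <= 2 * M * (t - s).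
  move=> X0.
  apply: (@real_MVT_bound _ (Psi X) (fun y =>
    - complex.Im (P (Complex (2 * X) y)) - - complex.Im (P (Complex X y))
    - (- complex.Im (P (Complex (- X) y)) - - complex.Im (P (Complex (- (2 * X)) y))))) => //.
    move=> y /andP [sy _]; have y0 := lt_le_trans s0 sy.
    have dv (x : R) : is_derive y 1 (fun y => complex.Re (Q (Complex x y))) (- complex.Im (P (Complex x y))).
      by have /= := dQ (Complex x y) y0 => /cdiff_vertical [].
    by apply: is_deriveB; apply: is_deriveB; exact: dv.
  move=> y /andP [sy _]; have y0 := lt_le_trans s0 sy.
  have := ImP X (2 * X) y _ y0; have := ImP (- (2 * X)) (- X) y _ y0.
  rewrite !ler_norml; move=> h1 h2.
  have /andP [? ?] : - M <= complex.Im (P (Complex (- X) y)) - complex.Im (P (Complex (- (2 * X)) y)) <= M by apply: h1; lra.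
  have /andP [? ?] : - M <= complex.Im (P (Complex (2 * X) y)) - complex.Im (P (Complex X y)) <= M by apply: h2; lra.
  apply/andP; split; lra.
(* [Psi X y] is the increment over [[X, 2X]] of Re Q(x) - Re Q(x - 3X), whose derivative is the
   integral of Re K over [[x - 3X, x]]. These intervals contain [[-X, X]], so the derivative is
   within [e] of [lineRe K y]. *)
have PsiX y e : 0 < y -> 0 < e -> exists2 X0 : R, 0 < X0 &
    forall X, X0 <= X -> `|Psi X y - lineRe K y * X| <= e * X.
  move=> y0 e0; have [X0 X00 X0P] := RI_tail _ (H1_iblRe y y0) e e0.
  exists X0 => // X X0X.
  have [cr _] := cdable_continuous K y (fun x => holK (Complex x y) y0).
  pose w (x : R) := complex.Re (Q (Complex x y)) - complex.Re (Q (Complex (x - 3 * X) y))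
    - lineRe K y * x.
  have -> : Psi X y - lineRe K y * X = w (2 * X) - w X.
    rewrite /Psi /w (_ : 2 * X - 3 * X = - X); last by ring.
    rewrite (_ : X - 3 * X = - (2 * X)); last by ring.
    ring.
  rewrite [e * X](_ : _ = e * (2 * X - X)); last by ring.
  apply: (@real_MVT_bound _ w (fun x => complex.Re (P (Complex x y))
    - complex.Re (P (Complex (x - 3 * X) y)) - lineRe K y)); first lra.
    move=> x _.
    have dv (x' : R) : is_derive x' 1 (fun x => complex.Re (Q (Complex x y))) (complex.Re (P (Complex x' y))).
      by have /= := dQ (Complex x' y) y0 => /cdiff_horizontal [].
    have d2 : is_derive x 1 (fun x => complex.Re (Q (Complex (x - 3 * X) y)))
        (complex.Re (P (Complex (x - 3 * X) y))).
      apply: is_derive_eq; first exact: (is_derive1_comp (dv _) (is_derive_shift x 1 (- (3 * X)))).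
      by rewrite mulr1.
    have d3 : is_derive x 1 (fun x => lineRe K y * x) (lineRe K y).
      have d := @is_deriveZ R R R id (lineRe K y) x 1 1 (is_derive_id x 1).
      by move: d; rewrite /GRing.scale /= mulr1.
    exact: (is_deriveB (is_deriveB (dv x) d2) d3).
  move=> x /andP [Xx x2X].
  have ab : x - 3 * X <= x by lra.
  have <- := @RI_FTC _ (fun x => complex.Re (K (Complex x y)))
     (fun x => complex.Re (P (Complex x y))) _ _ ab cr
     (fun x => proj1 (cdiff_horizontal _ _ _ _ (dP (Complex x y) y0))).
  by apply: X0P; lra.
apply/eqP; rewrite -subr_eq0 -normr_le0; apply/ler_addgt0Pr => e e0; rewrite add0r.
have e30 : 0 < e / 3 by rewrite divr_gt0.
have [X1 X10 X1P] := PsiX s _ s0 e30; have [X2 X20 X2P] := PsiX t _ t0 e30.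
(* Beyond both thresholds, and so large that the bounded change of [Psi X] between the two heights
   is at most (e/3) X. *)
pose X := X1 + X2 + 2 * M * (t - s) / (e / 3).
have D0 : 0 <= 2 * M * (t - s) / (e / 3).
  by rewrite divr_ge0 ?(ltW e30) // !mulr_ge0 // subr_ge0.
have X1X : X1 <= X by rewrite /X; lra.
have X2X : X2 <= X by rewrite /X; lra.
have X0 : 0 < X by rewrite /X; lra.
have h1 := X1P X X1X; have h2 := X2P X X2X; have h3 := PsiM X X0.
have h4 : 2 * M * (t - s) <= e / 3 * X.
  rewrite -[X in _ <= X]mulrC -ler_pdivrMr // /X; lra.
rewrite -(ler_pM2r X0) -[X in _ * X](gtr0_norm X0) -normrM.
rewrite (_ : (lineRe K s - lineRe K t) * X = - (Psi X s - lineRe K s * X)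
   + (Psi X t - lineRe K t * X) - (Psi X t - Psi X s)); last by ring.
apply: le_trans (ler_normB _ _) _; apply: le_trans (lerD (ler_normD _ _) (lexx _)) _.
rewrite normrN; lra.
Qed.

End Fixed.
End HardyH1.

(** * Vanishing line integrals and orthogonality in the half-plane *)

Section HardyOrthogonality.
Context {R : realType}.
Local Notation mu := (@lebesgue_measure R).

Lemma hol_cst c : hol (fun=> c : R[i]).
Proof. by move=> z _; exact: cdable_cst. Qed.

Lemma hol_id : hol (id : R[i] -> R[i]).
Proof. by move=> z _; exact: cdable_id. Qed.

Lemma holD (F G : R[i] -> R[i]) : hol F -> hol G -> hol (fun z => F z + G z).
Proof. by move=> hF hG z z0; apply: cdableD; [exact: hF|exact: hG]. Qed.

Lemma holB (F G : R[i] -> R[i]) : hol F -> hol G -> hol (fun z => F z - G z).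
Proof. by move=> hF hG z z0; apply: cdableB; [exact: hF|exact: hG]. Qed.

Lemma holM (F G : R[i] -> R[i]) : hol F -> hol G -> hol (fun z => F z * G z).
Proof. by move=> hF hG z z0; apply: cdableM; [exact: hF|exact: hG]. Qed.

Lemma holV (F : R[i] -> R[i]) : (forall z, 0 < complex.Im z -> F z != 0) -> hol F ->
  hol (fun z => (F z)^-1).
Proof. by move=> F0 hF z z0; apply: cdableV; [exact: F0|exact: hF]. Qed.

Lemma hol_shift (F : R[i] -> R[i]) (s : R) : 0 <= s -> hol F ->
  hol (fun z => F (z + Complex 0 s)).
Proof.
move=> s0 hF z z0; apply: cdable_shift; apply: hF.
by rewrite ImD /= ltr_wpDr.
Qed.

Lemma le_integral_EFin (u v : R -> R) : mfun u -> mfun v -> (forall x, 0 <= u x) ->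
  (forall x, u x <= v x) -> (\int[mu]_x (u x)%:E <= \int[mu]_x (v x)%:E)%E.
Proof.
move=> mu_ mv u0 uv; apply: ge0_le_integral => //.
- by move=> x _; rewrite lee_fin.
- exact/measurable_EFinP.
- exact/measurable_EFinP.
- by move=> x _; rewrite lee_fin.
Qed.

(* The factor n / (n - i z) makes the integral, which does not depend on the height,
   tend to 0 at large heights. *)
Lemma lineRe0 (K : R[i] -> R[i]) M t : hol K -> H1bound K M -> 0 < t -> lineRe K t = 0.
Proof.
move=> holK KM t0.
pose N n : R := n.+1%:R.
have N0 n : 0 < N n by rewrite /N ltr0n.
pose D n (z : R[i]) := (N n)%:C - Complex 0 1 * z.
have ReDn n z : complex.Re (D n z) = N n + complex.Im z.
  by rewrite /D; case: z => a b /=; ring.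
have Dge n z : 0 < complex.Im z -> N n + complex.Im z <= normc (D n z).
  by move=> z0; rewrite -ReDn; apply: le_trans (Re_le_normc _); exact: ler_norm.
have Dgt n z : 0 < complex.Im z -> 0 < normc (D n z).
  by move=> z0; apply: lt_le_trans (Dge n z z0); rewrite addr_gt0.
have D0 n z : 0 < complex.Im z -> D n z != 0.
  by move=> z0; rewrite -normc_gt0 Dgt.
pose Kn n z := K z * ((N n)%:C / D n z).
have holKn n : hol (Kn n).
  have holDn : hol (D n).
    exact: (holB _ _ (hol_cst _) (holM _ _ (hol_cst _) hol_id)).
  exact: (holM K _ holK (holM _ _ (hol_cst _) (holV (D n) (D0 n) holDn))).
have Kn_le n z : 0 < complex.Im z ->
    normc (Kn n z) <= N n / (N n + complex.Im z) * normc (K z).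
  move=> z0; rewrite /Kn normcM mulrC ler_wpM2r ?normc_ge0 //.
  rewrite normcM normcV normc_real gtr0_norm // ler_wpM2l ?(ltW (N0 n)) //.
  by rewrite lef_pV2 ?posrE ?Dgt ?Dge ?addr_gt0.
have Kn_le1 n z : 0 < complex.Im z -> normc (Kn n z) <= normc (K z).
  move=> z0; apply: le_trans (Kn_le n z z0) _.
  rewrite ler_piMl ?normc_ge0 // ler_pdivrMr ?addr_gt0 // mul1r lerDl; exact: ltW.
have mK n s : 0 < s -> mfun (fun x => normc (Kn n (Complex x s))).
  by move=> s0; apply: mfun_normc (cmeasurable_line _ _ (holKn n) s0).
have KnM n : H1bound (Kn n) M.
  move=> s s0; apply: le_trans (KM s s0); apply: le_integral_EFin.
  - exact: mK.
  - exact: mfun_normc (cmeasurable_line _ _ holK s0).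
  - by move=> x; exact: normc_ge0.
  - by move=> x; exact: Kn_le1.
have Kn0 n : lineRe (Kn n) t = 0.
  apply/eqP; rewrite -normr_le0; apply/ler_addgt0Pr => e e0; rewrite add0r.
  have M0 : 0 <= M by apply: le_trans (lineRe_le K M holK KM t t0).
  (* At height [s] the damping factor N/(N + s) brings the bound [M] below [e]. *)
  pose s := t + N n * M / e.
  have NM0 : 0 <= N n * M / e by rewrite divr_ge0 ?mulr_ge0 ?(ltW e0) ?(ltW (N0 n)).
  have ts : t <= s by rewrite lerDl.
  have s0 : 0 < s by exact: lt_le_trans ts.
  rewrite (lineRe_cst (Kn n) M (holKn n) (KnM n) t s t0 ts).
  have [iK leK] := H1_ibl K M holK KM s s0.
  apply: (@le_trans _ _ (RI (fun x => N n / (N n + s) * normc (K (Complex x s))))).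
    apply: le_normRI; first exact: H1_iblRe (holKn n) (KnM n) _ s0.
    - exact: iblZ.
    - by move=> x; apply: le_trans (Re_le_normc _) _; exact: Kn_le.
  rewrite RIZ //; apply: le_trans (ler_wpM2l _ leK) _.
    by apply: divr_ge0; [exact: ltW|apply: addr_ge0; exact: ltW].
  have sN : 0 < N n + s by apply: addr_gt0.
  rewrite mulrAC ler_pdivrMr // -ler_pdivrMl // mulrC /s.
  by have := N0 n; lra.
have cvgKn : RI (fun x => complex.Re (Kn n (Complex x t))) @[n --> \oo] --> lineRe K t.
  have [iK _] := H1_ibl K M holK KM t t0.
  apply: (dominated_RI (fun n x => complex.Re (Kn n (Complex x t))) _ _ _ _ _ iK).
  - by move=> n; case: (cmeasurable_line _ _ (holKn n) t0).
  - by case: (cmeasurable_line _ _ holK t0).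
  - apply: aeW => x; apply/cvgrPdist_le => e e0.
    pose z := Complex x t; pose c := normc (K z) * normc z.
    exists (Num.bound (c / e)) => // n /= hn.
    have cN : c / e <= N n.
      have c0 : 0 <= c / e by rewrite divr_ge0 ?(ltW e0) // mulr_ge0 ?normc_ge0.
      apply: le_trans (ltW (archi_boundP c0)) _.
      by rewrite /N ler_nat (leq_trans hn).
    rewrite -ReN -ReD -/z; apply: le_trans (Re_le_normc _) _.
    (* The difference is a fixed quantity over [D n z], whose modulus is at least [N n]; this gives
       pointwise convergence. *)
    have -> : K z - Kn n z = - K z * Complex 0 1 * z / D n z.
      have iz : Complex 0 1 * z = (N n)%:C - D n z by rewrite /D; ring.
      have := D0 n z t0; rewrite -[- K z * _ * z]mulrA iz /Kn.
      by move: (D n z) => d Dn0; field.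
    rewrite !normcM normc_opp normc_imag normr1 mulr1 normcV -/c.
    rewrite ler_pdivrMr ?Dgt // mulrC -ler_pdivrMr //; apply: le_trans cN _.
    by apply: le_trans (Dge n z t0); rewrite lerDl ltW.
  - by move=> n x; apply: le_trans (Re_le_normc _) (Kn_le1 _ _ _).
have E : (fun n => RI (fun x => complex.Re (Kn n (Complex x t)))) = (fun=> 0).
  by apply/funext => n; exact: Kn0.
rewrite E in cvgKn.
by rewrite -(cvg_lim (@Rhausdorff R) cvgKn) lim_cst.
Qed.

(** The product of two vertically shifted H^2 functions is in H^1, because |FG| <= |F|^2 + |G|^2.
    The two heights are independent because the boundary limits of the two factors are taken one
    after the other. *)
Lemma H2_orth (F G : R[i] -> R[i]) (M1 M2 y y' : R) : hol F -> hol G ->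
  (forall t, 0 < t -> (\int[mu]_x (sqmod (F (Complex x t)))%:E <= M1%:E)%E) ->
  (forall t, 0 < t -> (\int[mu]_x (sqmod (G (Complex x t)))%:E <= M2%:E)%E) ->
  0 < y -> 0 < y' ->
  ibl (fun x => normc (F (Complex x y) * G (Complex x y'))) /\
  RI (fun x => complex.Re (F (Complex x y) * G (Complex x y'))) = 0.
Proof.
move=> hF hG FM GM y0 y'0.
(* A common positive height below both: shifting by [y - d] and [y' - d] puts both factors on the
   line at height [d]. *)
pose d := Num.min y y' / 2.
have [d0 dy dy'] : [/\ 0 < d, d <= y & d <= y'].
  by rewrite /d; case: (leP y y') => h; split; lra.
pose K z := F (z + Complex 0 (y - d)) * G (z + Complex 0 (y' - d)).
have holK : hol K.
  by apply: (holM (fun z => F (z + _)) (fun z => G (z + _))); apply: hol_shift; rewrite ?subr_ge0.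
have KM : H1bound K (M1 + M2).
  move=> t t0.
  have t1 : 0 < t + (y - d) by lra.
  have t2 : 0 < t + (y' - d) by lra.
  have msq (H : R[i] -> R[i]) s : hol H -> 0 < s -> mfun (fun x => sqmod (H (Complex x s))).
    move=> hH s0; have [mr mi] := cmeasurable_line _ _ hH s0.
    by apply: measurable_funD; apply: measurable_funX.
  rewrite EFinD; apply: le_trans (leeD (FM _ t1) (GM _ t2)).
  rewrite -ge0_integralD //=; last 4 first.
  - by move=> x _; rewrite lee_fin sqmodE sqr_ge0.
  - by apply/measurable_EFinP; exact: msq.
  - by move=> x _; rewrite lee_fin sqmodE sqr_ge0.
  - by apply/measurable_EFinP; exact: msq.
  apply: le_integral_EFin.
  - exact: mfun_normc (cmeasurable_line _ _ holK t0).
  - by apply: measurable_funD; exact: msq.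
  - by move=> x; exact: normc_ge0.
  move=> x; rewrite /K normcM !sqmodE.
  rewrite -![Complex x t + _]/(Complex (x + 0) (t + _)) addr0.
  have := sqr_ge0 (normc (F (Complex x (t + (y - d)))) - normc (G (Complex x (t + (y' - d))))).
  have := normc_ge0 (F (Complex x (t + (y - d)))).
  have := normc_ge0 (G (Complex x (t + (y' - d)))).
  set a := normc _; set b := normc _ => *; nra.
have KE x : K (Complex x d) = F (Complex x y) * G (Complex x y').
  rewrite /K -![Complex x d + _]/(Complex (x + 0) (d + _)) addr0.
  by rewrite ![d + _]addrC !subrK.
have := lineRe0 K _ d holK KM d0; have [+ _] := H1_ibl K _ holK KM d d0.
rewrite /lineRe; under eq_fun do rewrite KE; move=> h1.
by under eq_fun do rewrite KE; move=> h2.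
Qed.

End HardyOrthogonality.

(** * Passage to the boundary in the pairing of two Hardy functions *)

Section BoundaryPairing.
Context {R : realType}.
Local Notation mu := (@lebesgue_measure R).

Lemma cmeasurableM (f g : R -> R[i]) : cmeasurable f -> cmeasurable g ->
  cmeasurable (fun x => f x * g x).
Proof.
move=> [f1 f2] [g1 g2]; split.
- under eq_fun do rewrite ReM; apply: measurable_funB; exact: measurable_funM.
- under eq_fun do rewrite ImM; apply: measurable_funD; exact: measurable_funM.
Qed.

Lemma cmeasurableB (f g : R -> R[i]) : cmeasurable f -> cmeasurable g ->
  cmeasurable (fun x => f x - g x).
Proof.
move=> [f1 f2] [g1 g2]; split.
- under eq_fun do rewrite ReD ReN; exact: measurable_funB.
- under eq_fun do rewrite ImD ImN; exact: measurable_funB.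
Qed.

Lemma mfunM (u v : R -> R) : mfun u -> mfun v -> mfun (fun x => u x * v x).
Proof. exact: measurable_funM. Qed.

Lemma mfunD (u v : R -> R) : mfun u -> mfun v -> mfun (fun x => u x + v x).
Proof. exact: measurable_funD. Qed.

Lemma mfunB (u v : R -> R) : mfun u -> mfun v -> mfun (fun x => u x - v x).
Proof. exact: measurable_funB. Qed.

Lemma mfunX (u : R -> R) n : mfun u -> mfun (fun x => u x ^+ n).
Proof. exact: measurable_funX. Qed.

Lemma mfun_cst (c : R) : mfun (fun=> c).
Proof. exact: measurable_cst. Qed.

Lemma mfun_min (u v : R -> R) : mfun u -> mfun v -> mfun (fun x => Num.min (u x) (v x)).
Proof. exact: measurable_minr. Qed.

Lemma mfun_max (u v : R -> R) : mfun u -> mfun v -> mfun (fun x => Num.max (u x) (v x)).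
Proof. exact: measurable_maxr. Qed.

Lemma ibl_mul (a b : R -> R) : mfun a -> mfun b ->
  ibl (fun x => a x ^+ 2) -> ibl (fun x => b x ^+ 2) -> ibl (fun x => a x * b x).
Proof.
move=> ma mb ia ib; apply: ibl_le (mfunM _ _ ma mb) _ (iblD _ _ ia ib) => x /=.
rewrite ler_norml; have := sqr_ge0 (a x - b x); have := sqr_ge0 (a x + b x).
have := sqr_ge0 (a x); have := sqr_ge0 (b x).
by move=> *; apply/andP; split; nra.
Qed.

(* u g <= min(u, l g) g + u^2 / l, where the first term is dominated by l g^2. *)
Lemma square_bounded_weak_cvg (u_ : nat -> R -> R) (g : R -> R) (M : R) :
  (forall n, mfun (u_ n)) -> (forall n x, 0 <= u_ n x) ->
  {ae mu, forall x, u_ n x @[n --> \oo] --> (0 : R)} ->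
  (forall n, ibl (fun x => u_ n x ^+ 2)) -> (forall n, RI (fun x => u_ n x ^+ 2) <= M) ->
  mfun g -> (forall x, 0 <= g x) -> ibl (fun x => g x ^+ 2) ->
  forall e : R, 0 < e -> \forall n \near \oo, RI (fun x => u_ n x * g x) <= e.
Proof.
move=> mu_ u0 ulim iu uM mg g0 ig e e0.
have M0 : 0 <= M by apply: le_trans (uM 0%N); apply: RI_ge0 => x; exact: sqr_ge0.
(* Large enough for M / l <= e / 2; the other half of [e] is left for the dominated term. *)
pose l := 2 * M / e + 1.
have Me0 : 0 <= 2 * M / e by rewrite divr_ge0 ?mulr_ge0 ?(ltW e0).
have l0 : 0 < l by rewrite /l; lra.
pose w n x := Num.min (u_ n x) (l * g x) * g x.
have mw n : mfun (w n).
  by apply: mfunM => //; apply: mfun_min => //; apply: mfunM => //; exact: mfun_cst.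
have w0 n x : 0 <= w n x by rewrite mulr_ge0 // le_min u0 mulr_ge0 // ltW.
have ilg := iblZ l _ ig.
have wg n x : `|w n x| <= l * g x ^+ 2.
  rewrite ger0_norm // /w expr2 mulrA ler_wpM2r //.
  by rewrite ge_min lexx orbT.
have lim : RI (w n) @[n --> \oo] --> RI (fun=> 0 : R).
  apply: (dominated_RI w _ _ mw (mfun_cst 0) _ ilg wg).
  apply: ae_imp ulim => x ux; apply: (@squeeze_cvgr _ _ _ _ (fun=> 0) (fun n => u_ n x * g x)).
  - apply: nearW => n; rewrite w0 /= /w ler_wpM2r //.
    by rewrite ge_min lexx.
  - exact: cvg_cst.
  - rewrite -[X in _ --> X](mul0r (g x)); apply: cvgM => //; exact: cvg_cst.
rewrite {2}/RI Rintegral_cst // mul0r in lim.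
have e20 : 0 < e / 2 by rewrite divr_gt0.
move/cvgrPdist_le: lim => /(_ _ e20); apply: filterS => n.
rewrite sub0r normrN ger0_norm; last exact: RI_ge0.
move=> wn.
apply: (@le_trans _ _ (RI (fun x => w n x + l^-1 * u_ n x ^+ 2))).
  apply: le_RI.
  - exact: ibl_mul.
  - by apply: iblD; [exact: ibl_le (mw n) (wg n) ilg|exact: iblZ].
  move=> x; rewrite /w; case: (leP (u_ n x) (l * g x)) => h.
    by rewrite lerDl mulr_ge0 ?sqr_ge0 // invr_ge0 ltW.
  rewrite -[X in X <= _]add0r lerD //; first by rewrite !mulr_ge0 // ltW.
  rewrite expr2 mulrCA ler_wpM2l // -ler_pdivrMl ?invr_gt0 // invrK.
  exact: ltW.
rewrite RID; last 2 first.
- exact: ibl_le (mw n) (wg n) ilg.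
- exact: iblZ.
rewrite RIZ // [e]splitr lerD //.
rewrite mulrC ler_pdivrMr //; apply: le_trans (uM n) _.
have -> : M = e / 2 * (2 * M / e) by field; rewrite gt_eqF.
by rewrite ler_wpM2l ?(ltW e20) // lerDl.
Qed.

(** Vertical limits are followed along this sequence of heights only, since dominated convergence is
    stated for sequences. *)
Definition yseq (n : nat) : R := n.+1%:R^-1.

Lemma yseq_gt0 n : 0 < yseq n.
Proof. by rewrite invr_gt0 ltr0n. Qed.

Lemma yseq_small (d : R) : 0 < d -> \forall n \near \oo, yseq n < d.
Proof.
move=> d0; exists (Num.bound d^-1) => // n /= hn.
rewrite /yseq -[d]invrK ltf_pV2 ?posrE ?invr_gt0 ?ltr0n //.
apply: lt_le_trans (archi_boundP _) _; first by rewrite invr_ge0 ltW.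
by rewrite ler_nat (leq_trans hn).
Qed.

Lemma cvg_at_right_yseq (F : R -> R[i]) (l : R[i]) :
  (fun y : R => (F y : CN R)) @ 0^'+ --> (l : CN R) ->
  normc (F (yseq n) - l) @[n --> \oo] --> (0 : R).
Proof.
move=> Fl; apply/cvgrPdist_le => e e0.
have e0' : (0 : R[i]) < e%:C by rewrite ltcR.
move/cvgrPdist_le: Fl => /(_ _ e0'); rewrite near_withinE => /nbhs_ballP [d d0 dP].
have := yseq_small d d0; apply: filterS => n nd.
have := dP (yseq n); rewrite /ball /= sub0r normrN gtr0_norm ?yseq_gt0 // => /(_ nd isT).
by rewrite normr_normc lecR sub0r normrN ger0_norm ?normc_ge0 // normc_distC.
Qed.

Definition bval (F : R[i] -> R[i]) (f : R -> R[i]) :=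
  {ae mu, forall x, normc (F (Complex x (yseq n)) - f x) @[n --> \oo] --> (0 : R)}.

Definition sqi (f : R -> R[i]) := cmeasurable f /\ ibl (fun x => normc (f x) ^+ 2).

(** An H^2 function together with an extension and a bound for it, so that f and the conjugate of v
    can be treated alike. *)
Definition h2pair (F : R[i] -> R[i]) (f : R -> R[i]) (M : R) :=
  [/\ hol F, (forall t, 0 < t -> (\int[mu]_x (sqmod (F (Complex x t)))%:E <= M%:E)%E),
      sqi f & bval F f].

Lemma h2_line F f M t : h2pair F f M -> 0 < t ->
  sqi (fun x => F (Complex x t)) /\ RI (fun x => normc (F (Complex x t)) ^+ 2) <= M.
Proof.
move=> [hF FM _ _] t0; have mF := cmeasurable_line F t hF t0.
have mF2 : mfun (fun x => normc (F (Complex x t)) ^+ 2) := mfunX _ 2 (mfun_normc _ mF).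
have [||i1 i2] := ge0_ibl_bound _ M mF2.
- by move=> x; exact: sqr_ge0.
- have := FM t t0; rewrite (_ : (fun x => _) = (fun x => (normc (F (Complex x t)) ^+ 2)%:E)) //.
  by apply/funext => x; rewrite sqmodE.
by split.
Qed.

Lemma RI_normc_diff_sq (f g : R -> R[i]) : sqi f -> sqi g ->
  ibl (fun x => normc (f x - g x) ^+ 2) /\
  RI (fun x => normc (f x - g x) ^+ 2) <=
    2 * RI (fun x => normc (f x) ^+ 2) + 2 * RI (fun x => normc (g x) ^+ 2).
Proof.
move=> [mf if2] [mg ig2].
have m := mfunX _ 2 (mfun_normc _ (cmeasurableB _ _ mf mg)).
have le x : normc (f x - g x) ^+ 2 <= 2 * normc (f x) ^+ 2 + 2 * normc (g x) ^+ 2.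
  have := normc_triangle (f x) (- g x); rewrite normc_opp => h.
  apply: (@le_trans _ _ ((normc (f x) + normc (g x)) ^+ 2)).
    by rewrite ler_sqr ?nnegrE ?addr_ge0 ?normc_ge0.
  have := sqr_ge0 (normc (f x) - normc (g x)); lra.
have i2 := iblD _ _ (iblZ 2 _ if2) (iblZ 2 _ ig2).
have i1 : ibl (fun x => normc (f x - g x) ^+ 2).
  by apply: ibl_le m _ i2 => x; rewrite ger0_norm ?sqr_ge0.
split => //; rewrite -!RIZ // -RID; [|exact: iblZ|exact: iblZ].
exact: le_RI.
Qed.

(* The weak limit is taken in the two factors one after the other, so that one factor
   is always a fixed L^2 function; no strong convergence to the boundary is needed. *)
Lemma boundary_pairing (beta F G : R[i] -> R[i]) (f g s : R -> R[i]) (m : R -> R)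
    (C Cs Cm M1 M2 : R) :
  hol beta -> (forall z, 0 < complex.Im z -> normc (beta z) <= C) ->
  cmeasurable s -> (forall x, normc (s x) <= Cs) ->
  mfun m -> (forall x, 0 <= m x <= Cm) ->
  {ae mu, forall x, \forall n \near \oo, normc (beta (Complex x (yseq n)) - s x) <= m x} ->
  h2pair F f M1 -> h2pair G g M2 ->
  RI (fun x => complex.Re (s x * f x * g x)) <= RI (fun x => m x * (normc (f x) * normc (g x))).
Proof.
move=> hb bC ms sC mm m01 bs hF hG.
have [holF FM [mf if2] Ff] := hF; have [holG GM [mg ig2] Gg] := hG.
have C0 : 0 <= C.
  by apply: le_trans (normc_ge0 _) (bC (Complex 0 1) _); exact: ltr01.
have Cs0 : 0 <= Cs by apply: le_trans (normc_ge0 _) (sC 0).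
have m0 x : 0 <= m x by case/andP: (m01 x).
have mC x : m x <= Cm by case/andP: (m01 x).
have Cm0 : 0 <= Cm by exact: le_trans (m0 0) (mC 0).
have nmf := mfun_normc _ mf; have nmg := mfun_normc _ mg.
have ibl3 (c a b : R -> R) D : mfun c -> mfun a -> mfun b -> (forall x, 0 <= c x <= D) ->
    ibl (fun x => a x ^+ 2) -> ibl (fun x => b x ^+ 2) -> ibl (fun x => c x * (a x * b x)).
  move=> mc ma mb cD ia ib; have iab := ibl_mul _ _ ma mb ia ib.
  apply: ibl_le (mfunM _ _ mc (mfunM _ _ ma mb)) _ (iblZ D _ (ibl_norm _ iab)) => x.
  have /andP [c0 c1] := cD x.
  by rewrite normrM ger0_norm // ler_wpM2r.
have sqle (c a : R -> R) D : mfun c -> mfun a -> (forall x, 0 <= c x <= D) ->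
    ibl (fun x => a x ^+ 2) -> ibl (fun x => (c x * a x) ^+ 2).
  move=> mc ma cD ia; apply: ibl_le (mfunX _ 2 (mfunM _ _ mc ma)) _ (iblZ (D ^+ 2) _ ia) => x.
  have /andP [c0 c1] := cD x.
  rewrite ger0_norm ?sqr_ge0 // exprMn ler_wpM2r ?sqr_ge0 // ler_sqr ?nnegrE //.
  exact: le_trans c1.
have nms := mfun_normc _ ms.
have s01 x : 0 <= normc (s x) <= Cs by rewrite normc_ge0 sC.
(* The second factor stays at the fixed height [yseq k]; only [beta] and [F] go to the boundary. *)
have step1 k : RI (fun x => complex.Re (s x * f x * G (Complex x (yseq k)))) <=
    RI (fun x => m x * (normc (f x) * normc (G (Complex x (yseq k))))).
  pose Gk x := G (Complex x (yseq k)).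
  have [[mGk iGk] _] := h2_line _ _ _ _ hG (yseq_gt0 k).
  have nmGk := mfun_normc _ mGk.
  have iR : ibl (fun x => complex.Re (s x * f x * Gk x)).
    have msf := cmeasurableM _ _ (cmeasurableM _ _ ms mf) mGk.
    apply: ibl_le (proj1 msf) _ (ibl3 _ _ _ Cs nms nmf nmGk s01 if2 iGk) => x.
    by apply: le_trans (Re_le_normc _) _; rewrite !normcM mulrA.
  have iM : ibl (fun x => m x * (normc (f x) * normc (Gk x))) by exact: ibl3 m01 if2 iGk.
  (* The excess of |beta - s| over [m]. At almost every point it is eventually zero, and it is
     bounded by C + Cs; so [u] tends to 0 a.e. with bounded L^2 norm, which is all that the weak
     limit needs. *)
  pose r n x := Num.max (normc (beta (Complex x (yseq n)) - s x) - m x) 0.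
  pose u n x := C * normc (F (Complex x (yseq n)) - f x) + r n x * normc (f x).
  have mbeta n := cmeasurable_line _ _ hb (yseq_gt0 n).
  have mr n : mfun (r n).
    apply: mfun_max; last exact: mfun_cst.
    by apply: mfunB => //; apply: mfun_normc; exact: cmeasurableB.
  have r0 n x : 0 <= r n x by rewrite le_max lexx orbT.
  have rC n x : r n x <= C + Cs.
    rewrite ge_max addr_ge0 // andbT lerBlDr -[X in X <= _]addr0 lerD //.
    apply: le_trans (normc_triangle _ _) _; rewrite normc_opp lerD //.
    by apply: bC; exact: yseq_gt0.
  have mFf n : cmeasurable (fun x => F (Complex x (yseq n)) - f x).
    by apply: cmeasurableB => //; exact: cmeasurable_line holF (yseq_gt0 n).
  have mu_ n : mfun (u n).
    apply: mfunD; first by apply: mfunM; [exact: mfun_cst|exact: mfun_normc].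
    exact: mfunM.
  have u0 n x : 0 <= u n x by rewrite addr_ge0 // mulr_ge0 // normc_ge0.
  have ulim : {ae mu, forall x, u n x @[n --> \oo] --> (0 : R)}.
    apply: ae_imp2 Ff bs => x Ffx bx.
    rewrite -[X in _ --> X]addr0; apply: cvgD.
      by rewrite -[X in _ --> X](mulr0 C); apply: cvgM => //; exact: cvg_cst.
    apply: cvg_near_cst; move: bx; apply: filterS => n bn.
    by rewrite /r max_r ?mul0r // subr_le0.
  pose B := 2 * C ^+ 2 * (2 * M1 + 2 * RI (fun x => normc (f x) ^+ 2)) +
    2 * (C + Cs) ^+ 2 * RI (fun x => normc (f x) ^+ 2).
  have u2 n x : u n x ^+ 2 <= 2 * C ^+ 2 * normc (F (Complex x (yseq n)) - f x) ^+ 2 +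
      2 * (C + Cs) ^+ 2 * normc (f x) ^+ 2.
    rewrite /u; set a := C * _; set b := _ * normc (f x).
    have ab : (a + b) ^+ 2 <= 2 * a ^+ 2 + 2 * b ^+ 2 by have := sqr_ge0 (a - b); lra.
    apply: le_trans ab _; rewrite /a exprMn mulrA lerD2l -mulrA ler_wpM2l //.
    rewrite /b exprMn ler_wpM2r ?sqr_ge0 // ler_sqr ?nnegrE ?r0 ?rC //.
    by rewrite addr_ge0.
  have diffn n := RI_normc_diff_sq _ _ (proj1 (h2_line _ _ _ _ hF (yseq_gt0 n))) (conj mf if2).
  have iu n : ibl (fun x => 2 * C ^+ 2 * normc (F (Complex x (yseq n)) - f x) ^+ 2 +
      2 * (C + Cs) ^+ 2 * normc (f x) ^+ 2).
    by apply: iblD; apply: iblZ => //; case: (diffn n).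
  have iu2 n : ibl (fun x => u n x ^+ 2).
    by apply: ibl_le (mfunX _ 2 (mu_ n)) _ (iu n) => x; rewrite ger0_norm ?sqr_ge0.
  have uB n : RI (fun x => u n x ^+ 2) <= B.
    apply: le_trans (le_RI _ _ (iu2 n) (iu n) (u2 n)) _.
    have [d1 d2] := diffn n; have [_ d3] := h2_line _ _ _ _ hF (yseq_gt0 n).
    rewrite RID; [|exact: iblZ|exact: iblZ]; rewrite !RIZ // /B lerD2r.
    rewrite ler_wpM2l ?mulr_ge0 ?sqr_ge0 // (le_trans d2) // lerD2r ler_wpM2l //.
  apply/ler_addgt0Pr => e e0.
  have Gk0 x : 0 <= normc (Gk x) by exact: normc_ge0.
  have := square_bounded_weak_cvg u _ B mu_ u0 ulim iu2 uB nmGk Gk0 iGk e e0.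
  move=> [n _ /(_ n (leqnn n)) un].
  pose bF z := beta z * F z.
  have hbF : hol bF by exact: holM.
  have bFM t : 0 < t -> (\int[mu]_x (sqmod (bF (Complex x t)))%:E <= (C ^+ 2 * M1)%:E)%E.
    move=> t0; have [[mF iF] FM1] := h2_line _ _ _ _ hF t0.
    apply: (@le_trans _ _ (\int[mu]_x (C ^+ 2 * normc (F (Complex x t)) ^+ 2)%:E)%E).
      apply: le_integral_EFin.
      - rewrite (_ : (fun x => _) = (fun x => normc (bF (Complex x t)) ^+ 2)).
          by apply: mfunX; apply: mfun_normc; exact: cmeasurable_line.
        by apply/funext => x; rewrite sqmodE.
      - by apply: mfunM; [exact: mfun_cst|apply: mfunX; exact: mfun_normc].
      - by move=> x; rewrite sqmodE sqr_ge0.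
      move=> x; rewrite sqmodE normcM exprMn ler_wpM2r ?sqr_ge0 //.
      by rewrite ler_sqr ?nnegrE ?normc_ge0 // bC.
    rewrite -RI_fin; last exact: iblZ.
    by rewrite lee_fin RIZ // ler_wpM2l ?sqr_ge0.
  (* The integral of beta F G vanishes with different heights in the two factors, and may be
     subtracted from the left-hand side. *)
  have [ibFG bFG0] := H2_orth bF G (C ^+ 2 * M1) M2 _ _ hbF holG bFM GM (yseq_gt0 n) (yseq_gt0 k).
  have iRbFG : ibl (fun x => complex.Re (bF (Complex x (yseq n)) * Gk x)).
    apply: ibl_le ibFG.
      exact: (proj1 (cmeasurableM _ _ (cmeasurable_line _ _ hbF (yseq_gt0 n)) mGk)).
    by move=> x; exact: Re_le_normc.
  rewrite -[X in X <= _]subr0 -[X in _ - X]bFG0 -RIB //.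
  have iuG : ibl (fun x => u n x * normc (Gk x)) by exact: ibl_mul.
  apply: le_trans (_ : RI (fun x => m x * (normc (f x) * normc (Gk x)) + u n x * normc (Gk x)) <= _).
    apply: le_RI; [exact: iblB|exact: iblD|].
    move=> x; rewrite -ReN -ReD; apply: le_trans (ler_norm _) _.
    apply: le_trans (Re_le_normc _) _; rewrite -/(Gk x) -mulrBl normcM mulrA -mulrDl.
    rewrite ler_wpM2r // /bF.
    have -> : s x * f x - beta (Complex x (yseq n)) * F (Complex x (yseq n)) =
       - (beta (Complex x (yseq n)) * (F (Complex x (yseq n)) - f x)
         + (beta (Complex x (yseq n)) - s x) * f x) by ring.
    rewrite normc_opp; apply: le_trans (normc_triangle _ _) _; rewrite !normcM.
    rewrite /u addrCA lerD //.
      by rewrite ler_wpM2r ?normc_ge0 // bC //; exact: yseq_gt0.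
    rewrite -mulrDl ler_wpM2r ?normc_ge0 //.
    by rewrite -lerBlDl le_max lexx.
  by rewrite RID // lerD2l.
apply/ler_addgt0Pr => e e0.
(* Now the second factor goes to the boundary. Replacing g by its value at height [yseq n] costs |s|
   |f| u on the left and m |f| u on the right, so [w] is the fixed L^2 function to test against. *)
pose w x := (m x + normc (s x)) * normc (f x).
have mw : mfun w by apply: mfunM => //; exact: mfunD.
have w0 x : 0 <= w x by rewrite mulr_ge0 ?addr_ge0 ?normc_ge0.
have iw : ibl (fun x => w x ^+ 2).
  apply: (sqle (fun x => m x + normc (s x)) _ (Cm + Cs)) => //; first exact: mfunD.
  by move=> x; rewrite addr_ge0 ?normc_ge0 //= lerD.
pose u n x := normc (G (Complex x (yseq n)) - g x).
have mGg n : cmeasurable (fun x => G (Complex x (yseq n)) - g x).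
  by apply: cmeasurableB => //; exact: cmeasurable_line holG (yseq_gt0 n).
have diffn n := RI_normc_diff_sq _ _ (proj1 (h2_line _ _ _ _ hG (yseq_gt0 n))) (conj mg ig2).
pose B := 2 * M2 + 2 * RI (fun x => normc (g x) ^+ 2).
have uB n : RI (fun x => u n x ^+ 2) <= B.
  have [d1 d2] := diffn n; have [_ d3] := h2_line _ _ _ _ hG (yseq_gt0 n).
  by apply: le_trans d2 _; rewrite lerD2r ler_wpM2l.
have := square_bounded_weak_cvg u w B (fun n => mfun_normc _ (mGg n))
  (fun n x => normc_ge0 _) Gg (fun n => proj1 (diffn n)) uB mw w0 iw e e0.
move=> [n _ /(_ n (leqnn n)) un].
have [[mGn iGn] _] := h2_line _ _ _ _ hG (yseq_gt0 n).
have nmGn := mfun_normc _ mGn.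
have iuw : ibl (fun x => u n x * w x).
  by apply: ibl_mul => //; [exact: mfun_normc|case: (diffn n)].
have iRe (h : R -> R[i]) : sqi h -> ibl (fun x => complex.Re (s x * f x * h x)).
  move=> [mh ih]; have msf := cmeasurableM _ _ (cmeasurableM _ _ ms mf) mh.
  apply: ibl_le (proj1 msf) _ (ibl3 _ _ _ Cs nms nmf (mfun_normc _ mh) s01 if2 ih) => x.
  by apply: le_trans (Re_le_normc _) _; rewrite !normcM mulrA.
have i1 := iRe g (conj mg ig2); have i2 := iRe _ (conj mGn iGn).
have i3 : ibl (fun x => m x * (normc (f x) * normc (g x))) by exact: ibl3 m01 if2 ig2.
have i4 : ibl (fun x => m x * (normc (f x) * normc (G (Complex x (yseq n))))).
  exact: ibl3 m01 if2 iGn.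
rewrite -[X in X <= _](subrK (RI (fun x => complex.Re (s x * f x * G (Complex x (yseq n)))))).
apply: le_trans (lerD (lexx _) (step1 n)) _.
rewrite -RIB // -RID //; last exact: iblB.
apply: le_trans (_ : RI (fun x => m x * (normc (f x) * normc (g x)) + u n x * w x) <= _).
  apply: le_RI; [by apply: iblD => //; exact: iblB|exact: iblD|].
  move=> x; rewrite -ReN -ReD -mulrBr.
  have h1 : complex.Re (s x * f x * (g x - G (Complex x (yseq n)))) <=
      normc (s x) * normc (f x) * u n x.
    apply: le_trans (ler_norm _) _; apply: le_trans (Re_le_normc _) _.
    by rewrite !normcM [normc (g x - _)]normc_distC.
  have h2 : normc (G (Complex x (yseq n))) <= normc (g x) + u n x.
    by rewrite -lerBlDl; exact: normc_triangleB.
  apply: le_trans (lerD h1 (ler_wpM2l (m0 x) (ler_wpM2l (normc_ge0 _) h2))) _.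
  by rewrite /w le_eqVlt; apply/orP; left; apply/eqP; ring.
by rewrite RID // lerD2l.
Qed.

End BoundaryPairing.

(** * Bounded analytic functions that peak off the real line *)

Lemma is_derive_atan_scaled {R : realType} (x y s : R) : 0 < y ->
  is_derive s 1 (fun s => atan ((s - x) / y)) (y / ((s - x) ^+ 2 + y ^+ 2)).
Proof.
move=> y0.
have d1 : is_derive s 1 (fun s : R => (s - x) / y) y^-1.
  apply: is_derive_eps => e e0; exists 1 => // h _.
  rewrite (_ : _ - _ - _ = 0) ?normr0 ?mulr_ge0 ?(ltW e0) //.
  by field; rewrite gt_eqF.
have := @is_derive1_comp R atan (fun s : R => (s - x) / y) s _ _ (@is_derive1_atan R ((s - x) / y)) d1.
rewrite (_ : _ * y^-1 = y / ((s - x) ^+ 2 + y ^+ 2)) //.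
have d0 : 0 < (s - x) ^+ 2 + y ^+ 2 by rewrite ltr_wpDl ?sqr_ge0 // exprn_gt0.
by field; rewrite !gt_eqF ?d0 //= ?addr_gt0 //.
Qed.

(** * The Cauchy integral over a bounded set, and its imaginary part *)

Section CauchyTransform.
Context {R : realType}.
Local Notation mu := (@lebesgue_measure R).
Variables (E : set R) (N0 : R).
Hypothesis mE : measurable E.
Hypothesis EN : forall s, E s -> `|s| <= N0.

Let ind : R -> R := \1_E.

Let ind01 x : 0 <= ind x <= 1.
Proof. by rewrite /ind indicE; case: (_ \in _); rewrite ?lexx ?ler01. Qed.

Let mind : mfun ind.
Proof. exact: measurable_indic. Qed.

Let indP x (P : R -> Prop) : (E x -> P 1) -> P 0 -> P (ind x).
Proof.
move=> P1 P0; rewrite /ind indicE; case: (boolP (x \in E)) => // xE.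
by apply: P1; exact: set_mem.
Qed.

Lemma ibl_indic_itv (a b : R) : ibl (\1_(`[a, b]%classic) : R -> R).
Proof.
exact: (integrable_indic_itv a b true false).
Qed.

Let iind : ibl ind.
Proof.
apply: ibl_le mind _ (ibl_indic_itv (- N0) N0) => x.
have /andP [i0 _] := ind01 x; rewrite ger0_norm //.
apply: (indP x (fun t => t <= \1_(`[- N0, N0]%classic) x)) => [Ex|]; last by rewrite indicE.
rewrite indicE mem_set //= in_itv /= -ler_norml; exact: EN.
Qed.

Definition vol := RI ind.

Definition bnd (u : R -> R[i]) := cmeasurable u /\ exists D, forall x, normc (u x) <= D.

Definition cint (u : R -> R[i]) : R[i] :=
  Complex (RI (fun x => ind x * complex.Re (u x))) (RI (fun x => ind x * complex.Im (u x))).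

Let ibl_bnd (v : R -> R) D : mfun v -> (forall x, `|v x| <= D) -> ibl (fun x => ind x * v x).
Proof.
move=> mv vD; apply: ibl_le (mfunM _ _ mind mv) _ (iblZ D _ iind) => x.
have /andP [i0 _] := ind01 x.
by rewrite normrM ger0_norm // mulrC ler_wpM2r.
Qed.

Let ibl_Re u : bnd u -> ibl (fun x => ind x * complex.Re (u x)).
Proof.
move=> [[m1 m2] [D uD]]; apply: (ibl_bnd _ D m1) => x.
exact: le_trans (Re_le_normc _) (uD x).
Qed.

Let ibl_Im u : bnd u -> ibl (fun x => ind x * complex.Im (u x)).
Proof.
move=> [[m1 m2] [D uD]]; apply: (ibl_bnd _ D m2) => x.
exact: le_trans (Im_le_normc _) (uD x).
Qed.

Lemma cintD u v : bnd u -> bnd v -> cint (fun x => u x + v x) = cint u + cint v.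
Proof.
move=> bu bv; apply/eqP; rewrite eq_complex /=; apply/andP; split; apply/eqP.
- rewrite -RID; [|exact: ibl_Re|exact: ibl_Re]; congr RI; apply/funext => x.
  by rewrite ReD mulrDr.
- rewrite -RID; [|exact: ibl_Im|exact: ibl_Im]; congr RI; apply/funext => x.
  by rewrite ImD mulrDr.
Qed.

Lemma cintZ c u : bnd u -> cint (fun x => c * u x) = c * cint u.
Proof.
move=> bu; have i1 := ibl_Re u bu; have i2 := ibl_Im u bu.
apply/eqP; rewrite eq_complex !ReImE /=; apply/andP; split; apply/eqP.
- rewrite -!RIZ // -RIB; [|exact: iblZ|exact: iblZ]; congr RI; apply/funext => x.
  by rewrite ReM; ring.
- rewrite -!RIZ // -RID; [|exact: iblZ|exact: iblZ]; congr RI; apply/funext => x.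
  by rewrite ImM; ring.
Qed.

Lemma normc_cint u D : cmeasurable u -> (forall x, normc (u x) <= D) ->
  normc (cint u) <= 2 * D * vol.
Proof.
move=> m uD; have bu : bnd u by split => //; exists D.
apply: le_trans (normc_le_ReIm _) _ => /=.
have le1 (v : R -> R) : ibl (fun x => ind x * v x) -> (forall x, `|v x| <= D) ->
    `|RI (fun x => ind x * v x)| <= D * vol.
  move=> iv vD; rewrite /vol -RIZ //; apply: le_normRI => //; first exact: iblZ.
  move=> x; have /andP [i0 _] := ind01 x.
  by rewrite normrM ger0_norm // mulrC ler_wpM2r.
rewrite -[2 * D]/(2 * D) -mulrA [2 * _]mulrDl mul1r lerD //.
- by apply: le1; [exact: ibl_Re|move=> x; exact: le_trans (Re_le_normc _) (uD x)].
- by apply: le1; [exact: ibl_Im|move=> x; exact: le_trans (Im_le_normc _) (uD x)].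
Qed.

Lemma Im_sub_ge (z : R[i]) (s : R) : 0 < complex.Im z -> complex.Im z <= normc (s%:C - z).
Proof.
move=> z0; apply: le_trans (Im_le_normc _).
by rewrite ImD ImN /= add0r normrN ler_norm.
Qed.

Lemma sub_neq0 (z : R[i]) (s : R) : 0 < complex.Im z -> s%:C - z != 0.
Proof.
by move=> z0; rewrite -normc_gt0; apply: lt_le_trans (Im_sub_ge z s z0).
Qed.

Lemma cmeasurable_inv (f : R -> R[i]) : cmeasurable f -> (forall x, f x != 0) ->
  continuous (fun x => complex.Re (f x)) -> continuous (fun x => complex.Im (f x)) ->
  cmeasurable (fun x => (f x)^-1).
Proof.
move=> _ f0 cr ci.
have d0 x : complex.Re (f x) ^+ 2 + complex.Im (f x) ^+ 2 != 0.
  have := f0 x; case: (f x) => a b /= ab0; apply: contra_neq ab0 => /eqP.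
  rewrite paddr_eq0 ?sqr_ge0 // !sqrf_eq0 => /andP [/eqP a0 /eqP b0].
  by rewrite a0 b0.
have cd : continuous (fun x => (complex.Re (f x) ^+ 2 + complex.Im (f x) ^+ 2)^-1).
  move=> x; apply: cvgV => //; apply: cvgD; rewrite expr2; apply: cvgM => //;
    by [exact: cr|exact: ci].
split; apply: continuous_measurable_fun => x.
- have -> : (fun x => complex.Re (f x)^-1) = (fun x => complex.Re (f x) *
      (complex.Re (f x) ^+ 2 + complex.Im (f x) ^+ 2)^-1).
    by apply/funext => t; case: (f t).
  by apply: cvgM; [exact: cr|exact: cd].
- have -> : (fun x => complex.Im (f x)^-1) = (fun x => - (complex.Im (f x) *
      (complex.Re (f x) ^+ 2 + complex.Im (f x) ^+ 2)^-1)).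
    by apply/funext => t; case: (f t).
  by apply: cvgN; apply: cvgM; [exact: ci|exact: cd].
Qed.

Lemma cmeasurable_cauchy (z : R[i]) : 0 < complex.Im z ->
  cmeasurable (fun s : R => (s%:C - z)^-1).
Proof.
move=> z0.
have cr : continuous (fun s : R => complex.Re (s%:C - z)).
  rewrite (_ : (fun s : R => _) = (fun s : R => s - complex.Re z)).
    by move=> s; apply: cvgB; [exact: cvg_id|exact: cvg_cst].
  by apply/funext => s; rewrite ReD ReN.
have ci : continuous (fun s : R => complex.Im (s%:C - z)).
  rewrite (_ : (fun s : R => _) = (fun s : R => - complex.Im z)).
    by move=> s; exact: cvg_cst.
  by apply/funext => s; rewrite ImD ImN /= add0r.
apply: cmeasurable_inv => //; last by move=> s; exact: sub_neq0.
by split; exact: continuous_measurable_fun.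
Qed.

Lemma normc_cauchy (z : R[i]) (s : R) : 0 < complex.Im z ->
  normc (s%:C - z)^-1 <= (complex.Im z)^-1.
Proof.
move=> z0; rewrite normcV lef_pV2 ?posrE //; first exact: Im_sub_ge.
by apply: lt_le_trans (Im_sub_ge z s z0).
Qed.

Lemma bndM u v : bnd u -> bnd v -> bnd (fun x => u x * v x).
Proof.
move=> [mu_ [D uD]] [mv [D' vD]]; split; first exact: cmeasurableM.
exists (D * D') => x; rewrite normcM ler_pM ?normc_ge0 //.
Qed.

Lemma bndZ c u : bnd u -> bnd (fun x => c * u x).
Proof.
apply: bndM; split; last by exists (normc c).
by split; exact: measurable_cst.
Qed.

Lemma bnd_cauchy z : 0 < complex.Im z -> bnd (fun s : R => (s%:C - z)^-1).
Proof.
move=> z0; split; first exact: cmeasurable_cauchy.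
by exists (complex.Im z)^-1 => s; exact: normc_cauchy.
Qed.

(** The density [c] makes the class stable: a divided difference of such an integral is one again,
    with the density multiplied by a Cauchy kernel. *)
Definition cauchyT (c : R -> R[i]) (z : R[i]) : R[i] := cint (fun s => c s * (s%:C - z)^-1).

Lemma cauchyT_bound c D z : cmeasurable c -> (forall x, normc (c x) <= D) -> 0 < complex.Im z ->
  normc (cauchyT c z) <= 2 * (D / complex.Im z) * vol.
Proof.
move=> mc cD z0; apply: normc_cint; first exact: cmeasurableM mc (cmeasurable_cauchy z z0).
by move=> x; rewrite normcM ler_pM ?normc_ge0 // normc_cauchy.
Qed.

Lemma cauchyT_diff c z w : bnd c -> 0 < complex.Im z -> 0 < complex.Im w ->
  cauchyT c z - cauchyT c w = (z - w) * cauchyT (fun s => c s * (s%:C - w)^-1) z.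
Proof.
move=> bc z0 w0.
have b1 := bndM _ _ bc (bnd_cauchy z z0); have b2 := bndM _ _ bc (bnd_cauchy w w0).
rewrite /cauchyT -cintZ; last by apply: bndM (bnd_cauchy z z0); exact: bndM (bnd_cauchy w w0).
rewrite -[- cint _]mulN1r -cintZ // -cintD //; last exact: bndZ.
congr cint; apply/funext => s.
have := sub_neq0 z s z0; have := sub_neq0 w s w0 => h1 h2; field.
by rewrite h1 h2.
Qed.

(** Two uses of [cauchyT_diff] write the remainder as h^2 times another Cauchy integral, which is
    bounded near [z]; no differentiation under the integral sign is involved. *)
Lemma hol_cauchyT c : bnd c -> hol (cauchyT c).
Proof.
move=> bc z z0; apply/cdableP.
pose c1 s := c s * (s%:C - z)^-1; pose c2 s := c1 s * (s%:C - z)^-1.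
have bc1 : bnd c1 by exact: bndM (bnd_cauchy z z0).
have bc2 : bnd c2 by exact: bndM (bnd_cauchy z z0).
exists (cauchyT c1 z) => e e0.
have [mc2 [D cD]] := bc2.
pose y := complex.Im z; pose K := 2 * (D / (y / 2)) * vol.
have D0 : 0 <= D by apply: le_trans (normc_ge0 _) (cD 0).
have vol0 : 0 <= vol by apply: RI_ge0 => x; case/andP: (ind01 x).
have y20 : 0 < y / 2 by rewrite divr_gt0.
have K0 : 0 <= K by rewrite !mulr_ge0 // invr_ge0 ltW.
exists (Num.min (y / 2) (e / (K + 1))).
  by rewrite lt_min y20 divr_gt0 // ltr_wpDl.
move=> h; rewrite lt_min => /andP [hy he].
have zh : y / 2 < complex.Im (z + h).
  have := le_lt_trans (Im_le_normc h) hy; rewrite ImD ltr_norml => /andP [+ _].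
  rewrite -/y; lra.
have zh0 : 0 < complex.Im (z + h) by exact: lt_trans zh.
have -> : cauchyT c (z + h) - cauchyT c z - cauchyT c1 z * h = h * (h * cauchyT c2 (z + h)).
  have H1 := cauchyT_diff c (z + h) z bc zh0 z0; rewrite -/c1 in H1.
  have H2 := cauchyT_diff c1 (z + h) z bc1 zh0 z0; rewrite -/c2 in H2.
  have hE : z + h - z = h by rewrite addrAC subrr add0r.
  by rewrite hE in H1 H2; rewrite H1 -H2; ring.
rewrite normcM mulrC ler_wpM2r ?normc_ge0 // normcM.
have TK : normc (cauchyT c2 (z + h)) <= K.
  apply: le_trans (cauchyT_bound _ _ _ mc2 cD zh0) _.
  rewrite ler_wpM2r // ler_wpM2l // ler_wpM2l // lef_pV2 ?posrE //; exact: ltW.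
apply: (@le_trans _ _ (e / (K + 1) * (K + 1))).
  by apply: ler_pM; rewrite ?normc_ge0 // ?(ltW he) // (le_trans TK) // lerDl.
by rewrite divfK // gt_eqF // ltr_wpDl.
Qed.

Definition harm (z : R[i]) := complex.Im (cauchyT (fun=> 1) z).

Lemma Im_cauchy (x y s : R) : 0 < y ->
  complex.Im (1 * (s%:C - Complex x y)^-1) = y / ((s - x) ^+ 2 + y ^+ 2).
Proof. by move=> y0; rewrite mul1r /= sub0r sqrrN mulNr opprK. Qed.

Lemma harmE (x y : R) : 0 < y -> harm (Complex x y) =
  RI (fun s => ind s * (y / ((s - x) ^+ 2 + y ^+ 2))).
Proof.
by move=> y0; rewrite /harm /cauchyT /cint /=; congr RI; apply/funext => s;
  rewrite -Im_cauchy.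
Qed.

Lemma bnd1 : bnd (fun=> 1 : R[i]).
Proof.
split; last by exists 1 => x; rewrite normc1.
by split; exact: measurable_cst.
Qed.

Lemma ibl_poisson (x y : R) : 0 < y -> ibl (fun s => ind s * (y / ((s - x) ^+ 2 + y ^+ 2))).
Proof.
move=> y0; have b := bndM _ _ bnd1 (bnd_cauchy (Complex x y) y0).
have := ibl_Im _ b; rewrite (_ : (fun s => _) = (fun s => ind s * (y / ((s - x) ^+ 2 + y ^+ 2)))) //.
by apply/funext => s; rewrite Im_cauchy.
Qed.

Lemma poisson_den (x y s : R) : 0 < y -> 0 < (s - x) ^+ 2 + y ^+ 2.
Proof. by move=> y0; rewrite ltr_wpDl ?sqr_ge0 // exprn_gt0. Qed.

(** The Poisson kernel is the derivative of atan((s - x)/y), so its integral over any interval is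
    below pi. *)
Lemma harm_le (z : R[i]) : 0 < complex.Im z -> harm z <= pi.
Proof.
case: z => x y /= y0; rewrite harmE //.
pose k s := y / ((s - x) ^+ 2 + y ^+ 2).
have dk (s : R) : is_derive s 1 (fun s => atan ((s - x) / y)) (k s).
  exact: is_derive_atan_scaled.
have ck : continuous k.
  move=> s; rewrite /k; apply: cvgM; first exact: cvg_cst.
  apply: cvgV; first by rewrite gt_eqF // poisson_den.
  apply: cvgD; last exact: cvg_cst.
  by rewrite expr2; apply: cvgM; (apply: cvgB; [exact: cvg_id|exact: cvg_cst]).
have k0 s : 0 <= k s by rewrite divr_ge0 ?(ltW y0) // ltW // poisson_den.
(* The sign of [N0] is not known when [E] may be empty, hence the absolute values. *)
have NN : - `|N0| <= `|N0| by apply: le_trans (normr_ge0 _); rewrite oppr_le0.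
have ikN : ibl (k \_ `[- `|N0|, `|N0|]).
  have := continuous_integrable_itv k (- `|N0|) `|N0| ck.
  by rewrite integrable_mkcond // restrict_EFin.
apply: le_trans (_ : RI (k \_ `[- `|N0|, `|N0|]) <= _).
  apply: le_RI => //; first exact: ibl_poisson.
  move=> s; rewrite patchE -/(k s); case: ifPn => [_|].
    by have /andP [i0 i1] := ind01 s; rewrite ler_piMl.
  rewrite notin_setE /= in_itv /= => sN; apply: (indP s (fun t => t * k s <= 0)); last by rewrite mul0r.
  by move=> Es; case: sN; rewrite -ler_norml (le_trans (EN s Es)) // ler_norm.
rewrite /RI -Rintegral_mkcond (RI_FTC _ _ _ _ NN ck dk).
have := atan_ltpi2 ((`|N0| - x) / y); have := atan_gtNpi2 ((- `|N0| - x) / y); lra.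
Qed.

Hypothesis vol0 : 0 < vol.

Lemma harm_gt0 (z : R[i]) : 0 < complex.Im z -> 0 < harm z.
Proof.
case: z => x y /= y0; rewrite harmE //.
pose D := (`|N0| + `|x|) ^+ 2 + y ^+ 2.
have D0 : 0 < D by rewrite ltr_wpDl ?sqr_ge0 // exprn_gt0.
apply: lt_le_trans (_ : y / D * vol <= _); first by rewrite mulr_gt0 // divr_gt0.
rewrite /vol -RIZ //; apply: le_RI; [exact: iblZ|exact: ibl_poisson|] => s.
apply: (indP s (fun t => y / D * t <= t * _)) => [Es|]; last by rewrite mulr0 mul0r.
rewrite mulr1 mul1r ler_wpM2l ?(ltW y0) // lef_pV2 ?posrE ?poisson_den // /D lerD2r.
rewrite -[X in X <= _]real_normK ?num_real // ler_sqr ?nnegrE ?addr_ge0 //.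
by apply: le_trans (ler_normB _ _) _; rewrite lerD2r (le_trans (EN s Es)) // ler_norm.
Qed.

(** At distance d from [E] the Poisson kernel is at most y / d^2, so [harm] decays linearly in the
    height. *)
Lemma harm_off (x y d : R) : 0 < y -> 0 < d -> (forall s, E s -> d <= `|s - x|) ->
  harm (Complex x y) <= y / d ^+ 2 * vol.
Proof.
move=> y0 d0 Ed; rewrite harmE // /vol -RIZ //.
apply: le_RI; [exact: ibl_poisson|exact: iblZ|] => s.
apply: (indP s (fun t => t * _ <= y / d ^+ 2 * t)) => [Es|]; last by rewrite mulr0 mul0r.
rewrite mulr1 mul1r ler_wpM2l ?(ltW y0) // lef_pV2 ?posrE ?poisson_den ?exprn_gt0 //.
apply: (@le_trans _ _ ((s - x) ^+ 2)); last by rewrite lerDl sqr_ge0.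
by rewrite -[X in _ <= X]real_normK ?num_real // ler_sqr ?nnegrE ?(ltW d0) // Ed.
Qed.

End CauchyTransform.

(** * Bounded analytic substitutes for a pole *)

Section PoleApproximation.
Context {R : realType}.
Variables (E : set R) (N0 : R).
Hypotheses (mE : measurable E) (EN : forall s, E s -> `|s| <= N0) (vol0 : 0 < vol E).

Variable p : R.
Hypotheses (p0 : 0 < p) (harm_p : forall z, 0 < complex.Im z -> harm E z <= p).
Let T (z : R[i]) := cauchyT E (fun=> 1) z.
Let den (z : R[i]) := Complex 0 (2 * p) - T z.
Let num (z : R[i]) := Complex 0 (2 * p) + T z.

(** A Cayley transform: |num|^2 - |den|^2 = 8 p Im T, so the modulus exceeds 1 exactly where Im T >
    0. As Im T <= p, the factor 2 in 2p keeps Im den >= p and hence the quotient bounded. *)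
Definition bump (z : R[i]) := num z * (den z)^-1.

Let holT : hol T.
Proof. exact: hol_cauchyT E N0 mE EN _ bnd1. Qed.

Let den_ge z : 0 < complex.Im z -> p <= normc (den z).
Proof.
move=> z0; apply: le_trans (Im_le_normc _); apply: le_trans (ler_norm _).
have := harm_p z z0; rewrite /harm -/(T z) /den ImD ImN /=; lra.
Qed.

Let den0 z : 0 < complex.Im z -> den z != 0.
Proof. by move=> z0; rewrite -normc_gt0 (lt_le_trans p0) // den_ge. Qed.

(** With the variable in the denominator only, the bound 1 + 4 is immediate and differences of
    values of [bump] reduce to differences of 1/den. *)
Let bump_alt z : 0 < complex.Im z -> bump z = -1 + Complex 0 (4 * p) * (den z)^-1.
Proof.
move=> z0; have d0 := den0 z z0.
apply: (mulIf d0); rewrite [RHS]mulrDl /bump !divfK //.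
rewrite /num /den; case: (T z) => a b; apply/eqP; rewrite eq_complex !ReImE /=.
by apply/andP; split; apply/eqP; ring.
Qed.

Lemma hol_bump : hol bump.
Proof.
have hd : hol den := holB _ _ (hol_cst _) holT.
exact: (holM _ _ (holD _ _ (hol_cst _) holT) (holV den den0 hd)).
Qed.

Lemma bump_le5 z : 0 < complex.Im z -> normc (bump z) <= 5.
Proof.
move=> z0; rewrite bump_alt //; apply: le_trans (normc_triangle _ _) _.
rewrite normc_opp normc1 normcM normc_imag normcV ger0_norm ?mulr_ge0 ?(ltW p0) //.
have : 4 * p / normc (den z) <= 4.
  rewrite ler_pdivrMr ?(lt_le_trans p0) ?den_ge // ler_wpM2l // den_ge //.
lra.
Qed.

Let sq_num_den z : 0 < complex.Im z ->
  normc (bump z) ^+ 2 = 1 + 8 * p * harm E z / normc (den z) ^+ 2.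
Proof.
move=> z0; have d0 : 0 < normc (den z) := lt_le_trans p0 (den_ge z z0).
have d20 : normc (den z) ^+ 2 != 0 by rewrite expf_neq0 // gt_eqF.
apply: (mulIf d20); rewrite mulrDl divfK // mul1r.
rewrite /bump normcM normcV exprMn exprVn divfK // -!sqmodE /sqmod /num /den /harm -/(T z).
by rewrite !ReImE /=; ring.
Qed.

Lemma bump_gt1 z : 0 < complex.Im z -> 1 < normc (bump z).
Proof.
move=> z0; rewrite -(@ltr_pXn2r _ 2) ?nnegrE ?normc_ge0 // expr1n sq_num_den // ltrDl.
have hz : 0 < harm E z by exact: harm_gt0 E N0 mE EN vol0 z z0.
by rewrite divr_gt0 ?mulr_gt0 ?exprn_gt0 ?normc_gt0 ?den0.
Qed.

Lemma bump_le_harm z : 0 < complex.Im z -> normc (bump z) ^+ 2 <= 1 + 8 * harm E z / p.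
Proof.
move=> z0; rewrite sq_num_den // lerD2l.
have h0 := ltW (harm_gt0 E N0 mE EN vol0 z z0).
have -> : 8 * harm E z / p = 8 * p * harm E z / p ^+ 2 by field; exact: lt0r_neq0.
rewrite ler_wpM2l ?mulr_ge0 ?(ltW p0) // lef_pV2 ?posrE ?exprn_gt0 //.
- by rewrite ler_sqr ?nnegrE ?normc_ge0 ?(ltW p0) // den_ge.
- by rewrite (lt_le_trans p0) // den_ge.
Qed.

Lemma bump_off (x : R) (t : R) : 1 < t -> (exists2 d : R, 0 < d & forall s, E s -> d <= `|s - x|) ->
  \forall n \near \oo, normc (bump (Complex x (yseq n))) ^+ 2 <= t.
Proof.
move=> t1 [d d0 Ed].
pose k := 8 * (vol E / d ^+ 2) / p.
have k0 : 0 < k by rewrite !mulr_gt0 ?invr_gt0 ?exprn_gt0.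
have tk : 0 < (t - 1) / k by rewrite divr_gt0 ?subr_gt0.
have := yseq_small _ tk; apply: filterS => n yn.
have y0 := @yseq_gt0 R n.
apply: le_trans (bump_le_harm (Complex x (yseq n)) y0) _.
have h := harm_off E N0 mE EN x (yseq n) d y0 d0 Ed.
apply: (@le_trans _ _ (1 + yseq n * k)).
  rewrite lerD2l /k.
  have -> : yseq n * (8 * (vol E / d ^+ 2) / p) = 8 * (yseq n / d ^+ 2 * vol E) / p.
    by field; rewrite !gt_eqF.
  by rewrite ler_wpM2r ?invr_ge0 ?(ltW p0) // ler_wpM2l.
by rewrite -lerBrDl -ler_pdivlMr // ltW.
Qed.

(** The quotient (1 - e^m)/(z - a) cannot serve as the definition, since the inverse of 0 is 0 and
    the value at [a] would be wrong. A formula without the division comes from e - 1 = (z - a) q,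
    with [q] explicit, and from the geometric sum. *)
Lemma pole_approx (a : R[i]) (eta : R) : 0 < complex.Im a -> 0 < eta ->
  exists r : R[i] -> R[i], exists C : R,
  [/\ hol r, (forall z, 0 < complex.Im z -> normc (r z) <= C) &
   forall x : R, (exists2 d : R, 0 < d & forall s, E s -> d <= `|s - x|) ->
     \forall n \near \oo, normc (r (Complex x (yseq n)) - (x%:C - a)^-1) <= eta].
Proof.
move=> a0 eta0.
pose y := complex.Im a; have y0 : 0 < y by [].
pose B := normc (bump a); have B1 : 1 < B := bump_gt1 a a0.
have B0 : 0 < B by exact: lt_trans B1.
have ba0 : bump a != 0 by rewrite -normc_gt0.
pose e z := bump z * (bump a)^-1.
have e_le z : 0 < complex.Im z -> normc (e z) <= 5.
  move=> z0; rewrite normcM normcV ler_pdivrMr ?normc_gt0 //.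
  apply: le_trans (bump_le5 z z0) _; rewrite -/B; lra.
have hole : hol e := holM _ _ hol_bump (hol_cst _).
pose Dd z := cauchyT E (fun s => 1 * (s%:C - a)^-1) z.
have bD : bnd (fun s : R => 1 * (s%:C - a)^-1) := bndM _ _ bnd1 (bnd_cauchy a a0).
have holDd : hol Dd := hol_cauchyT E N0 mE EN _ bD.
(* The divided difference of [e] at [a]: by [bump_alt] it comes from that of T, which [cauchyT_diff]
   expresses as the Cauchy integral [Dd]. *)
pose q z := Complex 0 (4 * p) * (den a * bump a)^-1 * (Dd z * (den z)^-1).
have hd : hol den := holB _ _ (hol_cst _) holT.
have holq : hol q := holM _ _ (hol_cst _) (holM _ _ holDd (holV den den0 hd)).
have eq1 z : 0 < complex.Im z -> e z - 1 = (z - a) * q z.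
  move=> z0; have TT := cauchyT_diff E N0 mE EN _ z a bnd1 z0 a0; rewrite -/(T z) -/(T a) -/(Dd z) in TT.
  have d0 := den0 z z0; have da0 := den0 a a0.
  have -> : (z - a) * q z = Complex 0 (4 * p) * (den a * bump a)^-1 * ((den a - den z) * (den z)^-1).
    by rewrite /q mulrCA [(z - a) * (Dd z * _)]mulrA -TT /den; ring.
  have bd : bump z - bump a = Complex 0 (4 * p) * ((den z)^-1 - (den a)^-1).
    by rewrite !bump_alt //; ring.
  rewrite /e -[1](divff ba0) -mulrBl bd; field.
  by rewrite da0 ba0 d0.
(* Off [E] the squared modulus of [bump] is eventually at most (1 + B^2)/2, the midpoint of 1 and
   B^2; dividing by B^2 leaves this bound below 1 for |e|^2. *)
pose rho2 := (1 + B ^+ 2) / (2 * B ^+ 2).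
have B21 : 1 < B ^+ 2 by rewrite exprn_egt1.
have rho20 : 0 <= rho2 by apply: divr_ge0; lra.
have B20 : 0 < 2 * B ^+ 2 by lra.
have rho21 : rho2 < 1 by rewrite ltr_pdivrMr // mul1r; lra.
pose rho := Num.sqrt rho2.
have rho0 : 0 <= rho by exact: sqrtr_ge0.
have rho1 : rho < 1 by rewrite -sqrtr1 ltr_sqrt.
(* With |z - a| >= y/2 the term e^m / (z - a) is then at most eta / 2. *)
have [m rhom] : exists m, rho ^+ m <= eta * (y / 4).
  have := @cvg_expr R rho; rewrite ger0_norm // => /(_ rho1) /cvgrPdist_le.
  have ey : 0 < eta * (y / 4) by rewrite mulr_gt0 // divr_gt0.
  move=> /(_ _ ey) [m _ /(_ m (leqnn m))]; rewrite sub0r normrN ger0_norm ?exprn_ge0 //.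
  by exists m.
pose S z := \sum_(i < m) e z ^+ i.
have holS : hol S.
  rewrite /S; elim: (m) => [|k IH] z z0.
    by apply: (eq_cdable (fun=> 0)); [move=> w; rewrite big_ord0|exact: cdable_cst].
  apply: (eq_cdable (fun z => \sum_(i < k) e z ^+ i + e z ^+ k)).
    by move=> w; rewrite big_ord_recr.
  by apply: cdableD; [exact: IH|apply: cdableX; exact: hole].
pose S5 : R := \sum_(i < m) 5 ^+ i.
have S_le z : 0 < complex.Im z -> normc (S z) <= S5.
  move=> z0; rewrite /S /S5; elim: (m) => [|k IH]; first by rewrite !big_ord0 normc0.
  rewrite !big_ord_recr /=; apply: le_trans (normc_triangle _ _) _; apply: lerD => //.
  by rewrite normcX lerXn2r ?nnegrE ?normc_ge0 // e_le.
(* Equal to (1 - e^m)/(z - a) away from [a], since e^m - 1 = (e - 1) S. *)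
pose r z := - (S z * q z).
have holr : hol r.
  move=> z z0; apply: (eq_cdable (fun z => -1 * (S z * q z))).
    by move=> w; rewrite mulN1r.
  by apply: cdableM; [exact: cdable_cst|apply: cdableM; [exact: holS|exact: holq]].
have rE z : 0 < complex.Im z -> r z * (z - a) = 1 - e z ^+ m.
  move=> z0; rewrite -[1 - _]opprB subrX1 eq1 // /r; rewrite -/(S z); ring.
have rE' z : 0 < complex.Im z -> z != a -> r z = (1 - e z ^+ m) * (z - a)^-1.
  by move=> z0 za; rewrite -rE // mulfK // subr_eq0.
pose Bq := 4 * p * (p * B)^-1 * (2 * (y^-1 / (y / 2)) * vol E * p^-1).
pose C := S5 * Bq + (1 + 5 ^+ m) * (y / 2)^-1.
have y20 : 0 < y / 2 by rewrite divr_gt0.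
have S50 : 0 <= S5 by apply: sumr_ge0 => i _; rewrite exprn_ge0.
have Bq0 : 0 <= Bq.
  by rewrite /Bq !mulr_ge0 ?invr_ge0 ?(ltW p0) ?(ltW y0) ?(ltW y20) ?(ltW vol0) ?mulr_ge0 ?(ltW p0) ?(ltW B0).
exists r, C; split => //.
(* Far from [a] the quotient form gives the bound. Within y/2 of [a] the product form does, because
   there Im z >= y/2 controls the Cauchy integral [Dd]. *)
- move=> z z0; have [za|za] := leP (y / 2) (normc (z - a)).
    have za0 : z != a.
      by rewrite -subr_eq0 -normc_gt0; exact: lt_le_trans za.
    rewrite rE' // normcM normcV.
    apply: (@le_trans _ _ ((1 + 5 ^+ m) * (y / 2)^-1)); last by rewrite lerDr mulr_ge0.
    apply: ler_pM; rewrite ?normc_ge0 ?invr_ge0 ?normc_ge0 //.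
      apply: le_trans (normc_triangle _ _) _; rewrite normc_opp normc1 normcX lerD2l.
      by rewrite lerXn2r ?nnegrE ?normc_ge0 // e_le.
    by rewrite lef_pV2 ?posrE // (lt_le_trans _ za).
  rewrite /r normc_opp normcM.
  apply: (@le_trans _ _ (S5 * Bq)); last first.
    by rewrite lerDl mulr_ge0 ?addr_ge0 ?exprn_ge0 // invr_ge0 ltW.
  apply: ler_pM; rewrite ?normc_ge0 ?S_le //.
  rewrite /q !normcM !normcV normcM normc_imag ger0_norm ?mulr_ge0 ?(ltW p0) // /Bq.
  apply: ler_pM.
  + by rewrite mulr_ge0 ?invr_ge0 ?mulr_ge0 ?normc_ge0 ?(ltW p0).
  + by rewrite mulr_ge0 ?invr_ge0 ?normc_ge0.
  + rewrite ler_wpM2l ?mulr_ge0 ?(ltW p0) // lef_pV2 ?posrE ?mulr_gt0 ?normc_gt0 ?den0 //.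
    by rewrite ler_wpM2r ?normc_ge0 // den_ge.
  + apply: ler_pM; rewrite ?normc_ge0 ?invr_ge0 ?normc_ge0 //; last first.
      by rewrite lef_pV2 ?posrE ?normc_gt0 ?den0 ?den_ge.
    have [mD _] := bD.
    apply: le_trans (cauchyT_bound E N0 mE EN _ y^-1 z mD _ z0) _.
      by move=> s; rewrite mul1r; exact: normc_cauchy.
    have yz : y / 2 <= complex.Im z.
      have := le_lt_trans (Im_le_normc _) za; rewrite ImD ImN -/y ltr_norml => /andP [+ _]; lra.
    rewrite ler_wpM2r ?(ltW vol0) // ler_wpM2l // ler_wpM2l ?invr_ge0 ?(ltW y0) //.
    by rewrite lef_pV2 ?posrE.
move=> x xE.
have t1 : 1 < (1 + B ^+ 2) / 2 by lra.
have := bump_off x _ t1 xE; have := yseq_small _ y20.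
(* Moving 1/(z - a) to the boundary costs yseq n / (|z - a| |x - a|), where the denominator is at
   least y^2 / 2; this leaves eta / 2. *)
have ey4 : 0 < eta * y ^+ 2 / 4 by rewrite divr_gt0 // mulr_gt0 // exprn_gt0.
have := yseq_small _ ey4; apply: filterS3 => n yn1 yn2 bn.
pose z := Complex x (yseq n); have z0 : 0 < complex.Im z by exact: yseq_gt0.
rewrite -/z in bn *.
have zay : y / 2 <= normc (z - a).
  apply: le_trans (Im_le_normc _); rewrite ImD ImN /= -/y distrC ger0_norm; lra.
have za : z != a by rewrite -subr_eq0 -normc_gt0; exact: lt_le_trans zay.
have xa : x%:C - a != 0 := sub_neq0 a x a0.
have xay : y <= normc (x%:C - a) := Im_sub_ge a x a0.
have zya : (normc (z - a))^-1 <= (y / 2)^-1.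
  by rewrite lef_pV2 ?posrE // normc_gt0 subr_eq0.
have xya : (normc (x%:C - a))^-1 <= y^-1 by rewrite lef_pV2 ?posrE // normc_gt0.
have em : normc (e z ^+ m) <= eta * (y / 4).
  rewrite normcX; apply: le_trans rhom; rewrite lerXn2r ?nnegrE ?normc_ge0 //.
  rewrite -(@ler_pXn2r _ 2) ?nnegrE ?normc_ge0 // [rho ^+ 2]sqr_sqrtr //.
  rewrite /e normcM normcV exprMn exprVn -/B ler_pdivrMr ?exprn_gt0 //.
  apply: le_trans bn _; rewrite /rho2 le_eqVlt; apply/orP; left; apply/eqP.
  by field; exact: lt0r_neq0.
have -> : r z - (x%:C - a)^-1 =
    - ((z - x%:C) * ((z - a)^-1 * (x%:C - a)^-1)) - e z ^+ m * (z - a)^-1.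
  rewrite rE' //; have za' : z - a != 0 by rewrite subr_eq0.
  by field; rewrite za' xa.
apply: le_trans (normc_triangle _ _) _; rewrite !normc_opp !normcM !normcV.
have -> : normc (z - x%:C) = yseq n.
  have -> : z - x%:C = Complex 0 (yseq n).
    by apply/eqP; rewrite eq_complex /= subrr subr0 !eqxx.
  by rewrite normc_imag gtr0_norm // yseq_gt0.
have h1 : yseq n * ((normc (z - a))^-1 * (normc (x%:C - a))^-1) <=
    eta * y ^+ 2 / 4 * ((y / 2)^-1 * y^-1).
  apply: ler_pM; rewrite ?mulr_ge0 ?invr_ge0 ?normc_ge0 ?(ltW (yseq_gt0 n)) ?(ltW yn1) //.
  by apply: ler_pM; rewrite ?invr_ge0 ?normc_ge0.
have h2 : normc (e z ^+ m) * (normc (z - a))^-1 <= eta * (y / 4) * (y / 2)^-1.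
  by apply: ler_pM; rewrite ?invr_ge0 ?normc_ge0.
apply: le_trans (lerD h1 h2) _; rewrite le_eqVlt; apply/orP; left; apply/eqP.
by field; exact: lt0r_neq0.
Qed.

End PoleApproximation.

(** * Uniform approximation by Poisson kernels *)

Section PoissonApproximation.
Context {R : realType}.
Implicit Types (u : R -> R).

(** The second point is not confined to the segment: below, the mesh points lie in a segment while
    the point of evaluation is arbitrary. *)
Lemma unif_continuous_segment u (a b e : R) : continuous u -> 0 < e ->
  exists2 d : R, 0 < d & forall x t, a <= x <= b -> `|x - t| < d -> `|u x - u t| <= e.
Proof.
move=> cu e0.
have /compact_near_coveringP := @segment_compact R a b.
move=> /(_ R (0%R^'+) (fun d x => forall t, `|x - t| < d -> `|u x - u t| <= e) _) H.
have [x xab|d d0 dP] := H _.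
  have e20 : 0 < e / 2 by rewrite divr_gt0.
  have /cvgrPdist_le /(_ _ e20) /nbhs_ballP [d d0 dP] := cu x.
  exists (ball x (d / 2), [set d' : R | d' < d / 2]).
    split; first by apply: nbhsx_ballx; rewrite divr_gt0.
    by rewrite /=; apply: nbhs_right_lt; rewrite divr_gt0.
  move=> [y d'] /= [xy d'd] t yt.
  have xy' : ball x d y by apply: le_ball xy; rewrite ler_pdivrMr // ler_pMr //; lra.
  have xt' : ball x d t.
    rewrite /ball /= in xy *; rewrite -(subrKA y) (le_lt_trans (ler_normD _ _)) //.
    lra.
  have := dP y xy'; have := dP t xt'; rewrite /=.
  rewrite !ler_norml => /andP [? ?] /andP [? ?]; apply/andP; split; lra.
exists (d / 2); first by rewrite divr_gt0.
move=> x t xab xt; apply: (dP (d / 2) _ _ x _ t xt).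
- by rewrite /ball /= sub0r normrN gtr0_norm ?divr_gt0 //; have : (0 < d) by []; lra.
- by rewrite divr_gt0.
- by rewrite /= in_itv.
Qed.

Lemma atan_cell (x t D y : R) : 0 < y -> 0 <= D -> exists2 s, t <= s <= t + D &
  atan ((t + D - x) / y) - atan ((t - x) / y) = D * (y / ((s - x) ^+ 2 + y ^+ 2)).
Proof.
move=> y0 D0.
have dk (s : R) := is_derive_atan_scaled x y s y0.
have cf : {within `[t, t + D], continuous (fun s => atan ((s - x) / y))}.
  by apply: derivable_within_continuous => s _; case: (dk s).
have tD : t <= t + D by rewrite lerDl.
have [s sI ->] := MVT_segment tD (fun s _ => dk s) cf.
exists s; first by move: sI; rewrite in_itv.
by rewrite mulrC; congr (_ * _); rewrite addrC addKr.
Qed.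

Lemma poisson_lip (x s t y : R) : 0 < y ->
  `|y / ((s - x) ^+ 2 + y ^+ 2) - y / ((t - x) ^+ 2 + y ^+ 2)| <= `|s - t| * (2 / y ^+ 2).
Proof.
move=> y0; have -> : s - t = (s - x) - (t - x) by ring.
move: (s - x) (t - x) => a b.
have A0 : 0 < a ^+ 2 + y ^+ 2 by rewrite ltr_wpDl ?sqr_ge0 // exprn_gt0.
have B0 : 0 < b ^+ 2 + y ^+ 2 by rewrite ltr_wpDl ?sqr_ge0 // exprn_gt0.
have -> : y / (a ^+ 2 + y ^+ 2) - y / (b ^+ 2 + y ^+ 2) =
    - (a - b) * (y * (a + b) / ((a ^+ 2 + y ^+ 2) * (b ^+ 2 + y ^+ 2))).
  by field; rewrite !gt_eqF.
rewrite normrM normrN ler_wpM2l // normrM normfV [`|_ * (b ^+ 2 + _)|]gtr0_norm ?mulr_gt0 //.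
rewrite ler_pdivrMr ?mulr_gt0 //.
rewrite mulrAC ler_pdivlMr ?exprn_gt0 // normrM (gtr0_norm y0).
have ab : y * `|a + b| <= (a ^+ 2 + y ^+ 2) / 2 + (b ^+ 2 + y ^+ 2) / 2.
  apply: (@le_trans _ _ (y * (`|a| + `|b|))); first by rewrite ler_wpM2l ?(ltW y0) // ler_normD.
  have := sqr_ge0 (`|a| - y); have := sqr_ge0 (`|b| - y).
  rewrite !sqrrB !real_normK ?num_real //; lra.
apply: le_trans (ler_wpM2r (sqr_ge0 y) ab) _.
have a20 := sqr_ge0 a; have b20 := sqr_ge0 b; have y20 := sqr_ge0 y.
have := mulr_ge0 a20 b20; have := mulr_ge0 a20 y20; have := mulr_ge0 b20 y20; have := mulr_ge0 y20 y20.
lra.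
Qed.

Definition poisson (a : R[i]) (x : R) : R := complex.Im (x%:C - a)^-1.

Lemma poissonE (x t y : R) : poisson (Complex t y) x = y / ((t - x) ^+ 2 + y ^+ 2).
Proof.
rewrite /poisson /= sub0r sqrrN mulNr opprK; congr (_ / (_ + _)).
by rewrite -sqrrN opprB.
Qed.

(* The differences of atan at the mesh points telescope, and each of them is a value of the
   Poisson kernel by the mean value theorem. *)
Lemma poisson_approx_real u (e : R) : continuous u ->
  (u x @[x --> +oo] --> (0 : R)) -> (u x @[x --> -oo] --> (0 : R)) -> 0 < e ->
  exists s : seq (R * R[i]), (forall ca, ca \in s -> 0 < complex.Im ca.2) /\
    forall x, `|u x - \sum_(ca <- s) ca.1 * poisson ca.2 x| <= e.
Proof.
move=> cu uy uNy e0.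
pose e3 := e / 3; have e30 : 0 < e3 by rewrite divr_gt0.
have [R0 R00 uR0] : exists2 R0 : R, 0 < R0 & forall x, R0 <= `|x| -> `|u x| <= e3.
  have /cvgrPdist_le /(_ _ e30) [r1 [_ r1P]] := uy.
  have /cvgrPdist_le /(_ _ e30) [r2 [_ r2P]] := uNy.
  exists (`|r1| + `|r2| + 1); first by rewrite ltr_wpDl ?addr_ge0.
  move=> x; have n1 := ler_norm r1; have n2 := ler_norm (- r2).
  rewrite normrN in n2; have m1 := normr_ge0 r1; have m2 := normr_ge0 r2.
  rewrite ler_normr => /orP [h|h].
    by have := r1P x; rewrite sub0r normrN; apply; lra.
  by have := r2P x; rewrite sub0r normrN; apply; lra.
have [M M0 uM] : exists2 M : R, 0 <= M & forall x, `|u x| <= M.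
  have cnu : {within `[- R0, R0], continuous (fun x => `|u x|)}.
    apply: continuous_subspaceT => x; apply: cvg_norm; exact: cu.
  have RR : - R0 <= R0 by lra.
  have [c _ cP] := EVT_max RR cnu.
  exists (`|u c| + e3); first by rewrite addr_ge0 // ltW.
  move=> x; have [h|h] := leP R0 `|x|.
    by rewrite (le_trans (uR0 x h)) // lerDr.
  have /cP h' : x \in `[- R0, R0]%R by rewrite in_itv /= -ler_norml ltW.
  by rewrite (le_trans h') // lerDl ltW.
(* The margin 1 keeps every x with |x| < R0 at distance at least 1 from both ends, which is what
   makes the kernel mass missed at the ends uniformly small. *)
pose R1 := R0 + 1.
have [eta eta0 etaP] := unif_continuous_segment u (- R1) R1 e3 cu e30.
(* A small height serves twice: almost all the mass pi of the kernel lies within distance 1 of its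
   centre, and the kernel is small beyond distance eta / 2. *)
have [y [y0 yatan yfar]] : exists y : R, [/\ 0 < y, M * (pi - 2 * atan y^-1) <= e3 &
    2 * R1 * (2 * M * (y / (eta / 2) ^+ 2)) <= e3 / 2].
  pose K := 2 * R1 * (2 * M * ((eta / 2) ^+ 2)^-1).
  have e5 : 0 < e3 / (2 * (M + 1)) by rewrite divr_gt0 // mulr_gt0 // ltr_wpDl.
  have /cvgrPdist_le /(_ _ e5) [r [_ rP]] := @cvgy_atan R.
  have K0 : 0 <= K.
    by rewrite /K !mulr_ge0 ?invr_ge0 ?sqr_ge0 // /R1; lra.
  pose y := Num.min (`|r| + 1)^-1 (e3 / 2 / (K + 1)).
  have y0 : 0 < y.
    by rewrite lt_min invr_gt0 ltr_wpDl //= !divr_gt0 // ltr_wpDl.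
  have yr : r < y^-1.
    apply: (@lt_le_trans _ _ (`|r| + 1)).
      by have := ler_norm r; lra.
    by rewrite -[X in X <= _]invrK lef_pV2 ?posrE ?invr_gt0 ?ltr_wpDl // ge_min lexx.
  have yK : y <= e3 / 2 / (K + 1) by rewrite ge_min lexx orbT.
  exists y; split => //.
    have := rP _ yr; rewrite ler_norml => /andP [_].
    rewrite ler_pdivlMr ?mulr_gt0 ?ltr_wpDl // => h.
    have := atan_ltpi2 y^-1; set P := (pi : R) in h *; set Q := atan _ in h * => h'.
    have : 0 <= P - 2 * Q by lra.
    have : (P / 2 - Q) * (2 * (M + 1)) = M * (P - 2 * Q) + (P - 2 * Q) by field.
    lra.
  have -> : 2 * R1 * (2 * M * (y / (eta / 2) ^+ 2)) = y * K by rewrite /K; ring.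
  apply: (@le_trans _ _ (y * (K + 1))).
    by rewrite ler_wpM2l ?(ltW y0) // lerDl.
  by rewrite -ler_pdivlMr // ltr_wpDl.
have R10 : 0 < R1 by rewrite /R1; lra.
(* Cells of length at most eta / 2, so that a cell whose left end is eta away from x stays eta / 2
   away; and fine enough for the Lipschitz error of the kernel, summed over all cells. *)
have [n [n0 nmesh nlip]] : exists n : nat, [/\ (0 < n)%N, 2 * R1 / n%:R <= eta / 2 &
    2 * R1 * (M * (2 * R1 / n%:R * (2 / y ^+ 2))) <= e3 / 2].
  pose K := 2 * R1 / (eta / 2) + 2 * R1 * (M * (2 * R1 * (2 / y ^+ 2))) / (e3 / 2).
  have h1 : 0 <= 2 * R1 / (eta / 2) by apply: divr_ge0; lra.
  have h2 : 0 <= 2 * R1 * (M * (2 * R1 * (2 / y ^+ 2))) / (e3 / 2).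
    have ? : 0 <= 2 * R1 by lra.
    apply: divr_ge0; last lra.
    have y2 : 0 <= 2 / y ^+ 2 by rewrite divr_ge0 // sqr_ge0.
    by apply: mulr_ge0 => //; apply: mulr_ge0 => //; exact: mulr_ge0.
  have K0 : 0 <= K by apply: addr_ge0.
  have nK := archi_boundP K0; set n := Num.bound K in nK.
  have n0 : (0 < n)%N by rewrite -(ltr0n R); exact: le_lt_trans nK.
  have nR : 0 < n%:R :> R by rewrite ltr0n.
  exists n; split => //.
    rewrite ler_pdivrMr // -ler_pdivrMl ?divr_gt0 // [_^-1 * _]mulrC.
    by apply: le_trans (ltW nK); rewrite lerDl.
  have -> : 2 * R1 * (M * (2 * R1 / n%:R * (2 / y ^+ 2))) =
     2 * R1 * (M * (2 * R1 * (2 / y ^+ 2))) / n%:R.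
    by field; rewrite !gt_eqF // ?exprn_gt0.
  rewrite ler_pdivrMr // -ler_pdivrMl ?divr_gt0 // [_^-1 * _]mulrC.
  by apply: le_trans (ltW nK); rewrite lerDr.
have nR : 0 < n%:R :> R by rewrite ltr0n.
pose D := 2 * R1 / n%:R; have D0 : 0 < D by rewrite divr_gt0 // mulr_gt0.
pose t (j : nat) := - R1 + j%:R * D.
have tn : t n = R1 by rewrite /t /D; field; rewrite gt_eqF.
have t0 : t 0%N = - R1 by rewrite /t mul0r addr0.
have tS j : t j.+1 = t j + D by rewrite /t -natr1; ring.
have tI j : (j < n)%N -> - R1 <= t j <= R1.
  move=> jn; rewrite /t lerDl mulr_ge0 ?(ltW D0) //= -{2}tn /t lerD2l.
  by rewrite ler_wpM2r ?(ltW D0) // ler_nat ltnW.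
pose s := [seq (u (t j) * D / pi, Complex (t j) y) | j <- iota 0 n].
exists s; split; first by move=> ca /mapP [j _ ->].
move=> x.
(* The integral over the j-th cell of the kernel centred at x. *)
pose q j := atan ((t j.+1 - x) / y) - atan ((t j - x) / y).
pose k j := y / ((t j - x) ^+ 2 + y ^+ 2).
have -> : \sum_(ca <- s) ca.1 * poisson ca.2 x = pi^-1 * \sum_(0 <= j < n) u (t j) * D * k j.
  rewrite /s big_map /index_iota subn0 mulr_sumr; apply: eq_bigr => j _ /=.
  by rewrite -/(poisson (Complex (t j) y) x) poissonE -/(k j); ring.
have pi0 : 0 < (pi : R) := pi_gt0 R.
have pi2 : 2 <= (pi : R) := pi_ge2 R.
pose e1 := 2 * M * (y / (eta / 2) ^+ 2) + M * (D * (2 / y ^+ 2)).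
have q0 j : 0 <= q j.
  rewrite /q subr_ge0 le_atan // ler_wpM2r ?invr_ge0 ?(ltW y0) // tS; lra.
(* Within eta of x, continuity of [u] gives e3 times the kernel mass of the cell; farther away [u]
   is only bounded but the kernel is small. The Lipschitz error occurs in both cases. *)
have cell j : (j < n)%N -> `|u x * q j - u (t j) * D * k j| <= e3 * q j + D * e1.
  move=> jn; have [s0 /andP [s1 s2]] := atan_cell x (t j) D y y0 (ltW D0).
  rewrite -tS -/(q j); set ks := y / _ => qE.
  have ks0 : 0 <= ks by rewrite divr_ge0 ?(ltW y0) // addr_ge0 // sqr_ge0.
  have lip : `|ks - k j| <= D * (2 / y ^+ 2).
    apply: le_trans (poisson_lip x s0 (t j) y y0) _; apply: ler_wpM2r.
      by rewrite divr_ge0 // sqr_ge0.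
    by rewrite ger0_norm; lra.
  have -> : u x * q j - u (t j) * D * k j =
      (u x - u (t j)) * q j + D * (u (t j) * (ks - k j)) by rewrite qE; ring.
  apply: le_trans (ler_normD _ _) _; rewrite /e1 [D * (_ + _)]mulrDr addrA; apply: lerD; last first.
    rewrite normrM (gtr0_norm D0) ler_wpM2l ?(ltW D0) // normrM.
    by apply: ler_pM.
  rewrite normrM (ger0_norm (q0 j)).
  have De0 : 0 <= D * (2 * M * (y / (eta / 2) ^+ 2)).
    have ye : 0 <= y / (eta / 2) ^+ 2 by rewrite divr_ge0 ?sqr_ge0 ?(ltW y0).
    by apply: mulr_ge0; [exact: ltW|apply: mulr_ge0 => //; exact: mulr_ge0].
  have [near|far] := ltP `|t j - x| eta.
    apply: le_trans (_ : e3 * q j <= _); last by rewrite lerDl.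
    by rewrite ler_wpM2r // distrC; apply: etaP => //; exact: tI.
  apply: le_trans (_ : D * (2 * M * (y / (eta / 2) ^+ 2)) <= _); last first.
    by rewrite lerDr mulr_ge0 // ltW.
  rewrite qE mulrCA ler_wpM2l ?(ltW D0) //; apply: ler_pM => //.
    by apply: le_trans (ler_normB _ _) _; have := uM x; have := uM (t j); lra.
  rewrite /ks ler_wpM2l ?(ltW y0) // lef_pV2 ?posrE; last 2 first.
  - by rewrite ltr_wpDl ?sqr_ge0 // exprn_gt0.
  - by rewrite exprn_gt0 // divr_gt0.
  apply: (@le_trans _ _ ((s0 - x) ^+ 2)); last by rewrite lerDl sqr_ge0.
  rewrite -[X in _ <= X]real_normK ?num_real // ler_sqr ?nnegrE ?divr_ge0 ?(ltW eta0) //.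
  have h1 : `|t j - x| <= `|s0 - x| + `|t j - s0|.
    by rewrite -[t j - x](subrKA s0) addrC ler_normD.
  have h2 : `|t j - s0| <= D by rewrite distrC ger0_norm; lra.
  rewrite -/D in nmesh; lra.
have sumq : \sum_(0 <= j < n) q j = atan ((R1 - x) / y) + atan ((R1 + x) / y).
  rewrite telescope_sumr // tn t0 -[X in _ - X]opprK -atanN opprK; congr (_ + atan _).
  by ring.
set Q := atan ((R1 - x) / y) + atan ((R1 + x) / y) in sumq.
have Q0 : 0 <= Q by rewrite -sumq; apply: sumr_ge0.
have Qpi : Q <= pi.
  by have := atan_ltpi2 ((R1 - x) / y); have := atan_ltpi2 ((R1 + x) / y); rewrite /Q; lra.
have total : `|u x * Q - \sum_(0 <= j < n) u (t j) * D * k j| <= e3 * Q + e3.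
  rewrite -sumq mulr_sumr -sumrB; apply: le_trans (ler_norm_sum _ _ _) _.
  apply: (@le_trans _ _ (\sum_(0 <= j < n) (e3 * q j + D * e1))).
    by apply: ler_sum_nat => j /andP [_ jn]; exact: cell.
  rewrite big_split /= -mulr_sumr lerD2l big_const_nat subn0 iter_addr_0.
  rewrite -[D * e1 *+ n]mulr_natl mulrA.
  have -> : n%:R * D = 2 * R1 by rewrite /D; field; rewrite gt_eqF.
  rewrite /e1 mulrDr; move: yfar nlip; rewrite -/D; lra.
(* The missing mass pi - Q is harmless for one of two reasons: [u] is small for |x| >= R0, and Q is
   close to pi for |x| < R0. *)
have tail : `|u x| * (pi - Q) <= e3 * pi.
  have [h|h] := leP R0 `|x|.
    apply: (@le_trans _ _ (e3 * (pi - Q))); first by rewrite ler_wpM2r ?subr_ge0 ?uR0.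
    by rewrite ler_wpM2l ?(ltW e30) // gerBl.
  apply: (@le_trans _ _ e3); last by rewrite ler_peMr ?(ltW e30) //; lra.
  apply: le_trans yatan; apply: ler_pM; rewrite ?subr_ge0 //.
  rewrite lerD2l lerN2 /Q.
  move: h; rewrite ltr_norml => /andP [h1 h2].
  have a1 : atan y^-1 <= atan ((R1 - x) / y).
    by apply: le_atan; rewrite ler_pdivlMr // mulVf ?gt_eqF // /R1; lra.
  have a2 : atan y^-1 <= atan ((R1 + x) / y).
    by apply: le_atan; rewrite ler_pdivlMr // mulVf ?gt_eqF // /R1; lra.
  lra.
set S := \sum_(0 <= j < n) _ in total *.
(* Stated for a variable in place of [pi], so that [field] treats it as an atom. *)
have gen (P : R) : 0 < P -> u x - P^-1 * S = P^-1 * (u x * (P - Q) + (u x * Q - S)).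
  by move=> P0; field; exact: lt0r_neq0.
rewrite gen //.
rewrite normrM ger0_norm ?invr_ge0 ?(ltW pi0) // mulrC ler_pdivrMr //.
apply: le_trans (ler_normD _ _) _; rewrite normrM [`|pi - Q|]ger0_norm ?subr_ge0 //.
apply: le_trans (lerD tail total) _.
have -> : e = 3 * e3 by rewrite /e3; field.
have : e3 * Q <= e3 * pi by rewrite ler_wpM2l ?(ltW e30).
have : e3 * 1 <= e3 * pi by rewrite ler_wpM2l ?(ltW e30) //; lra.
lra.
Qed.

End PoissonApproximation.

(** * Analytic approximation of the symbol *)

Section SymbolApproximation.
Context {R : realType}.
Local Notation mu := (@lebesgue_measure R).

Lemma cvg_ReIm (T : Type) (F : set_system T) (FF : Filter F) (f : T -> R[i]) (l : R[i]) :
  (f x : CN R) @[x --> F] --> (l : CN R) ->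
  complex.Re (f x) @[x --> F] --> complex.Re l /\ complex.Im (f x) @[x --> F] --> complex.Im l.
Proof.
move=> /cvgrPdist_le fl; split; apply/cvgrPdist_le => e e0;
    have e0' : (0 : R[i]) < e%:C by rewrite ltcR.
- have := fl _ e0'; apply: filterS => x; rewrite normr_normc lecR; apply: le_trans.
  by rewrite -ReN -ReD Re_le_normc.
- have := fl _ e0'; apply: filterS => x; rewrite normr_normc lecR; apply: le_trans.
  by rewrite -ImN -ImD Im_le_normc.
Qed.

Lemma poisson_approx (g : R -> R[i]) (e : R) : Cinf g -> 0 < e ->
  exists l : R[i], exists s : seq (R[i] * R[i]),
    (forall ca, ca \in s -> 0 < complex.Im ca.2) /\
    forall x, normc (g x - l - \sum_(ca <- s) ca.1 * (poisson ca.2 x)%:C) <= e.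
Proof.
move=> [cg [l [gy gNy]]] e0; exists l.
have e20 : 0 < e / 2 by rewrite divr_gt0.
have [ry iy] := cvg_ReIm _ _ _ _ _ gy; have [rNy iNy] := cvg_ReIm _ _ _ _ _ gNy.
have cr : continuous (fun x => complex.Re (g x) - complex.Re l).
  by move=> x; apply: cvgB; [case: (cvg_ReIm _ _ _ _ _ (cg x))|exact: cvg_cst].
have ci : continuous (fun x => complex.Im (g x) - complex.Im l).
  by move=> x; apply: cvgB; [case: (cvg_ReIm _ _ _ _ _ (cg x))|exact: cvg_cst].
have lim0 (F : set_system R) (FF : Filter F) (u : R -> R) (c : R) :
    u x @[x --> F] --> c -> (u x - c) @[x --> F] --> (0 : R).
  by move=> uc; rewrite -(subrr c); apply: cvgB => //; exact: cvg_cst.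
have [s1 [s1P s1a]] := poisson_approx_real _ _ cr (lim0 _ _ _ _ ry) (lim0 _ _ _ _ rNy) e20.
have [s2 [s2P s2a]] := poisson_approx_real _ _ ci (lim0 _ _ _ _ iy) (lim0 _ _ _ _ iNy) e20.
exists ([seq (ca.1%:C, ca.2) | ca <- s1] ++ [seq (Complex 0 ca.1, ca.2) | ca <- s2]); split.
  by move=> ca; rewrite mem_cat => /orP [] /mapP [ca' cas ->] /=; [exact: s1P|exact: s2P].
move=> x; rewrite big_cat !big_map /=.
have E1 : \sum_(j <- s1) (j.1%:C * (poisson j.2 x)%:C) =
    (\sum_(j <- s1) j.1 * poisson j.2 x)%:C.
  by rewrite rmorph_sum; apply: eq_bigr => j _; rewrite rmorphM.
have E2 : \sum_(j <- s2) (Complex 0 j.1 * (poisson j.2 x)%:C) =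
    Complex 0 (\sum_(j <- s2) j.1 * poisson j.2 x).
  elim: s2 {s2P s2a} => [|j s2 IH]; first by rewrite !big_nil.
  by rewrite !big_cons IH; apply/eqP; rewrite eq_complex !ReImE /=; apply/andP;
    split; apply/eqP; ring.
rewrite E1 E2; apply: le_trans (normc_le_ReIm _) _; rewrite !ReImE /= [e]splitr.
by apply: lerD; rewrite ?oppr0 ?addr0 ?add0r ?subr0; [exact: s1a|exact: s2a].
Qed.

Lemma poisson_split (a : R[i]) (x : R) : 0 < complex.Im a ->
  (poisson a x)%:C = (Complex 0 2)^-1 * ((x%:C - a)^-1 - (x%:C - a^*)^-1).
Proof.
move=> a0; have h1 := sub_neq0 a x a0.
have -> : (x%:C - a^*)^-1 = ((x%:C - a)^-1)^*.
  rewrite conjc_inv; congr (_^-1); case: (a) => u v; apply/eqP.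
  by rewrite eq_complex /=; apply/andP; split; apply/eqP; ring.
rewrite /poisson; case: (x%:C - a)^-1 => b c.
have -> : Complex b c - (Complex b c)^* = Complex 0 2 * c%:C.
  by apply/eqP; rewrite eq_complex !ReImE /=; apply/andP; split; apply/eqP; ring.
rewrite mulrA mulVf ?mul1r // eq_complex /= pnatr_eq0 andbF //.
Qed.

Section Poles.
Variables (E : set R) (N0 : R).
Hypotheses (mE : measurable E) (EN : forall s, E s -> `|s| <= N0) (vol0 : 0 < vol E).

Definition off (x : R) := exists2 d : R, 0 < d & forall s, E s -> d <= `|s - x|.

Lemma poisson_sum_approx (s : seq (R[i] * R[i])) (eta : R) :
  (forall ca, ca \in s -> 0 < complex.Im ca.2) -> 0 < eta ->
  exists beta : R[i] -> R[i], exists C : R,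
  [/\ hol beta, (forall z, 0 < complex.Im z -> normc (beta z) <= C),
   (forall x : R, normc (\sum_(ca <- s) ca.1 * (poisson ca.2 x)%:C) <= C) &
   forall x : R, off x -> \forall n \near \oo,
     normc (beta (Complex x (yseq n)) - \sum_(ca <- s) ca.1 * (poisson ca.2 x)%:C) <= eta].
Proof.
elim: s eta => [|[c a] s IH] eta sP eta0.
  exists (fun=> 0), 0; split; first exact: hol_cst.
  - by move=> z _; rewrite normc0.
  - by move=> x; rewrite big_nil normc0.
  - by move=> x _; apply: nearW => n; rewrite big_nil subrr normc0 ltW.
have a0 : 0 < complex.Im a by apply: (sP (c, a)); rewrite mem_head.
have sP' ca : ca \in s -> 0 < complex.Im ca.2.
  by move=> cas; apply: sP; rewrite inE cas orbT.
have eta20 : 0 < eta / 2 by rewrite divr_gt0.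
have [beta [C [hb bC sC bs]]] := IH (eta / 2) sP' eta20.
pose c' := c * (Complex 0 2)^-1; pose K := normc c' + 1.
have K0 : 0 < K by rewrite ltr_wpDl ?normc_ge0.
(* Each Poisson kernel brings two such errors, one from [r] and one from moving 1/(z - conj a) to
   the boundary; after multiplication by [c'] they make at most eta / 2. The [+ 1] in [K] covers c'
   = 0. *)
have e0 : 0 < eta / 4 / K by rewrite !divr_gt0.
have [r [Cr [hr rC rs]]] := pole_approx E N0 mE EN vol0 pi (pi_gt0 R)
  (harm_le E N0 mE EN) a _ a0 e0.
have ac z : 0 < complex.Im z -> complex.Im a <= normc (z - a^*).
  move=> z0; apply: le_trans (Im_le_normc _); apply: le_trans (ler_norm _).
  by rewrite ImD ImN /=; case: (a) => u v /=; lra.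
have ac0 z : 0 < complex.Im z -> z - a^* != 0.
  by move=> z0; rewrite -normc_gt0 (lt_le_trans a0) // ac.
have xac x : complex.Im a <= normc (x%:C - a^*).
  apply: le_trans (Im_le_normc _); apply: le_trans (ler_norm _).
  by rewrite ImD ImN /=; case: (a) => u v /=; lra.
have xac0 x : x%:C - a^* != 0 by rewrite -normc_gt0 (lt_le_trans a0).
have hinv : hol (fun z => (z - a^*)^-1).
  exact: (holV (fun z => z - a^*) ac0 (holB _ _ hol_id (hol_cst _))).
pose A := complex.Im a.
have inv_le w : A <= normc w -> normc w^-1 <= A^-1.
  by move=> Aw; rewrite normcV lef_pV2 ?posrE // (lt_le_trans a0).
have A0 : 0 <= A^-1 by rewrite invr_ge0 ltW.
have Cr0 : 0 <= Cr by apply: le_trans (normc_ge0 _) (rC a a0).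
have C0 : 0 <= C by apply: le_trans (normc_ge0 _) (bC a a0).
exists (fun z => c' * (r z - (z - a^*)^-1) + beta z).
exists (normc c' * (Cr + A^-1 + A^-1) + C); split.
- exact: (holD _ _ (holM _ _ (hol_cst c') (holB _ _ hr hinv)) hb).
- move=> z z0; apply: le_trans (normc_triangle _ _) _; apply: lerD; last exact: bC.
  rewrite normcM ler_wpM2l ?normc_ge0 //; apply: le_trans (normc_triangle _ _) _.
  rewrite normc_opp -addrA lerD ?rC // (le_trans (inv_le _ (ac z z0))) // lerDl.
  exact: A0.
- move=> x; rewrite big_cons /=; apply: le_trans (normc_triangle _ _) _; apply: lerD => //.
  rewrite poisson_split // mulrA -/c' normcM ler_wpM2l ?normc_ge0 //.
  apply: le_trans (normc_triangle _ _) _; rewrite normc_opp -addrA.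
  apply: le_trans (_ : A^-1 + A^-1 <= _); last by rewrite lerDr.
  by apply: lerD; apply: inv_le => //; exact: Im_sub_ge.
move=> x xoff.
have e20 : 0 < eta / 4 / K * A ^+ 2 by rewrite mulr_gt0 // exprn_gt0.
have := bs x xoff; have := rs x xoff; have := yseq_small _ e20.
apply: filterS3 => n yn rn bn; rewrite big_cons /= poisson_split //.
set z := Complex x (yseq n) in rn bn *; have z0 : 0 < complex.Im z by exact: yseq_gt0.
have dz : normc ((z - a^*)^-1 - (x%:C - a^*)^-1) <= eta / 4 / K.
  have -> : (z - a^*)^-1 - (x%:C - a^*)^-1 = - ((z - x%:C) * ((z - a^*)^-1 * (x%:C - a^*)^-1)).
    have h1 := ac0 z z0; have h2 := xac0 x.
    by field; rewrite h1 h2.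
  have -> : z - x%:C = Complex 0 (yseq n).
    by apply/eqP; rewrite eq_complex /= subrr subr0 !eqxx.
  rewrite normc_opp !normcM normc_imag gtr0_norm ?yseq_gt0 //.
  apply: (@le_trans _ _ (yseq n * (A^-1 * A^-1))).
    rewrite ler_wpM2l ?(ltW (yseq_gt0 n)) // ler_pM ?normc_ge0 //; apply: inv_le => //.
    exact: ac.
  by rewrite -expr2 exprVn ler_pdivrMr ?exprn_gt0 // ltW.
rewrite mulrA -/c'.
have -> : c' * (r z - (z - a^*)^-1) + beta z - (c' * ((x%:C - a)^-1 - (x%:C - a^*)^-1)
    + \sum_(j <- s) j.1 * (poisson j.2 x)%:C) =
    c' * ((r z - (x%:C - a)^-1) - ((z - a^*)^-1 - (x%:C - a^*)^-1))
    + (beta z - \sum_(j <- s) j.1 * (poisson j.2 x)%:C) by ring.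
apply: le_trans (normc_triangle _ _) _; rewrite [eta]splitr; apply: lerD => //.
rewrite normcM; apply: (@le_trans _ _ (K * (eta / 4 / K + eta / 4 / K))).
  apply: ler_pM; rewrite ?normc_ge0 // ?lerDl //.
  by apply: le_trans (normc_triangle _ _) _; rewrite normc_opp lerD.
by rewrite le_eqVlt; apply/orP; left; apply/eqP; field; exact: lt0r_neq0.
Qed.

(** Off [E] the error has three parts of at most 1/8: the boundary limit of the H^infty part, the
    Poisson approximation of g, and the removal of the poles. On [E] mere boundedness is used. *)
Lemma symbol_approx (phi : R -> R[i]) : HinfC phi -> closed E ->
  exists beta : R[i] -> R[i], exists C : R,
  [/\ hol beta, (forall z, 0 < complex.Im z -> normc (beta z) <= C), 0 <= C &
   {ae mu, forall x, \forall n \near \oo,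
     normc (beta (Complex x (yseq n)) - phi x) <= 1 / 2 + C * \1_E x}].
Proof.
move=> [h [g [[F [hF [M FM] Fh]] Cg phiE]]] cE.
have e0 : (0 : R) < 1 / 8 by [].
have [l [s [sP sa]]] := poisson_approx g _ Cg e0.
have [beta [C [hb bC sC bs]]] := poisson_sum_approx s (1 / 8) sP e0.
have FM' z : 0 < complex.Im z -> normc (F z) <= Num.sqrt M.
  move=> z0; apply: normc_le_sqr; first exact: sqrtr_ge0.
  have Fz := FM z z0; rewrite sqr_sqrtr // (le_trans _ Fz) //.
  by rewrite sqmodE sqr_ge0.
have C0 : 0 <= C by apply: le_trans (normc_ge0 _) (sC 0).
(* One constant for two purposes: a bound of the new function in the half-plane, which needs one
   [C], and of the error on [E], which needs two. *)
pose CC := Num.sqrt M + normc l + C + C.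
exists (fun z => F z + l + beta z), CC; split.
- exact: (holD _ _ (holD _ _ hF (hol_cst l)) hb).
- move=> z z0; apply: le_trans (normc_triangle _ _) _.
  apply: le_trans (lerD (normc_triangle _ _) (bC z z0)) _.
  have := FM' z z0; rewrite /CC; lra.
- by rewrite !addr_ge0 ?sqrtr_ge0 ?normc_ge0.
apply: ae_imp2 Fh phiE => x /cvg_at_right_yseq /cvgrPdist_le /(_ _ e0) Fx ->.
have Sx := sC x; have gx := sa x.
set S := \sum_(ca <- s) ca.1 * (poisson ca.2 x)%:C in Sx gx.
have [xE|xE] := pselect (E x).
  apply: filterS Fx => n; rewrite sub0r normrN ger0_norm ?normc_ge0 // => Fn.
  rewrite indicE mem_set // mulr1; set z := Complex x (yseq n) in Fn *.
  have bz := bC z (yseq_gt0 n).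
  have -> : F z + l + beta z - (h x + g x) = (F z - h x) + beta z - (g x - l - S) - S by ring.
  apply: le_trans (normc_triangle _ _) _; rewrite normc_opp.
  apply: le_trans (lerD (normc_triangle _ _) (lexx _)) _; rewrite normc_opp.
  apply: le_trans (lerD (lerD (normc_triangle _ _) (lexx _)) (lexx _)) _.
  have := sqrtr_ge0 M; have := normc_ge0 l; rewrite /CC; lra.
(* Closedness of [E] enters here: a point outside has positive distance to it. *)
have xoff : off x.
  have : (~` E) x by [].
  move/closed_openC: cE; rewrite openE => /(_ x) h1 /h1 /nbhs_ballP [d d0 dP].
  exists d => // t Et; rewrite leNgt; apply/negP => tx.
  by apply: (dP t) => //; rewrite /ball /= distrC.
have := bs x xoff; apply: filterS2 Fx => n; rewrite sub0r normrN ger0_norm ?normc_ge0 // => Fn bn.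
rewrite indicE memNset // mulr0 addr0; rewrite -/S in bn.
set z := Complex x (yseq n) in Fn bn *.
have -> : F z + l + beta z - (h x + g x) = (F z - h x) + (beta z - S) - (g x - l - S) by ring.
apply: le_trans (normc_triangle _ _) _; rewrite normc_opp.
apply: le_trans (lerD (normc_triangle _ _) (lexx _)) _; lra.
Qed.

End Poles.
End SymbolApproximation.

(** * The norm estimate *)

Section Assembly.
Context {R : realType}.
Local Notation mu := (@lebesgue_measure R).

Lemma L2_sqi (f : R -> R[i]) : L2 f -> sqi f.
Proof.
move=> [mf ff]; split => //; apply: ge0_ibl.
- exact: mfunX (mfun_normc _ mf).
- by move=> x; exact: sqr_ge0.
- by rewrite (_ : (fun x => _) = (fun x => (sqmod (f x))%:E)) //; apply/funext => x; rewrite sqmodE.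
Qed.

Lemma L2normE (f : R -> R[i]) : L2norm f = Num.sqrt (RI (fun x => normc (f x) ^+ 2)).
Proof.
rewrite /L2norm /RI /Rintegral; congr (Num.sqrt (fine _)).
by apply: eq_integral => x _; rewrite sqmodE.
Qed.

(** Lebesgue measure is its own image under reflection. *)
Lemma L2norm_Jop (f : R -> R[i]) : cmeasurable f -> L2norm (Jop f) = L2norm f.
Proof.
move=> mf; rewrite /L2norm; congr (Num.sqrt (fine _)).
have mu_sq : measurable_fun [set: R] (fun x => (sqmod (f x))%:E).
  apply/measurable_EFinP; rewrite (_ : (fun x => _) = (fun x => normc (f x) ^+ 2)).
    exact: mfunX (mfun_normc _ mf).
  by apply/funext => x; rewrite sqmodE.
have mN : measurable_fun [set: measurableTypeR R] (-%R : measurableTypeR R -> measurableTypeR R).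
  exact: oppr_measurable.
have H := @ge0_integral_pushforward _ _ (measurableTypeR R) (measurableTypeR R) R
  (-%R : measurableTypeR R -> measurableTypeR R) mN mu setT
  (fun x => (sqmod (f x))%:E) measurableT mu_sq.
have <- : (\int[pushforward mu (-%R : measurableTypeR R -> measurableTypeR R)]_x
    (sqmod (f x))%:E = \int[leb R]_x (sqmod (f x))%:E)%E.
  by apply: eq_measure_integral => A mA _; exact: lebesgue_measureN.
rewrite H ?preimage_setT //.
by move=> x _; rewrite lee_fin sqmodE sqr_ge0.
Qed.

Lemma H2plus_pair (f : R -> R[i]) : H2plus f -> exists F M, h2pair F f M.
Proof.
move=> [Lf [F [hF [M FM] Ff]]]; exists F, M; split => //; first exact: L2_sqi.
by apply: ae_imp Ff => x; exact: cvg_at_right_yseq.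
Qed.

Lemma cvg_at_left_yseq (F : R -> R[i]) (l : R[i]) :
  (fun y : R => (F y : CN R)) @ 0^'- --> (l : CN R) ->
  normc (F (- yseq n) - l) @[n --> \oo] --> (0 : R).
Proof.
move=> Fl; apply/cvgrPdist_le => e e0.
have e0' : (0 : R[i]) < e%:C by rewrite ltcR.
move/cvgrPdist_le: Fl => /(_ _ e0'); rewrite near_withinE => /nbhs_ballP [d d0 dP].
have := yseq_small d d0; apply: filterS => n nd.
have := dP (- yseq n); rewrite /ball /= sub0r normrN normrN gtr0_norm ?yseq_gt0 // oppr_lt0 yseq_gt0.
move=> /(_ nd isT).
by rewrite normr_normc lecR sub0r normrN ger0_norm ?normc_ge0 // normc_distC.
Qed.

(** By Schwarz reflection the conjugate of v is in H^2 of the upper half-plane, so the inner product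
    with v is the integral of a product of two functions of that space. *)
Lemma H2minus_conj_pair (v : R -> R[i]) : H2minus v ->
  exists G M, h2pair G (fun x => (v x)^*) M.
Proof.
move=> [Lv [F [hF [M FM] Fv]]]; exists (fun z => (F z^*)^*), M; split.
- move=> z z0; apply: cdable_conj; apply: hF.
  by case: z z0 => a b /=; rewrite /lower_half /= oppr_lt0.
- move=> t t0; have nt : - t < 0 by rewrite oppr_lt0.
  apply: le_trans (FM (- t) nt); rewrite le_eqVlt; apply/orP; left; apply/eqP.
  by apply: eq_integral => x _; rewrite !sqmodE normc_conj.
- have [[m1 m2] iv] := L2_sqi _ Lv; split.
    split.
      by rewrite (_ : (fun x => _) = (fun x => complex.Re (v x))) //; apply/funext => x; case: (v x).
    rewrite (_ : (fun x => _) = (fun x => - complex.Im (v x))).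
      exact: measurable_funN.
    by apply/funext => x; case: (v x).
  by rewrite (_ : (fun x => _) = (fun x => normc (v x) ^+ 2)) //; apply/funext => x; rewrite normc_conj.
- apply: ae_imp Fv => x /cvg_at_left_yseq.
  rewrite (_ : (fun n => normc (F (Complex x (- yseq n)) - v x)) =
    (fun n => normc ((F (Complex x (yseq n))^*)^* - (v x)^*))) //.
  by apply/funext => n; rewrite -[in RHS]rmorphB normc_conj.
Qed.

(** The set where |phi| < 1 is a countable union of bounded sets [B n] on which |phi|^2 stays below
    1 by a fixed amount; one of them is not null, and inner regularity shrinks it to a compact
    set. *)
Lemma compact_below_one (phi : R -> R[i]) : cmeasurable phi ->
  (0 < mu [set x | (sqmod (phi x) < 1)%R])%E ->
  exists E : set R, exists k N0 : R, [/\ closed E, measurable E,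
    (forall s, E s -> `|s| <= N0), 0 < vol E &
    0 < k <= 1 /\ forall s, E s -> sqmod (phi s) <= 1 - k].
Proof.
move=> mphi mu1.
have msq : mfun (fun x => sqmod (phi x)).
  rewrite (_ : (fun x => _) = (fun x => normc (phi x) ^+ 2)).
    exact: mfunX (mfun_normc _ mphi).
  by apply/funext => x; rewrite sqmodE.
pose B (n : nat) := [set x | sqmod (phi x) <= 1 - @yseq R n] `&` `[- n%:R, n%:R]%classic.
have mB n : measurable (B n).
  apply: measurableI; last exact: measurable_itv.
  rewrite (_ : [set x | _] = (fun x => sqmod (phi x)) @^-1` `]-oo, (1 - yseq n)]%classic).
    by rewrite -[X in measurable X]setTI; apply: msq => //; exact: measurable_itv.
  by apply/seteqP; split => x /=; rewrite in_itv.
have m1 : measurable [set x | (sqmod (phi x) < 1)%R].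
  rewrite (_ : [set x | _] = (fun x => sqmod (phi x)) @^-1` `]-oo, 1%R[%classic).
    by rewrite -[X in measurable X]setTI; apply: msq => //; exact: measurable_itv.
  by apply/seteqP; split => x /=; rewrite in_itv.
have [n Bn0] : exists n, (0 < mu (B n))%E.
  apply: contrapT => H.
  have neg n : mu.-negligible (B n).
    apply/negligibleP; first exact: mB.
    apply/eqP; rewrite eq_le measure_ge0 andbT leNgt.
    by apply/negP => h; apply: H; exists n.
  have := negligibleS _ (negligible_bigcup neg) => /(_ [set x | (sqmod (phi x) < 1)%R]) H1.
  have : mu.-negligible [set x | (sqmod (phi x) < 1)%R].
    apply: H1 => x /= x1.
    have d0 : 0 < 1 - sqmod (phi x) by rewrite subr_gt0.
    have [n1 _ n1P] := yseq_small _ d0.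
    pose n := (n1 + Num.bound `|x|)%N; exists n => //; split => /=.
      have := n1P n (leq_addr _ _) => /=; lra.
    rewrite in_itv /= -ler_norml (le_trans (ltW (archi_boundP (normr_ge0 x)))) //.
    by rewrite ler_nat leq_addl.
  by move/negligibleP => /(_ m1) h; move: mu1; rewrite h ltxx.
have finB : (mu (B n) < +oo)%E.
  apply: (@le_lt_trans _ _ (mu `[- n%:R, n%:R]%classic)).
    apply: le_measure; rewrite ?inE; [exact: mB|exact: measurable_itv|].
    exact: subIsetr.
  by rewrite lebesgue_measure_itv /=; case: ifP => _; rewrite ?ltry.
have finB' : mu (B n) \is a fin_num by rewrite ge0_fin_numE.
have e0 : 0 < fine (mu (B n)) by rewrite -lte_fin fineK.
(* The error allowed is the measure of [B n] itself, which is just enough to prevent [V] from being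
   null. *)
have [V [cV VB mV]] := lebesgue_regularity_inner (mB n) finB e0.
have mVV : measurable V by exact: compact_measurable.
have V0 : (0 < mu V)%E.
  rewrite lt_neqAle measure_ge0 andbT eq_sym; apply/eqP => h.
  move: mV; rewrite fineK //; apply/negP; rewrite -leNgt.
  have := @measureU2 _ _ _ mu _ _ mVV (measurableD (mB n) mVV).
  rewrite setDUK // => /le_trans; apply; rewrite -[X in (_ <= X)%E]add0e.
  by apply: leeD => //; rewrite le_eqVlt; apply/orP; left; apply/eqP; exact: h.
exists V, (yseq n), n%:R; split => //.
- exact: compact_closed (@Rhausdorff R) cV.
- by move=> s /VB [_]; rewrite /= in_itv /= -ler_norml.
- rewrite /vol /RI /Rintegral integral_indic // setIT fine_gt0 // V0 /=.
  apply: le_lt_trans finB; apply: le_measure; rewrite ?inE; [exact: mVV|exact: mB|exact: VB].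
split; first by rewrite yseq_gt0 /= /yseq invf_le1 ?ltr0n // ler1n.
by move=> s /VB [].
Qed.

(** The weights are 2 C^2 for the first bound and k for the second, over their sum k + 2 C^2; they
    are chosen so that the terms in [a] cancel. *)
Lemma sqrt_le_of_two_bounds (k C F2 V a : R) : 0 < k -> V <= F2 - k * a ->
  V <= 2^-1 * F2 + 2 * C ^+ 2 * a -> 0 <= F2 ->
  Num.sqrt V <= Num.sqrt ((k / 2 + 2 * C ^+ 2) / (k + 2 * C ^+ 2)) * Num.sqrt F2.
Proof.
move=> k0 h1 h2 F0; have C2 := sqr_ge0 C; move: (C ^+ 2) C2 h2 => D D0 h2.
have kD : 0 < k + 2 * D by lra.
rewrite -sqrtrM; last by apply: divr_ge0; lra.
apply: ler_wsqrtr; rewrite mulrAC ler_pdivlMr //.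
have := ler_wpM2l (ltW k0) h2.
have D20 : 0 <= 2 * D by lra.
have := ler_wpM2l D20 h1; lra.
Qed.

Lemma contraction_constant_lt1 (k C : R) : 0 < k ->
  Num.sqrt ((k / 2 + 2 * C ^+ 2) / (k + 2 * C ^+ 2)) < 1.
Proof.
move=> k0; have C2 := sqr_ge0 C; move: (C ^+ 2) C2 => D D0.
have kD : 0 < k + 2 * D by lra.
rewrite -[X in _ < X]sqrtr1 ltr_sqrt // ltr_pdivrMr // mul1r; lra.
Qed.

(** The bound |phi| <= 1 holds almost everywhere only, whereas integrability is obtained from
    pointwise domination. The symbol is set to 0 on the exceptional null set, which leaves it
    unchanged on [E]. *)
Lemma truncate_symbol (phi : R -> R[i]) : cmeasurable phi ->
  {ae mu, forall x, sqmod (phi x) <= 1} ->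
  exists phi' : R -> R[i], [/\ cmeasurable phi', (forall x, normc (phi' x) <= 1),
    {ae mu, forall x, phi x = phi' x} & forall x, sqmod (phi x) <= 1 -> phi' x = phi x].
Proof.
move=> mphi phi1; pose S := [set x | sqmod (phi x) <= 1].
have msq : mfun (fun x => sqmod (phi x)).
  rewrite (_ : (fun x => _) = (fun x => normc (phi x) ^+ 2)).
    exact: mfunX (mfun_normc _ mphi).
  by apply/funext => x; rewrite sqmodE.
have mS : measurable S.
  rewrite (_ : S = (fun x => sqmod (phi x)) @^-1` `]-oo, 1%R]%classic).
    by rewrite -[X in measurable X]setTI; apply: msq => //; exact: measurable_itv.
  by apply/seteqP; split => x /=; rewrite in_itv.
have phiS x : sqmod (phi x) <= 1 -> (\1_S x)%:C * phi x = phi x.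
  by move=> x1; rewrite indicE mem_set // mul1r.
exists (fun x => (\1_S x)%:C * phi x); split => //.
- apply: cmeasurableM => //; split => /=; last exact: measurable_cst.
  exact: measurable_indic.
- move=> x; have [x1|x1] := boolP (sqmod (phi x) <= 1).
    by rewrite phiS //; apply: normc_le_sqr; rewrite ?expr1n.
  rewrite indicE memNset ?mul0r ?normc0 //= => h; by move: x1; rewrite h.
- by apply: ae_imp phi1 => x /phiS.
Qed.

End Assembly.

(* ||H(phi)|| < 1, where H(phi) f = J P_-(phi f) on H^2 *)
Theorem theorem5p8 (R : realType) (phi : R -> R[i]) :
  HinfC phi ->
  cmeasurable phi ->
  {ae leb R, forall x, (sqmod (phi x) <= 1)%R} ->
  {ae leb R, forall x, Jop phi x = (phi x)^*} ->
  (0 < leb R [set x | (sqmod (phi x) < 1)%R])%E ->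
  exists c : R, c < 1 /\
    forall f v : R -> R[i], H2plus f -> is_Pminus (fun x => phi x * f x) v ->
      L2norm (Jop v) <= c * L2norm f.
Proof.
move=> HC mphi phi1 _ phipos.
have [E [k [N0 [cE mE EN volE [/andP [k0 k1] Ek]]]]] := compact_below_one phi mphi phipos.
have [beta [C [hb bC C0 bs]]] := symbol_approx E N0 mE EN volE phi HC cE.
have [phi' [mphi' phi'1 phiE phi'E]] := truncate_symbol phi mphi phi1.
exists (Num.sqrt ((k / 2 + 2 * C ^+ 2) / (k + 2 * C ^+ 2))); split; first exact: contraction_constant_lt1.
move=> f v Hf [Hv Pv].
have [F [M hF]] := H2plus_pair f Hf; have [G [M2 hG]] := H2minus_conj_pair v Hv.
have [_ _ [mf if2] _] := hF; have [_ _ [mg ig2] _] := hG.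
have [mv iv2] : sqi v by apply: L2_sqi; case: Hv.
have nv x : normc (v x)^* = normc (v x) by exact: normc_conj.
have ind01 x : 0 <= (\1_E x : R) <= 1 by rewrite indicE; case: (_ \in _); rewrite ?lexx ?ler01.
have mind : mfun (\1_E : R -> R) by exact: measurable_indic.
have nmf := mfun_normc _ mf; have nmv := mfun_normc _ mv.
have iEf : ibl (fun x => \1_E x * normc (f x) ^+ 2).
  apply: ibl_le (mfunM _ _ mind (mfunX _ 2 nmf)) _ if2 => x.
  have /andP [i0 i1] := ind01 x.
  rewrite normrM (ger0_norm i0) ger0_norm ?sqr_ge0 //.
  by apply: ler_piMl => //; exact: sqr_ge0.
have mpf := cmeasurableM _ _ mphi' mf.
have ipf2 : ibl (fun x => normc (phi' x * f x) ^+ 2).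
  apply: ibl_le (mfunX _ 2 (mfun_normc _ mpf)) _ if2 => x.
  rewrite ger0_norm ?sqr_ge0 // normcM exprMn.
  apply: ler_piMl; first exact: sqr_ge0.
  by apply: exprn_ile1; rewrite ?normc_ge0.
have mpfv := cmeasurableM _ _ mpf mg.
have ipfv : ibl (fun x => complex.Re (phi' x * f x * (v x)^*)).
  have i2 := iblD _ _ ipf2 iv2.
  apply: ibl_le (proj1 mpfv) _ i2 => x; apply: le_trans (Re_le_normc _) _.
  rewrite normcM nv; have := sqr_ge0 (normc (phi' x * f x) - normc (v x)).
  have := sqr_ge0 (normc (phi' x * f x)); have := sqr_ge0 (normc (v x)); lra.
set V := RI (fun x => normc (v x) ^+ 2); set F2 := RI (fun x => normc (f x) ^+ 2).
set al := RI (fun x => \1_E x * normc (f x) ^+ 2).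
(* The projection property is tested on v itself. *)
have VE : V = RI (fun x => complex.Re (phi' x * f x * (v x)^*)).
  have [H0 _] := Pv v Hv.
  have mpf0 := cmeasurableM _ _ mphi mf.
  have R0 : RI (fun x => complex.Re ((phi x * f x - v x) * (v x)^*)) = 0.
    by rewrite /RI /Rintegral H0.
  have E1 : RI (fun x => complex.Re ((phi x * f x - v x) * (v x)^*)) =
      RI (fun x => complex.Re (phi' x * f x * (v x)^*) - normc (v x) ^+ 2).
    apply: ae_eq_RI.
    - exact: (proj1 (cmeasurableM _ _ (cmeasurableB _ _ mpf0 mv) mg)).
    - exact: mfunB (proj1 mpfv) (mfunX _ 2 nmv).
    apply: ae_imp phiE => x ->; rewrite mulrBl ReD ReN; congr (_ - _).
    by rewrite -sqmodE /sqmod; case: (v x) => a b /=; ring.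
  by apply/esym/eqP; rewrite -subr_eq0 -RIB // -E1 R0.
(* From 2 Re <phi f, v> <= |phi f|^2 + |v|^2, whose left side is 2 |v|^2. *)
have V1 : V <= F2 - k * al.
  have h1 : 2 * V <= RI (fun x => normc (phi' x * f x) ^+ 2) + V.
    rewrite {1}VE -RIZ // -RID //; apply: le_RI; [exact: iblZ|exact: iblD|] => x.
    have h : complex.Re (phi' x * f x * (v x)^*) <= normc (phi' x * f x) * normc (v x).
      by apply: le_trans (ler_norm _) _; apply: le_trans (Re_le_normc _) _; rewrite normcM nv.
    have := sqr_ge0 (normc (phi' x * f x) - normc (v x)); lra.
  have h2 : RI (fun x => normc (phi' x * f x) ^+ 2) <= F2 - k * al.
    rewrite /al -RIZ // -RIB //; last exact: iblZ.
    apply: le_RI => //; first by apply: iblB => //; exact: iblZ.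
    move=> x; rewrite normcM exprMn.
    have fx := sqr_ge0 (normc (f x)).
    suff h : normc (phi' x) ^+ 2 <= 1 - k * \1_E x.
      by apply: le_trans (ler_wpM2r fx h) _; rewrite mulrBl mul1r -mulrA.
    have [xE|xE] := pselect (E x).
      have Ekx := Ek x xE; rewrite indicE mem_set // mulr1 phi'E; first by rewrite -sqmodE.
      lra.
    by rewrite indicE memNset // mulr0 subr0 exprn_ile1 ?normc_ge0.
  lra.
pose m x := 1 / 2 + C * \1_E x.
have mm : mfun m by apply: mfunD; [exact: mfun_cst|apply: mfunM => //; exact: mfun_cst].
have m01 x : 0 <= m x <= 1 / 2 + C.
  have /andP [i0 i1] := ind01 x; have := mulr_ge0 C0 i0; have := ler_wpM2l C0 i1.
  by rewrite /m; lra.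
have bs' : {ae leb R, forall x, \forall n \near \oo, normc (beta (Complex x (yseq n)) - phi' x) <= m x}.
  by apply: ae_imp2 phiE bs => x ->.
have V2 : V <= 2^-1 * F2 + 2 * C ^+ 2 * al.
  have := boundary_pairing beta F G f (fun x => (v x)^*) phi' m C 1 (1 / 2 + C) M M2
    hb bC mphi' phi'1 mm m01 bs' hF hG.
  rewrite -VE => h.
  have i1 := iblZ (1 / 4) _ if2; have i2 := iblZ (1 / 2) _ iv2; have i3 := iblZ (C ^+ 2) _ iEf.
  (* Young's inequality on each part of [m]: |f||v|/2 <= |f|^2/4 + |v|^2/4, and on [E] also C|f||v|
     <= C^2|f|^2 + |v|^2/4. The total coefficient 1/2 of |v|^2 can be absorbed on the left, and
     doubling gives the constants of [V2]. *)
  have h2 : RI (fun x => m x * (normc (f x) * normc (v x)^*)) <=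
     1 / 4 * F2 + 1 / 2 * V + C ^+ 2 * al.
    rewrite /F2 /V /al -!RIZ // -!RID //; last exact: iblD.
    apply: le_RI; last 1 first.
    - move=> x; rewrite nv /m; have /andP [i0 _] := ind01 x.
      have sq1 := sqr_ge0 (normc (f x) - normc (v x)).
      have sq2 := sqr_ge0 (C * normc (f x) - normc (v x) / 2).
      have := sqr_ge0 (normc (v x)).
      rewrite indicE; case: (_ \in _) => /=; nra.
    - apply: ibl_le (mfunM _ _ mm (mfunM _ _ nmf (mfun_normc _ mg))) _
        (iblZ (1 / 2 + C) _ (iblD _ _ if2 iv2)) => x.
      have /andP [m0 mC] := m01 x.
      have nf0 := normc_ge0 (f x); have nv0 := normc_ge0 (v x).
      rewrite nv ger0_norm ?mulr_ge0 //.
      apply: ler_pM; rewrite ?mulr_ge0 //.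
      by have := sqr_ge0 (normc (f x) - normc (v x)); have := sqr_ge0 (normc (f x));
         have := sqr_ge0 (normc (v x)); lra.
    - by apply: iblD => //; exact: iblD.
  by move: (le_trans h h2); lra.
rewrite L2norm_Jop // !L2normE; apply: sqrt_le_of_two_bounds k0 V1 V2 _.
by apply: RI_ge0 => x; exact: sqr_ge0.
Qed.
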